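(* Let $r\in[0,1]$. Under the Levi-Civita transformations $q_i(t)=z_i(\tau_{z_i}(t))^2$, $i=1,2$, with time changes satisfying $\frac{dt}{q_i(t)}=\frac{d\tau_{z_i}(t)}{\|z_i\|^2}$, critical points $(z_1,z_2)$ of the regularized action functional $\mathcal B_r=r\,\mathcal B_{in}+(1-r)\,\mathcal B_{av}:\mathcal H^1_{in}\to\mathbb R$ are in 4-to-1 correspondence with generalized solutions $(q_1,q_2)$ of the interpolated system $$\ddot q_1(t)=-\frac{2}{q_1(t)^2}+\frac{r}{(q_1(t)-q_2(t))^2}+\frac{1-r}{(\bar q_1-\bar q_2)^2},\qquad \ddot q_2(t)=-\frac{2}{q_2(t)^2}-\frac{r}{(q_1(t)-q_2(t))^2}-\frac{1-r}{(\bar q_1-\bar q_2)^2}.$$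
   Context: Notation: $S^1=\mathbb R/\mathbb Z$; $\|f\|^2=\int_0^1 f(\tau)^2d\tau$ (so $\|z^2\|^2=\int_0^1z^4d\tau$); $H^k=W^{k,2}$; $\bar q=\int_0^1q(t)dt$. Time changes: for $z\in C^0(S^1,\mathbb R)$ with finite zero set let $t_z:S^1\to S^1$, $t_z(\tau)=\|z\|^{-2}\int_0^\tau z(\sigma)^2d\sigma$. This is a homeomorphism, and $\tau_z:=t_z^{-1}$. The Levi-Civita transform of $z$ is $q(t)=z(\tau_z(t))^2$. Space and functionals: $\mathcal H^1_{in}=\{(z_1,z_2)\in H^1(S^1,\mathbb R^2): \|z_1\|>0,\ \|z_2\|>0,\ z_1^2(\tau)-z_2^2(\tau_{z_2}(t_{z_1}(\tau)))>0\ \text{for all }\tau\in S^1\}$, an open subset of $H^1(S^1,\mathbb R^2)$. On it $\mathcal Q(z_i)=2\|z_i\|^2\|z_i'\|^2+\frac{2}{\|z_i\|^2}$, $\mathcal I(z_1,z_2)=-\frac1{\|z_1\|^2}\int_0^1\frac{z_1(\tau)^2}{z_1^2(\tau)-z_2^2(\tau_{z_2}(t_{z_1}(\tau)))}d\tau$, $\mathcal A(z_1,z_2)=-\frac{\|z_1\|^2\|z_2\|^2}{\|z_1^2\|^2\|z_2\|^2-\|z_2^2\|^2\|z_1\|^2}$, $\mathcal B_{in}=\mathcal Q(z_1)+\mathcal Q(z_2)+\mathcal I(z_1,z_2)$, $\mathcal B_{av}=\mathcal Q(z_1)+\mathcal Q(z_2)+\mathcal A(z_1,z_2)$. A generalized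 solution of the system is a pair $(q_1,q_2)\in H^1(S^1,\mathbb R_{\ge0}\times\mathbb R_{\ge0})$ such that for $i=1,2$: (1) $q_1(t)>q_2(t)$ for all $t\in S^1$; (2) the zero sets $Z_i=q_i^{-1}(0)\subset S^1$ are finite and each have an even number of elements; (3) the restricted maps $q_i:S^1\setminus Z_i\to\mathbb R_{\ge0}$ are smooth and satisfy the system; (4) the energies $E_i(t)=\frac{\dot q_i(t)^2}{2}-\frac{2}{q_i(t)}$, $t\in S^1\setminus Z_i$, extend to continuous functions $E_i:S^1\to\mathbb R$.
   Formalization: In (3), ''smooth'' off Z_i is read as C^2 off Z_i and C^infinity off Z_1 and Z_2: for r>0, q_1 cannot be C^infinity at zeros of q_2, so the literal class is empty; for r=0 the two agree. If z has infinitely many zeros, tau_z is the least preimage. *)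

(* Defs.v *)
From HB Require Import structures.
From mathcomp Require Import all_boot all_order all_algebra.
From mathcomp Require Import all_classical all_reals all_analysis.

Set Implicit Arguments.
Unset Strict Implicit.
Unset Printing Implicit Defensive.

Import Order.TTheory GRing.Theory Num.Theory.
Import numFieldNormedType.Exports.

Local Open Scope classical_set_scope.
Local Open Scope ring_scope.

(* Functions on the circle S^1 = R/Z are represented by
   1-periodic functions R -> R, and self-maps of S^1 by their lifts to R;
   subsets of S^1 are counted in the fundamental domain [0, 1[. *)

Section Circle.
Variable R : realType.
Implicit Types f g h z q : R -> R.

Definition int01 f : R := \int[lebesgue_measure]_(x in `[0, 1]) f x.

(* ||f||^2 *)
Definition sqnorm f : R := int01 (fun x => f x ^+ 2).

Definition periodic1 f := forall t, f (t + 1) = f t.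

(* C^k on an open set A. *)
Definition Ck_on (k : nat) (A : set R) f :=
  forall x, A x ->
    (forall j, (j < k)%N -> derivable (derive1n j f) x 1) /\
    {for x, continuous (derive1n k f)}.

Definition Cinfty_on (A : set R) f := forall k, Ck_on k A f.

Definition test_function f := periodic1 f /\ Cinfty_on setT f.

Definition in_L2 g :=
  measurable_fun (`[0, 1] : set R) g /\
  lebesgue_measure.-integrable (`[0, 1] : set R) (fun x => (g x ^+ 2)%:E).

Definition weak_derivative f g :=
  in_L2 g /\
  forall phi, test_function phi ->
    int01 (fun x => f x * derive1 phi x) = - int01 (fun x => g x * phi x).

(* W^{1,2}(S^1, R); each class is represented by its continuous member, so
   that pointwise values make sense and equality of classes is equality of
   functions. *)
Definition H1 f :=
  [/\ periodic1 f, continuous f & exists g, weak_derivative f g].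

(* A weak derivative of f; it is unique almost everywhere on [0, 1]. *)
Definition wderiv f : R -> R := xget (fun=> 0) [set g | weak_derivative f g].

(* The lift of t_z to R: ||z||^{-2} times the oriented integral of z^2 from 0
   to tau (for tau < 0 the first interval is empty, for tau > 0 the second). *)
Definition time_change z (tau : R) : R :=
  (sqnorm z)^-1 *
  (\int[lebesgue_measure]_(s in `[0, tau]) (z s ^+ 2) -
   \int[lebesgue_measure]_(s in `[tau, 0]) (z s ^+ 2)).

(* tau_z.  If z has finitely many zeros on the circle, t_z is a homeomorphism
   and this is its inverse.  In general (||z|| > 0) t_z is still continuous,
   nondecreasing and onto, and z vanishes identically on every interval where
   t_z is constant, so z(tau_z(t)) does not depend on which preimage of t
   is selected. *)
Definition inv_time_change z (t : R) : R :=
  inf [set tau | time_change z tau = t].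

Definition levi_civita z (t : R) : R := z (inv_time_change z t) ^+ 2.

Definition zero_set f : set R := [set t | 0 <= t < 1 /\ f t = 0].

(* z has a time change in the strict sense (finite zero set), and
   dt / q(t) = d tau_z(t) / ||z||^2 off the zeros of q. *)
Definition regular_time_change z :=
  finite_set (zero_set z) /\
  forall t, levi_civita z t != 0 ->
    is_derive t 1 (inv_time_change z) (sqnorm z / levi_civita z t).

End Circle.

Section Functionals.
Variable R : realType.
Local Notation pair2 := ((R -> R) * (R -> R))%type.
Implicit Types z h q : pair2.

Definition H1_pair z := H1 z.1 /\ H1 z.2.

Definition H1_norm z : R :=
  Num.sqrt (sqnorm z.1 + sqnorm (wderiv z.1) +
            (sqnorm z.2 + sqnorm (wderiv z.2))).

(* z_1(tau)^2 - z_2(tau_{z_2}(t_{z_1}(tau)))^2 *)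
Definition gap z (tau : R) : R :=
  z.1 tau ^+ 2 - z.2 (inv_time_change z.2 (time_change z.1 tau)) ^+ 2.

Definition H1_in : set pair2 :=
  [set z | [/\ H1_pair z, 0 < sqnorm z.1, 0 < sqnorm z.2
             & forall tau, 0 < gap z tau]].

Definition Qfun (f : R -> R) : R :=
  2 * sqnorm f * sqnorm (wderiv f) + 2 / sqnorm f.

Definition Ifun z : R :=
  - ((sqnorm z.1)^-1 * int01 (fun tau => z.1 tau ^+ 2 / gap z tau)).

Definition Afun z : R :=
  let sq f := sqnorm (fun x : R => f x ^+ 2) in
  - (sqnorm z.1 * sqnorm z.2 /
     (sq z.1 * sqnorm z.2 - sq z.2 * sqnorm z.1)).

Definition B_in z : R := Qfun z.1 + Qfun z.2 + Ifun z.

Definition B_av z : R := Qfun z.1 + Qfun z.2 + Afun z.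

Definition B_r (r : R) z : R := r * B_in z + (1 - r) * B_av z.

(* z lies in the open set D of H^1(S^1, R^2), and F : D -> R is Frechet
   differentiable at z with differential 0. *)
Definition critical_point (D : set pair2) (F : pair2 -> R) z :=
  D z /\
  forall e : R, 0 < e -> exists2 d : R, 0 < d &
    forall h, H1_pair h -> H1_norm h < d -> D (z + h) ->
      `|F (z + h) - F z| <= e * H1_norm h.

Definition LC z : pair2 := (levi_civita z.1, levi_civita z.2).

Definition nonzero (f : R -> R) : set R := [set t | f t != 0].

Definition even_zero_set (f : R -> R) :=
  exists n : nat, (zero_set f #= `I_(n.*2))%card.

Definition interpolated_system1 (r : R) q (t : R) :=
  derive1n 2 q.1 t = - (2 / q.1 t ^+ 2) + r / (q.1 t - q.2 t) ^+ 2
             + (1 - r) / (int01 q.1 - int01 q.2) ^+ 2.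

Definition interpolated_system2 (r : R) q (t : R) :=
  derive1n 2 q.2 t = - (2 / q.2 t ^+ 2) - r / (q.1 t - q.2 t) ^+ 2
             - (1 - r) / (int01 q.1 - int01 q.2) ^+ 2.

Definition energy_extends (f : R -> R) :=
  exists E : R -> R,
    [/\ periodic1 E, continuous E
      & forall t, f t != 0 -> E t = derive1 f t ^+ 2 / 2 - 2 / f t].

(* Regularity: q_i is C^2 wherever its own equation is imposed, i.e. off its own
   zeros, and C^oo off the zeros of both components.  For i = 2 this is plain
   smoothness on the complement of Z_2, because q_1 > q_2 >= 0 has no zeros.
   For i = 1 it cannot be improved when r > 0: at a zero of q_2 the function
   q_2 is only Hoelder continuous and enters the equation of q_1, so q_1 is
   C^2 but not C^oo there. *)
Definition regular_off_zeros q :=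
  forall f, f = q.1 \/ f = q.2 ->
    Ck_on 2 (nonzero f) f /\ Cinfty_on (nonzero q.1 `&` nonzero q.2) f.

Definition generalized_solution (r : R) : set pair2 :=
  [set q |
    [/\ H1_pair q,
        (forall t, 0 <= q.1 t /\ 0 <= q.2 t),
        (forall t, q.2 t < q.1 t),
        even_zero_set q.1 /\ even_zero_set q.2 &
     [/\ regular_off_zeros q,
         (forall t, nonzero q.1 t -> interpolated_system1 r q t),
         (forall t, nonzero q.2 t -> interpolated_system2 r q t)
       & energy_extends q.1 /\ energy_extends q.2]]].

End Functionals.

(* F maps A to B, and every element of B has exactly k preimages in A. *)
Definition k_to_one (T U : Type) (k : nat) (A : set T) (B : set U) (F : T -> U) :=
  (forall x, A x -> B (F x)) /\
  (forall y, B y -> ([set x | A x /\ F x = y] #= `I_k)%card).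

(* Main.v *)
(* To first order the interaction of the two particles decouples: (z1, z2) is critical iff
   each z_i is stationary for a one-body action Q(z) + int f q dt, where q = z^2 o t_z^-1 and
   the force f = r/(q1 - q2)^2 + (1 - r)/(mean q1 - mean q2)^2 is frozen, with sign + for z1
   and - for z2.  With C = ||z||^2, stationarity means 2 C^2 z'' = (e + f(t_z) z^2) z, where
   the energy e satisfies e' = 2 f(t_z) z z' and z^2 e = 2 C^2 z'^2 - 2, so that the zeros of
   z are simple.  That e is periodic follows for z1 from z1(0) <> 0, and then for z2 because
   f (q1' - q2') is an exact derivative.

   Conversely, for a generalized solution q with energy E the function W = q q' is continuous
   and W' = 2/q + 2 E + f q, so (W - int (2 E + f q))/2 is a primitive of 1/q; it determines
   the time change and C.  Then z is sqrt q with a sign that alternates at the zeros, which is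
   consistent on the circle because their number is even.  Two lifts of the same q_i have the
   same time change and the same square, hence agree up to a global sign: 2 x 2 = 4 lifts. *)

Require Import Defs.
From mathcomp Require Import all_boot all_order all_algebra.
From mathcomp Require Import all_classical all_reals all_analysis.
From mathcomp Require Import measurable_realfun ring lra.

Set Implicit Arguments.
Unset Strict Implicit.
Unset Printing Implicit Defensive.
Import Order.TTheory GRing.Theory Num.Theory.
Import numFieldNormedType.Exports.
Local Open Scope classical_set_scope.
Local Open Scope ring_scope.

(** * Integrals on intervals *)

(** At a general point of the domain z2 may vanish on an interval, so [inv_time_change] may jump,
    and at that stage q is only shown to be continuous. The inverse time change is therefore never
    differentiated with respect to z. Integrals against q are pulled back to tau, where only t_z
    occurs, and an integration by parts leaves a primitive of the weight to be composed with t_z.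
    The map from z to q is thus expanded only after integration against a fixed continuous weight;
    pointwise, q is merely shown to move little. The remainder of the interaction has the order of
    int delta^2, where delta is the variation of q1 - q2. It becomes o(|h|) because the Lipschitz
    bound for int f q involves f only through sup |f|, so that delta itself may serve as the weight.
    Finiteness of the zero sets, invertibility of t_z and membership of q in H^1 are all
    consequences of the energy relation. *)

Section EpsilonDelta.
Variable R : realType.
Implicit Types (f g : R -> R) (a b c d e x y : R).

Lemma continuous_atP f x : {for x, continuous f} <->
  forall e, 0 < e -> exists2 d : R, 0 < d & forall y, `|y - x| < d -> `|f y - f x| < e.
Proof.
split=> [/cvgrPdist_lt fx e e0|H].
  have /nbhs_ballP[d /= d0 dP] := fx e e0.
  exists d => // y yx; rewrite distrC; apply: dP.
  by rewrite /ball /= distrC.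
apply/cvgrPdist_lt => e e0; have [d d0 dP] := H e e0.
apply/nbhs_ballP; exists d => //= y; rewrite /ball /= => yx.
by rewrite distrC; apply: dP; rewrite distrC.
Qed.

Lemma is_deriveP f x a : is_derive x 1 f a <->
  forall e, 0 < e -> exists2 d : R, 0 < d &
    forall y, `|y - x| < d -> `|f y - f x - a * (y - x)| <= e * `|y - x|.
Proof.
split=> [/is_derive1_caratheodory[g [fE gx gE]] e e0|H].
  have [d d0 dP] := (continuous_atP g x).1 gx e e0.
  exists d => // y yx; rewrite fE -gE -mulrBl normrM ler_wpM2r//.
  by rewrite ltW// dP.
apply/is_derive1_caratheodory.
exists (fun y => if y == x then a else (f y - f x) / (y - x)); split.
- move=> y /=; case: (eqVneq y x) => [->|yx]; first by rewrite !subrr mulr0.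
  by rewrite divfK// subr_eq0.
- apply/continuous_atP => e e0; rewrite eqxx.
  have e20 : 0 < e / 2 by rewrite divr_gt0.
  have [d d0 dP] := H _ e20; exists d => // y yxd /=.
  case: (eqVneq y x) => [_|yx]; first by rewrite subrr normr0.
  have yx0 : 0 < `|y - x| by rewrite normr_gt0 subr_eq0.
  rewrite -(ltr_pM2r yx0) -normrM mulrBl divfK ?subr_eq0//.
  by rewrite (le_lt_trans (dP _ yxd))// ltr_pM2r// ltr_pdivrMr// mulr_natr mulr2n ltrDl.
- by rewrite eqxx.
Qed.

Lemma is_derive_continuous f x a : is_derive x 1 f a -> {for x, continuous f}.
Proof.
by move=> fa; apply/differentiable_continuous/derivable1_diffP.
Qed.

Lemma continuous_derive f f' : (forall x, is_derive x 1 f (f' x)) -> continuous f.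
Proof. by move=> ff' x; apply: is_derive_continuous (ff' x). Qed.

Lemma continuous_within f a b : continuous f -> {within `[a, b], continuous f}.
Proof. by move=> cf; apply: continuous_subspaceT. Qed.

Lemma MVT_le f f' a b : a <= b -> (forall x, a < x < b -> is_derive x 1 f (f' x)) ->
  (forall x, a <= x <= b -> {for x, continuous f}) ->
  exists2 c, a <= c <= b & f b - f a = f' c * (b - a).
Proof.
move=> ab df cf.
have H1 x : x \in `]a, b[ -> is_derive x 1 f (f' x) by rewrite in_itv/= => /df.
have H2 : {within `[a, b], continuous f}.
  by apply: continuous_in_subspaceT => x; rewrite inE/= in_itv/= => xab; exact: cf.
have [c] := MVT_segment ab H1 H2.
by rewrite in_itv/= => cab E; exists c.
Qed.

Lemma MVT_between (p p' : R -> R) x y : (forall s : R, is_derive s 1 p (p' s)) ->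
  exists2 c, `|c - x| <= `|y - x| & p y - p x = p' c * (y - x).
Proof.
move=> dp; have cp s : {for s, continuous p} := is_derive_continuous (dp s).
have [xy|/ltW yx] := leP x y.
  have [c /andP[xc cy] E] := @MVT_le p p' x y xy (fun s _ => dp s) (fun s _ => cp s).
  by exists c => //; rewrite !ger0_norm ?subr_ge0// lerD2r.
have [c /andP[yc cx] E] := @MVT_le p p' y x yx (fun s _ => dp s) (fun s _ => cp s).
exists c; first by rewrite !ler0_norm ?subr_le0// !opprB lerD2l lerN2.
by rewrite -[LHS]opprB E; ring.
Qed.

(* Heine-Cantor; the second point may leave the compact interval. *)
Lemma uniform_continuous_itv f a b : continuous f ->
  forall e, 0 < e -> exists2 d : R, 0 < d &
    forall x y, a <= x <= b -> `|y - x| < d -> `|f y - f x| < e.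
Proof.
move=> cf e e0.
have e20 : 0 < e / 2 by rewrite divr_gt0.
(* The near-covering form of compactness provides one d valid for all x at once. *)
have /compact_near_coveringP K := @segment_compact R a b.
pose P (d x : R) := forall y, `|y - x| < d -> `|f y - f x| < e.
have : \forall d \near 0^'+, `[a, b] `<=` P d.
  apply: K => x _; have [d d0 dP] := (continuous_atP f x).1 (cf x) _ e20.
  have d20 : 0 < d / 2 by rewrite divr_gt0.
  exists (ball x (d / 2), [set r | r < d / 2]).
    split; first exact: nbhsx_ballx.
    exact: nbhs_right_lt.
  move=> [x' r] /= [x'x rd] y yx'.
  rewrite /ball /= in x'x.
  have A : `|f y - f x| < e / 2.
    apply: dP; rewrite (_ : y - x = (y - x') + (x' - x)); last by ring.
    rewrite (le_lt_trans (ler_normD _ _))// (_ : d = d / 2 + d / 2); last by field.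
    by rewrite ltrD// ?(lt_trans yx')// distrC.
  have B : `|f x - f x'| < e / 2.
    rewrite distrC; apply: dP; rewrite distrC (lt_trans x'x)//.
    by rewrite ltr_pdivrMr// mulr_natr mulr2n ltrDl.
  rewrite (_ : f y - f x' = (f y - f x) + (f x - f x')); last by ring.
  rewrite (le_lt_trans (ler_normD _ _))// (_ : e = e / 2 + e / 2); last by field.
  exact: ltrD.
move=> H; near ((0:R)^'+) => d.
exists d => // x y xab; have : (`[a, b] `<=` P d) by near: d.
by apply; rewrite /= in_itv.
Unshelve. all: by end_near. Qed.

Lemma bounded_itv f a b : continuous f ->
  exists2 M : R, 0 < M & forall x, a <= x <= b -> `|f x| <= M.
Proof.
move=> cf; have [ab|ba] := leP a b; last first.
  by exists 1 => // x /andP[ax xb]; move: (le_lt_trans (le_trans ax xb) ba); rewrite ltxx.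
have cn : continuous (fun x => `|f x|) by move=> x; apply: continuous_comp; [exact: cf|exact: norm_continuous].
have [c cab cP] := EVT_max ab (continuous_within (a:=a) (b:=b) cn).
exists (`|f c| + 1); first by rewrite ltr_wpDl.
move=> x xab; rewrite (le_trans (cP x _))//; last by rewrite lerDl.

Qed.

End EpsilonDelta.

Section Integrals.
Variable R : realType.
Implicit Types (f g : R -> R) (a b c d e x y : R).
Local Notation mu := (@lebesgue_measure R).

(* If the increments of Phi are negligible with respect to those of a control
   function M, uniformly on small intervals, then Phi is constant. *)
Lemma negligible_increments (Phi M : R -> R) a b : a <= b ->
  (forall e, 0 < e -> exists2 d : R, 0 < d & forall x y, a <= x -> x <= y -> y <= b ->
     y - x < d -> `|Phi y - Phi x| <= e * (M y - M x)) ->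
  Phi b = Phi a.
Proof.
move=> ab H.
have E e : 0 < e -> `|Phi b - Phi a| <= e * (M b - M a).
  move=> e0; have [d d0 dP] := H e e0.
  have d20 : 0 < d / 2 by rewrite divr_gt0.
  (* Induction on the number of steps of length d / 2 that lead from a to x. *)
  have K : forall n x, a <= x -> x <= b -> x - a <= n%:R * (d / 2) ->
      `|Phi x - Phi a| <= e * (M x - M a).
    elim=> [|n IH] x ax xb xn.
      have -> : x = a by lra.
      by rewrite !subrr normr0 mulr0.
    have [xd|xd] := leP (x - a) (d / 2).
      by apply: dP => //; lra.
    have := IH (x - d / 2); rewrite -natr1 in xn => {}IH.
    have A := IH ltac:(lra) ltac:(lra) ltac:(lra).
    have B := dP (x - d / 2) x ltac:(lra) ltac:(lra) xb ltac:(lra).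
    rewrite (_ : Phi x - Phi a = (Phi x - Phi (x - d / 2)) + (Phi (x - d / 2) - Phi a)); last by ring.
    rewrite (le_trans (ler_normD _ _))//; lra.
  apply: (K (Num.trunc ((b - a) / (d / 2))).+1) => //.
  rewrite -ler_pdivrMr//; apply/ltW/truncnS_gt.
have M0 : 0 <= M b - M a.
  by have := E 1 ltr01; rewrite mul1r; apply: le_trans.
apply/eqP; rewrite -subr_eq0 -normr_eq0 -(negbK (_ == 0)) ; apply/negP => Phi0.
have P0 : 0 < `|Phi b - Phi a| by rewrite lt_neqAle eq_sym Phi0/=.
(* For this e the bound E reads M b - M a + 1 <= M b - M a; the 1 also covers the case M b = M a. *)
have e0 : 0 < `|Phi b - Phi a| / (M b - M a + 1) by rewrite divr_gt0// ltr_wpDl.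
have := E _ e0; rewrite mulrAC ler_pdivlMr ?ltr_wpDl// ler_pM2l//.
by rewrite gerDl ler10.
Qed.

Definition integrable_on a b f := mu.-integrable `[a, b] (EFin \o f).
Definition itg a b f : R := \int[mu]_(x in `[a, b]) f x.

Lemma int01E f : int01 f = itg 0 1 f. Proof. by []. Qed.

Lemma integrable_onS a b c d f : a <= c -> d <= b ->
  integrable_on a b f -> integrable_on c d f.
Proof.
move=> ac db; apply: integrableS => //.
by move=> x /=; rewrite !in_itv/= => /andP[cx xd]; rewrite (le_trans ac)//= (le_trans xd).
Qed.

Lemma continuous_integrable_on a b f : continuous f -> integrable_on a b f.
Proof.
move=> cf; apply: continuous_compact_integrable; first exact: segment_compact.
exact: continuous_within.
Qed.

Lemma integrable_onD a b f g : integrable_on a b f -> integrable_on a b g ->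
  integrable_on a b (fun x => f x + g x).
Proof. by move=> If Ig; apply: (integrableD _ If Ig). Qed.

Lemma integrable_onZ a b c f : integrable_on a b f -> integrable_on a b (fun x => c * f x).
Proof. by move=> If; apply: (integrableZl _ c If). Qed.

Lemma integrable_onN a b f : integrable_on a b f -> integrable_on a b (fun x => - f x).
Proof. by move=> If; apply: (integrableN If). Qed.

Lemma integrable_onB a b f g : integrable_on a b f -> integrable_on a b g ->
  integrable_on a b (fun x => f x - g x).
Proof. by move=> If Ig; apply: integrable_onD => //; apply: integrable_onN. Qed.

Lemma integrable_on_norm a b f : integrable_on a b f -> integrable_on a b (fun x => `|f x|).
Proof. by move=> If; apply: integrable_norm. Qed.

Lemma integrable_on_measurable a b f : integrable_on a b f -> measurable_fun `[a, b] f.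
Proof. by move=> /integrableP[/measurable_EFinP]. Qed.

Lemma integrable_on_le a b f g : measurable_fun `[a, b] f -> integrable_on a b g ->
  (forall x, a <= x <= b -> `|f x| <= g x) -> integrable_on a b f.
Proof.
move=> mf Ig fg; apply: (le_integrable _ _ _ Ig) => //.
  exact/measurable_EFinP.
move=> x; rewrite /= in_itv/= => /fg h; rewrite lee_fin.
by rewrite (le_trans h) ?ler_norm.
Qed.

Lemma continuous_measurable_itv a b f : continuous f -> measurable_fun `[a, b] f.
Proof. by move=> /(@continuous_integrable_on a b)/integrable_on_measurable. Qed.

Lemma integrable_onM a b f g : continuous f -> integrable_on a b g ->
  integrable_on a b (fun x => f x * g x).
Proof.
move=> cf Ig; have [M M0 MP] := bounded_itv a b cf.
apply: (@integrable_on_le _ _ _ (fun x => M * `|g x|)).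
- apply: measurable_funM; first exact: continuous_measurable_itv.
  exact: integrable_on_measurable.
- exact/integrable_onZ/integrable_on_norm.
- by move=> x /MP fM; rewrite normrM ler_wpM2r.
Qed.

Lemma eq_itg a b f g : (forall x, a <= x <= b -> f x = g x) -> itg a b f = itg a b g.
Proof.
by move=> fg; apply: eq_Rintegral => x; rewrite inE/= in_itv/=; apply: fg.
Qed.

Lemma eq_integrable_on a b f g : (forall x, a <= x <= b -> f x = g x) ->
  integrable_on a b f -> integrable_on a b g.
Proof.
by move=> fg; apply: eq_integrable => // x; rewrite inE/= in_itv/= => /fg ->.
Qed.

Lemma itgD a b f g : integrable_on a b f -> integrable_on a b g ->
  itg a b (fun x => f x + g x) = itg a b f + itg a b g.
Proof. by move=> If Ig; apply: RintegralD. Qed.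

Lemma itgB a b f g : integrable_on a b f -> integrable_on a b g ->
  itg a b (fun x => f x - g x) = itg a b f - itg a b g.
Proof. by move=> If Ig; apply: RintegralB. Qed.

Lemma itgZ a b c f : integrable_on a b f -> itg a b (fun x => c * f x) = c * itg a b f.
Proof. by move=> If; apply: RintegralZl. Qed.

Lemma itgN a b f : integrable_on a b f -> itg a b (fun x => - f x) = - itg a b f.
Proof.
move=> If; rewrite -mulN1r -itgZ//.
by apply: eq_itg => x _; rewrite mulN1r.
Qed.

Lemma itg_cst a b c : a <= b -> itg a b (fun=> c) = c * (b - a).
Proof.
move=> ab; rewrite /itg Rintegral_cst//=; congr (_ * _).
have -> : (lebesgue_measure `[a, b] = (b - a)%:E)%E; last by [].
rewrite lebesgue_measure_itv/= lte_fin.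
have [ab'|ba] := ltP a b; first by rewrite -EFinD.
have E : a = b by lra.
by rewrite E subrr.
Qed.

Lemma itg_le a b f g : integrable_on a b f -> integrable_on a b g ->
  (forall x, a <= x <= b -> f x <= g x) -> itg a b f <= itg a b g.
Proof. by move=> If Ig fg; apply: le_Rintegral => // x; rewrite /= in_itv/=; apply: fg. Qed.

Lemma itg_ge0 a b f : (forall x, a <= x <= b -> 0 <= f x) -> 0 <= itg a b f.
Proof. by move=> f0; apply: Rintegral_ge0 => x; rewrite /= in_itv/=; apply: f0. Qed.

Lemma itg_norm a b f : integrable_on a b f -> `|itg a b f| <= itg a b (fun x => `|f x|).
Proof. by move=> If; apply: le_normr_Rintegral. Qed.

Lemma itg_norm_le a b f g : integrable_on a b f -> integrable_on a b g ->
  (forall x, a <= x <= b -> `|f x| <= g x) -> `|itg a b f| <= itg a b g.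
Proof.
move=> If Ig fg; apply: (le_trans (itg_norm If)).
by apply: itg_le => //; apply: integrable_on_norm.
Qed.

Lemma itg_xx a f : itg a a f = 0.
Proof. by rewrite /itg set_itv1 Rintegral_set1. Qed.

Lemma itg_gt a b f : b < a -> itg a b f = 0.
Proof. by move=> ba; rewrite /itg set_itv_ge ?Rintegral_set0// bnd_simp -ltNge. Qed.

Lemma itg_split a c b f : a <= c <= b -> integrable_on a b f ->
  itg a b f = itg a c f + itg c b f.
Proof.
move=> /andP[ac cb] If; rewrite /itg.
have := @Rintegral_itvB R f (BLeft a) (BRight b) c If.
rewrite !bnd_simp => /(_ ac cb).
rewrite Rintegral_itv_obnd_cbnd; first by move=> <-; rewrite addrC subrK.
move: If; apply: integrableS => //.
by move=> x /=; rewrite !in_itv/= => /andP[/ltW cx ->]; rewrite (le_trans ac).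
Qed.

End Integrals.

(** * Absolutely continuous functions *)

Section AbsolutelyContinuous.
Variable R : realType.
Implicit Types (f g u v : R -> R) (a b c d e x y s t : R).
Local Notation mu := (@lebesgue_measure R).

(** Extends primitives from [0, 1] to functions continuous on the whole line, as [AC01] requires. *)
Definition clamp01 x : R := Num.max 0 (Num.min x 1).

Lemma clamp01_itv x : 0 <= clamp01 x <= 1.
Proof. by rewrite /clamp01; apply/andP; split; rewrite ?le_max ?lexx// ge_max ler01 ge_min lexx orbT. Qed.

Lemma clamp01_id x : 0 <= x <= 1 -> clamp01 x = x.
Proof. by move=> /andP[x0 x1]; rewrite /clamp01 min_l// max_r. Qed.

Lemma clamp01_lip x y : `|clamp01 y - clamp01 x| <= `|y - x|.
Proof.
rewrite /clamp01 /Num.max /Num.min.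
rewrite ler_norml; have := ler_norm (y - x); have := ler_norm (x - y).
rewrite [`|x - y|]distrC; set n := `|y - x|.
by case: (ltP x 1) => x1; case: (ltP y 1) => y1; case: ltP => ?; case: ltP => ? *;
  apply/andP; split; lra.
Qed.

Lemma continuous_prim01 g : integrable_on 0 1 g -> continuous (fun x => itg 0 (clamp01 x) g).
Proof.
move=> Ig x; apply/continuous_atP => e e0.
have /subspace_continuousP H := parameterized_integral_continuous (@ler01 R) Ig.
have x01 : (`[0, 1]%classic : set R) (clamp01 x) by rewrite /= in_itv/=; exact: clamp01_itv.
have /cvgrPdist_lt/(_ e e0) := H _ x01.
rewrite near_withinE => /nbhs_ballP[d /= d0 dP].
exists d => // y yx; rewrite distrC; apply: dP.
  rewrite /ball /= distrC; apply: le_lt_trans yx; exact: clamp01_lip.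
by rewrite /= in_itv/=; exact: clamp01_itv.
Qed.

(** Absolute continuity on one period, expressed by the integral so that no almost everywhere
    derivative of f has to be discussed. Continuity is global, while g matters on [0, 1] only. *)
Definition AC01 f g := [/\ continuous f, integrable_on 0 1 g &
  forall x, 0 <= x <= 1 -> f x = f 0 + itg 0 x g].

Lemma AC_incr f g x y : AC01 f g -> 0 <= x -> x <= y -> y <= 1 -> f y - f x = itg x y g.
Proof.
move=> [_ Ig fE] x0 xy y1.
rewrite fE ?(le_trans x0)//= [f x]fE ?x0 ?(le_trans xy)//.
rewrite (@itg_split _ 0 x y) ?x0//; first by ring.
by apply: integrable_onS Ig.
Qed.

Lemma AC_prim g c : integrable_on 0 1 g -> AC01 (fun x => c + itg 0 (clamp01 x) g) g.
Proof.
move=> Ig; split => //.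
  by move=> x; apply: cvgD; [exact: cvg_cst|exact: continuous_prim01].
move=> x x01; rewrite !clamp01_id ?lexx ?ler01//.
by rewrite itg_xx addr0.
Qed.

Lemma eq_AC f f' g g' : continuous f' -> (forall x, 0 <= x <= 1 -> f x = f' x) ->
  (forall x, 0 <= x <= 1 -> g x = g' x) -> AC01 f g -> AC01 f' g'.
Proof.
move=> cf ff' gg' [_ Ig fE]; split => //; first exact: eq_integrable_on Ig.
move=> x x01; rewrite -!ff' ?lexx ?ler01// fE//; congr (_ + _).
by apply: eq_itg => s /andP[s0 sx]; rewrite gg'// s0 (le_trans sx)//; case/andP: x01.
Qed.

Lemma ACD f g u v : AC01 f g -> AC01 u v -> AC01 (fun x => f x + u x) (fun x => g x + v x).
Proof.
move=> [cf Ig fE] [cu Iv uE]; split.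
- by move=> x; apply: cvgD; [exact: cf|exact: cu].
- exact: integrable_onD.
- move=> x x01; rewrite fE// uE// itgD; first by ring.
  + by apply: integrable_onS Ig => //; case/andP: x01.
  + by apply: integrable_onS Iv => //; case/andP: x01.
Qed.

Lemma ACZ c f g : AC01 f g -> AC01 (fun x => c * f x) (fun x => c * g x).
Proof.
move=> [cf Ig fE]; split.
- by move=> x; apply: cvgM; [exact: cvg_cst|exact: cf].
- exact: integrable_onZ.
- move=> x x01; rewrite fE// itgZ; first by ring.
  by apply: integrable_onS Ig => //; case/andP: x01.
Qed.

Lemma cts_mul f g : continuous f -> continuous g -> continuous (fun x => f x * g x).
Proof. by move=> cf cg x; apply: cvgM; [exact: cf|exact: cg]. Qed.

Lemma cts_add f g : continuous f -> continuous g -> continuous (fun x => f x + g x).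
Proof. by move=> cf cg x; apply: cvgD; [exact: cf|exact: cg]. Qed.

Lemma cts_sub f g : continuous f -> continuous g -> continuous (fun x => f x - g x).
Proof. by move=> cf cg x; apply: cvgB; [exact: cf|exact: cg]. Qed.

Lemma cts_opp f : continuous f -> continuous (fun x => - f x).
Proof. by move=> cf x; apply: cvgN; exact: cf. Qed.

Lemma cts_scale c f : continuous f -> continuous (fun x => c * f x).
Proof. by move=> cf; apply: cts_mul => //; exact: cst_continuous. Qed.

Lemma cts_exp f n : continuous f -> continuous (fun x => f x ^+ n).
Proof. by move=> cf x; apply: (@cvg_comp _ _ _ f (fun y => y ^+ n)); [exact: cf|exact: exprn_continuous]. Qed.

Lemma cts_comp f g : continuous f -> continuous g -> continuous (fun x => f (g x)).
Proof. by move=> cf cg x; apply: continuous_comp; [exact: cg|exact: cf]. Qed.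

Lemma cts_inv f : continuous f -> (forall x, f x != 0) -> continuous (fun x => (f x)^-1).
Proof. by move=> cf f0 x; apply: cvgV; [exact: f0|exact: cf]. Qed.

(* Over [x, y] the increment of f u is int (g u(y) + f(x) v), so replacing u(y), f(x)
   by u(s), f(s) costs at most (oscillation) * int (|g| + |v|). *)
Lemma AC_mul f g u v : AC01 f g -> AC01 u v ->
  AC01 (fun x => f x * u x) (fun x => g x * u x + f x * v x).
Proof.
move=> fg uv; have [cf Ig fE] := fg; have [cu Iv uE] := uv.
have I1 : integrable_on 0 1 (fun x => g x * u x + f x * v x).
  apply: integrable_onD; last exact: integrable_onM.
  by apply: eq_integrable_on (integrable_onM cu Ig) => x _; rewrite mulrC.
split => //; first exact: cts_mul.
move=> b b01; have [b0 b1] := andP b01.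
pose Phi x := f x * u x - itg 0 x (fun x => g x * u x + f x * v x).
pose M x := itg 0 x (fun x => `|g x| + `|v x|).
have IM : integrable_on 0 1 (fun x => `|g x| + `|v x|).
  by apply: integrable_onD; apply: integrable_on_norm.
suff : Phi b = Phi 0 by rewrite /Phi itg_xx; lra.
apply: (@negligible_increments _ _ M) => // e e0.
have [d1 d10 d1P] := uniform_continuous_itv 0 1 cf e0.
have [d2 d20 d2P] := uniform_continuous_itv 0 1 cu e0.
exists (Num.min d1 d2); first by rewrite lt_min d10.
move=> x y x0 xy yb; rewrite lt_min => /andP[xy1 xy2].
have y1 := le_trans yb b1; have y0 := le_trans x0 xy; have x1 := le_trans xy y1.
have S h : integrable_on 0 1 h -> integrable_on x y h by apply: integrable_onS.
have E h : integrable_on 0 1 h -> itg 0 y h - itg 0 x h = itg x y h.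
  move=> Ih; rewrite (@itg_split _ 0 x y) ?x0//; first by rewrite addrC addKr.
  exact: integrable_onS Ih.
have -> : Phi y - Phi x = itg x y (fun s => g s * (u y - u s) + (f x - f s) * v s).
  have -> : Phi y - Phi x = u y * (f y - f x) + f x * (u y - u x)
     - itg x y (fun x => g x * u x + f x * v x) by rewrite /Phi -E//; ring.
  rewrite (AC_incr fg)// (AC_incr uv)//.
  rewrite -itgZ; last exact: S.
  rewrite -itgZ; last exact: S.
  rewrite -itgD; try (by apply/integrable_onZ/S).
  rewrite -itgB; [|by apply: integrable_onD; apply/integrable_onZ/S|exact: S].
  by apply: eq_itg => s _; ring.
rewrite /M E// -itgZ; last exact: S.
apply: itg_norm_le.
- apply/S/(eq_integrable_on (f := fun s => (u y - u s) * g s + (f x - f s) * v s)).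
    by move=> s _; ring.
  apply: integrable_onD; apply: integrable_onM => //.
    by apply: cts_sub => //; exact: cst_continuous.
  by apply: cts_sub => //; exact: cst_continuous.
- exact/integrable_onZ/S.
- move=> s /andP[xs sy]; rewrite (le_trans (ler_normD _ _))// !normrM mulrDr.
  have U : `|u y - u s| <= e.
    by apply/ltW/d2P; rewrite ?(le_trans x0)//= ?(le_trans sy)// ger0_norm; lra.
  have F : `|f x - f s| <= e.
    rewrite distrC; apply/ltW/d1P; rewrite ?x0//= ger0_norm; lra.
  by rewrite [`|g s| * _]mulrC lerD// ler_wpM2r.
Qed.

(** As for products: by the mean value theorem the increment of F o f over [x, y] is F'(c) times
    that of f, and replacing F'(c) by F'(f s) costs an oscillation of F' times int |g|. *)
Lemma AC_comp F F' f g : (forall x, is_derive x 1 F (F' x)) -> continuous F' -> AC01 f g ->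
  AC01 (fun x => F (f x)) (fun x => F' (f x) * g x).
Proof.
move=> dF cF' fg; have [cf Ig fE] := fg.
have cF := continuous_derive dF.
have cF'f : continuous (fun x => F' (f x)) by exact: cts_comp.
have I1 : integrable_on 0 1 (fun x => F' (f x) * g x) by exact: integrable_onM.
split => //; first exact: cts_comp.
move=> b b01; have [b0 b1] := andP b01.
pose Phi x := F (f x) - itg 0 x (fun x => F' (f x) * g x).
pose M x := itg 0 x (fun x => `|g x|).
have IM := integrable_on_norm Ig.
suff : Phi b = Phi 0 by rewrite /Phi itg_xx; lra.
apply: (@negligible_increments _ _ M) => // e e0.
have [m m0 mP] := bounded_itv 0 1 cf.
have [d1 d10 d1P] := uniform_continuous_itv (- m) m cF' e0.
(* Both c and f s lie within d1 / 2 of f x, hence within d1 of each other. *)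
have d12 : 0 < d1 / 2 by lra.
have [d2 d20 d2P] := uniform_continuous_itv 0 1 cf d12.
exists d2 => // x y x0 xy yb xy2.
have y1 := le_trans yb b1; have y0 := le_trans x0 xy; have x1 := le_trans xy y1.
have S h : integrable_on 0 1 h -> integrable_on x y h by apply: integrable_onS.
have E h : integrable_on 0 1 h -> itg 0 y h - itg 0 x h = itg x y h.
  move=> Ih; rewrite (@itg_split _ 0 x y) ?x0//; first by rewrite addrC addKr.
  exact: integrable_onS Ih.
have [c c1 c2] := MVT_between (f x) (f y) dF.
have -> : Phi y - Phi x = itg x y (fun s => (F' c - F' (f s)) * g s).
  have -> : Phi y - Phi x = F' c * (f y - f x)
     - itg x y (fun x => F' (f x) * g x) by rewrite /Phi -E// -c2; ring.
  rewrite (AC_incr fg)// -itgZ; last exact: S.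
  rewrite -itgB; [|exact/integrable_onZ/S|exact: S].
  by apply: eq_itg => s _; ring.
rewrite /M E// -itgZ; last exact: S.
apply: itg_norm_le.
- apply/S/integrable_onM => //.
  by apply: cts_sub => //; exact: cst_continuous.
- exact/integrable_onZ/S.
- move=> s /andP[xs sy]; rewrite normrM ler_wpM2r//.
  apply/ltW/d1P.
    by rewrite -ler_norml; apply: mP; rewrite (le_trans x0)//= (le_trans sy).
  have A : `|f y - f x| < d1 / 2 by apply: d2P; rewrite ?x0// ger0_norm; lra.
  have B : `|f s - f x| < d1 / 2 by apply: d2P; rewrite ?x0// ger0_norm; lra.
  rewrite (_ : c - f s = (c - f x) - (f s - f x)); last by ring.
  rewrite (le_lt_trans (ler_normB _ _))// (_ : d1 = d1 / 2 + d1 / 2); last by field.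
  by rewrite ltrD// (le_lt_trans c1).
Qed.

Lemma C1_AC f f' : (forall x, is_derive x 1 f (f' x)) -> continuous f' -> AC01 f f'.
Proof.
move=> df cf'; have Iid : AC01 (fun x : R => x) (fun=> 1).
  split => [x||].
    exact: cvg_id.
    by apply: continuous_integrable_on; exact: cst_continuous.
  by move=> x /andP[x0 x1]; rewrite itg_cst//; ring.
apply: eq_AC (AC_comp df cf' Iid) => //; first exact: continuous_derive df.
by move=> x _; rewrite mulr1.
Qed.

Lemma AC_cst c : AC01 (fun=> c) (fun=> 0).
Proof.
by apply: C1_AC; exact: cst_continuous.
Qed.

Lemma itg_parts f g u v : AC01 f g -> AC01 u v ->
  itg 0 1 (fun x => f x * v x) = f 1 * u 1 - f 0 * u 0 - itg 0 1 (fun x => g x * u x).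
Proof.
move=> fg uv; have [_ _ /(_ 1)] := AC_mul fg uv.
rewrite lexx ler01 => /(_ isT).
have [cf Ig _] := fg; have [cu Iv _] := uv.
rewrite itgD; first lra.
  by apply: eq_integrable_on (integrable_onM cu Ig) => x _; rewrite mulrC.
exact: integrable_onM.
Qed.

(** Oriented primitive from 0, in the two-integral form of [time_change], which makes it valid for
    negative x. *)
Definition prim f x := itg 0 x f - itg x 0 f.

Lemma prim_ge0 f x : 0 <= x -> prim f x = itg 0 x f.
Proof.
rewrite le_eqVlt /prim => /predU1P[<-|x0]; first by rewrite itg_xx subrr.
by rewrite [itg x 0 f]itg_gt// subr0.
Qed.

Lemma prim0 f : prim f 0 = 0.
Proof. by rewrite prim_ge0// itg_xx. Qed.

Lemma prim_le0 f x : x <= 0 -> prim f x = - itg x 0 f.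
Proof.
rewrite le_eqVlt /prim => /predU1P[->|x0]; first by rewrite itg_xx subrr oppr0.
by rewrite [itg 0 x f]itg_gt// sub0r.
Qed.

Lemma primB f x y : continuous f -> x <= y -> prim f y - prim f x = itg x y f.
Proof.
move=> cf xy; have I a b : integrable_on a b f by apply: continuous_integrable_on.
have [x0|x0] := leP 0 x.
  rewrite !prim_ge0//; last exact: le_trans xy.
  by rewrite (@itg_split _ 0 x y) ?x0//; ring.
have [y0|y0] := leP 0 y.
  rewrite (prim_ge0 _ y0) (prim_le0 _ (ltW x0)).
  by rewrite (@itg_split _ x 0 y) ?(ltW x0)//; ring.
rewrite !prim_le0 ?ltW//.
by rewrite (@itg_split _ x y 0) ?xy ?ltW//; ring.
Qed.

Lemma is_derive_prim f x : continuous f -> is_derive x 1 (prim f) (f x).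
Proof.
move=> cf; have I a b : integrable_on a b f by apply: continuous_integrable_on.
have W a b c e : a <= b -> (forall s, a <= s <= b -> `|f s - c| <= e) ->
    `|itg a b f - c * (b - a)| <= e * (b - a).
  move=> ab H; rewrite -!itg_cst// -itgB//; last first.
    by apply: continuous_integrable_on; exact: cst_continuous.
  apply: itg_norm_le => //; apply: continuous_integrable_on.
    by apply: cts_sub => //; exact: cst_continuous.
  exact: cst_continuous.
apply/is_deriveP => e e0.
have [d d0 dP] := (continuous_atP f x).1 (cf x) e e0.
exists d => // y yx.
have [xy|yx'] := leP x y.
  rewrite primB// [`|y - x|]ger0_norm ?subr_ge0//; apply: W => // s /andP[xs sy].
  apply/ltW/dP; apply: le_lt_trans yx.
  by rewrite !ger0_norm; lra.
rewrite distrC in yx *; rewrite -[X in `|X|]opprK normrN.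
have -> : - (prim f y - prim f x - f x * (y - x)) = (prim f x - prim f y) - f x * (x - y) by ring.
have yx2 := ltW yx'; rewrite primB// [`|x - y|]ger0_norm ?subr_ge0//; apply: W => // s /andP[xs sy].
apply/ltW/dP; rewrite distrC; apply: le_lt_trans yx.
by rewrite !ger0_norm; lra.
Qed.

End AbsolutelyContinuous.

(** * Derivatives and C^k functions *)

Section DerivativeRules.
Variable R : realType.
Implicit Types (f g : R -> R) (x y a b c : R).

Lemma derD f g x a b : is_derive x 1 f a -> is_derive x 1 g b ->
  is_derive x 1 (fun y => f y + g y) (a + b).
Proof. by move=> fa gb; exact: is_deriveD fa gb. Qed.

Lemma derN f x a : is_derive x 1 f a -> is_derive x 1 (fun y => - f y) (- a).
Proof. by move=> fa; exact: is_deriveN fa. Qed.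

Lemma derB f g x a b : is_derive x 1 f a -> is_derive x 1 g b ->
  is_derive x 1 (fun y => f y - g y) (a - b).
Proof. by move=> fa gb; exact: is_deriveB fa gb. Qed.

Lemma derM f g x a b : is_derive x 1 f a -> is_derive x 1 g b ->
  is_derive x 1 (fun y => f y * g y) (a * g x + f x * b).
Proof.
move=> fa gb; apply: is_derive_eq (is_deriveM fa gb) _.
by rewrite /GRing.scale/=; ring.
Qed.

Lemma derZ c f x a : is_derive x 1 f a -> is_derive x 1 (fun y => c * f y) (c * a).
Proof.
move=> fa; apply: is_derive_eq (derM (is_derive_cst c x 1) fa) _.
by rewrite mul0r add0r.
Qed.

Lemma derV f x a : f x != 0 -> is_derive x 1 f a ->
  is_derive x 1 (fun y => (f y)^-1) (- a / f x ^+ 2).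
Proof.
move=> f0 fa; apply: is_derive_eq (is_deriveV f0 fa) _.
by rewrite /GRing.scale/= mulNr mulrC mulNr.
Qed.

Lemma der_sqr f x a : is_derive x 1 f a -> is_derive x 1 (fun y => f y ^+ 2) (2 * f x * a).
Proof.
move=> fa; apply: is_derive_eq (derM fa fa) _; ring.
Qed.

Lemma der_comp f g x a b : is_derive (g x) 1 f a -> is_derive x 1 g b ->
  is_derive x 1 (fun y => f (g y)) (a * b).
Proof. by move=> fa gb; exact: is_derive1_comp fa gb. Qed.

Lemma derive1_val f x a : is_derive x 1 f a -> derive1 f x = a.
Proof. by move=> fa; rewrite derive1E; exact: derive_val. Qed.

End DerivativeRules.

Section Smoothness.
Variable R : realType.
Implicit Types (A : set R) (f g : R -> R) (x y c : R).

Lemma near_is_derive f g x c : (\forall y \near x, f y = g y) -> is_derive x 1 f c -> is_derive x 1 g c.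
Proof. by move=> fg; apply: near_eq_is_derive => //. Qed.

Lemma open_near A x : open A -> A x -> \forall y \near x, A y.
Proof. by move=> oA Ax; apply: open_nbhs_nbhs. Qed.

Lemma eq_derive1n_open A f g k : open A -> (forall x, A x -> f x = g x) ->
  forall x, A x -> derive1n k f x = derive1n k g x.
Proof.
move=> oA fg; elim: k => [|k IH] x Ax; first by rewrite !derive1n0 fg.
rewrite !derive1nS !derive1E; apply: near_eq_derive.
by near=> y; apply: IH; near: y; exact: open_near.
Unshelve. all: by end_near. Qed.

Lemma Ck_on_ext k A f g : open A -> (forall x, A x -> f x = g x) -> Ck_on k A f -> Ck_on k A g.
Proof.
move=> oA fg cf x Ax; have [df ck] := cf x Ax; split=> [j jk|].
  have := df j jk; apply: near_eq_derivable.
  by near=> y; apply: (eq_derive1n_open _ oA fg); near: y; exact: open_near.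
have E := eq_derive1n_open k oA fg.
suff : derive1n k g y @[y --> x] --> derive1n k g x by [].
rewrite -E//; apply: cvg_trans ck; apply: near_eq_cvg.
by near=> y; apply: E; near: y; exact: open_near.
Unshelve. all: by end_near. Qed.

Lemma Ck_on0 A f : Ck_on 0 A f <-> forall x, A x -> {for x, continuous f}.
Proof.
split=> [cf x Ax|cf x Ax]; first by have [_] := cf x Ax; rewrite derive1n0.
by split => //; rewrite derive1n0; exact: cf.
Qed.

Lemma Ck_onS k A f : Ck_on k.+1 A f <->
  (forall x, A x -> derivable f x 1) /\ Ck_on k A (derive1 f).
Proof.
split=> [cf|[df cf] x Ax].
  split=> x Ax; have [df ck] := cf x Ax; first exact: (df 0%N).
  by split=> [j jk|]; rewrite -derive1Sn; [apply: (df j.+1)|exact: ck].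
have [d1 ck] := cf x Ax; split=> [[|j] jk|]; rewrite ?derive1Sn//.
  by rewrite derive1n0; exact: df.
exact: d1.
Qed.

Lemma Ck_onSP k A f f' : open A -> (forall x, A x -> is_derive x 1 f (f' x)) ->
  Ck_on k A f' -> Ck_on k.+1 A f.
Proof.
move=> oA df cf'; apply/Ck_onS; split=> [x /df[]//|].
by apply: Ck_on_ext cf' => // x Ax; rewrite derive1E; have := df x Ax; move=> /@derive_val ->.
Qed.

Lemma Ck_on_is_derive k A f x : Ck_on k.+1 A f -> A x -> is_derive x 1 f (derive1 f x).
Proof. by move=> /Ck_onS[df _] /df dfx; rewrite derive1E; exact: derivableP. Qed.

Lemma Ck_on_continuous k A f x : Ck_on k A f -> A x -> {for x, continuous f}.
Proof.
case: k => [/Ck_on0|k] cf Ax; first exact: cf.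
exact: is_derive_continuous (Ck_on_is_derive cf Ax).
Qed.

Lemma Ck_onW k A f : Ck_on k.+1 A f -> Ck_on k A f.
Proof.
elim: k f => [|k IH] f cf; first by apply/Ck_on0 => x; exact: Ck_on_continuous cf.
by move/Ck_onS: cf => [df cf]; apply/Ck_onS; split => //; exact: IH.
Qed.

Lemma Ck_on_cst k A c : open A -> Ck_on k A (fun=> c).
Proof.
move=> oA; elim: k c => [|k IH] c; first by apply/Ck_on0 => x _; exact: cst_continuous.
by apply: (@Ck_onSP _ _ _ (fun=> 0)).
Qed.

Lemma Ck_onD k A f g : open A -> Ck_on k A f -> Ck_on k A g -> Ck_on k A (fun x => f x + g x).
Proof.
move=> oA; elim: k f g => [|k IH] f g cf cg.
  by apply/Ck_on0 => x Ax; apply: cvgD; [exact: Ck_on_continuous cf Ax|exact: Ck_on_continuous cg Ax].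
have [_ cf'] := (Ck_onS _ _ _).1 cf; have [_ cg'] := (Ck_onS _ _ _).1 cg.
apply: (Ck_onSP oA _ (IH _ _ cf' cg')) => x Ax.
exact: derD (Ck_on_is_derive cf Ax) (Ck_on_is_derive cg Ax).
Qed.

Lemma Ck_onM k A f g : open A -> Ck_on k A f -> Ck_on k A g -> Ck_on k A (fun x => f x * g x).
Proof.
move=> oA; elim: k f g => [|k IH] f g cf cg.
  by apply/Ck_on0 => x Ax; apply: cvgM; [exact: Ck_on_continuous cf Ax|exact: Ck_on_continuous cg Ax].
have [_ cf'] := (Ck_onS _ _ _).1 cf; have [_ cg'] := (Ck_onS _ _ _).1 cg.
apply: (Ck_onSP oA _ (Ck_onD oA (IH _ _ cf' (Ck_onW cg)) (IH _ _ (Ck_onW cf) cg'))) => x Ax.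
exact: derM (Ck_on_is_derive cf Ax) (Ck_on_is_derive cg Ax).
Qed.

Lemma Ck_onZ k A c f : open A -> Ck_on k A f -> Ck_on k A (fun x => c * f x).
Proof. by move=> oA; apply: Ck_onM => //; exact: Ck_on_cst. Qed.

Lemma Ck_onV k A f : open A -> (forall x, A x -> f x != 0) -> Ck_on k A f ->
  Ck_on k A (fun x => (f x)^-1).
Proof.
move=> oA f0; elim: k => [|k IH] cf.
  by apply/Ck_on0 => x Ax; apply: cvgV; [exact: f0|exact: Ck_on_continuous cf Ax].
have [_ cf'] := (Ck_onS _ _ _).1 cf; have cV := IH (Ck_onW cf).
apply: (Ck_onSP oA _ (Ck_onM oA (Ck_onZ (-1) oA (Ck_onM oA cV cV)) cf')) => x Ax.
apply: is_derive_eq (derV (f0 x Ax) (Ck_on_is_derive cf Ax)) _.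
by rewrite -exprVn expr2; ring.
Qed.

Lemma Ck_onX k A f n : open A -> Ck_on k A f -> Ck_on k A (fun x => f x ^+ n).
Proof.
move=> oA cf; elim: n => [|n IH].
  apply: (Ck_on_ext oA _ (Ck_on_cst k 1 oA)) => x _; by rewrite expr0.
apply: (Ck_on_ext oA _ (Ck_onM oA cf IH)) => x _; by rewrite exprS.
Qed.

Lemma Ck_on_trig k A a b : open A ->
  Ck_on k A (fun x : R => cos (a * x + b)) /\ Ck_on k A (fun x : R => sin (a * x + b)).
Proof.
move=> oA; have D x : is_derive x 1 (fun x : R => a * x + b) a.
  by apply: is_derive_eq (derD (derZ a (is_derive_id x 1)) (is_derive_cst b x 1)) _; rewrite addr0 mulr1.
elim: k => [|k [IHc IHs]].
  by split; apply/Ck_on0 => x _; apply: continuous_comp;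
    [exact: is_derive_continuous (D x)|exact: continuous_cos|
     exact: is_derive_continuous (D x)|exact: continuous_sin].
split.
  apply: (Ck_onSP oA _ (Ck_onZ (- a) oA IHs)) => x _.
  apply: is_derive_eq (is_derive1_comp (is_derive_cos _) (D x)) _; by rewrite mulNr mulrC mulNr.
apply: (Ck_onSP oA _ (Ck_onZ a oA IHc)) => x _.
apply: is_derive_eq (is_derive1_comp (is_derive_sin _) (D x)) _; by rewrite mulrC.
Qed.

End Smoothness.

(** * Square integrable functions *)

Section SquareIntegrable.
Variable R : realType.
Implicit Types (f g h u v : R -> R) (a b c d e x y s t : R).
Local Notation mu := (@lebesgue_measure R).

Lemma integrable_prod a b f g : measurable_fun `[a, b] f -> measurable_fun `[a, b] g ->
  integrable_on a b (fun x => f x ^+ 2) -> integrable_on a b (fun x => g x ^+ 2) ->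
  integrable_on a b (fun x => f x * g x).
Proof.
move=> mf mg If Ig; apply: integrable_on_le (integrable_onD If Ig) _.
  exact: measurable_funM.
move=> x _; rewrite normrM.
have := sqr_ge0 (`|f x| - `|g x|); have := sqr_ge0 (`|f x| + `|g x|).
rewrite -[f x ^+ 2]real_normK ?num_real// -[g x ^+ 2]real_normK ?num_real//.
nra.
Qed.

Lemma in_L2_prod f g : in_L2 f -> in_L2 g -> integrable_on 0 1 (fun x => f x * g x).
Proof. by move=> [mf If] [mg Ig]; apply: integrable_prod. Qed.

Lemma continuous_in_L2 f : continuous f -> in_L2 f.
Proof.
move=> cf; split; first exact: continuous_measurable_itv.
by apply: continuous_integrable_on; exact: cts_exp.
Qed.

Lemma in_L2_integrable f : in_L2 f -> integrable_on 0 1 f.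
Proof.
move=> f2; have := in_L2_prod f2 (continuous_in_L2 (@cst_continuous _ _ (1 : R))).
by apply: eq_integrable_on => x _; rewrite mulr1.
Qed.

Lemma in_L2D f g : in_L2 f -> in_L2 g -> in_L2 (fun x => f x + g x).
Proof.
move=> f2 g2; have [mf If] := f2; have [mg Ig] := g2; split; first exact: measurable_funD.
have := integrable_onD (integrable_onD If Ig) (integrable_onZ 2 (in_L2_prod f2 g2)).
by apply: eq_integrable_on => x _; ring.
Qed.

Lemma in_L2M f g : continuous f -> in_L2 g -> in_L2 (fun x => f x * g x).
Proof.
move=> cf [mg Ig]; split.
  by apply: measurable_funM => //; exact: continuous_measurable_itv.
have := integrable_onM (cts_exp (n := 2) cf) Ig.
by apply: eq_integrable_on => x _; rewrite exprMn.
Qed.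

Lemma in_L2Z c f : in_L2 f -> in_L2 (fun x => c * f x).
Proof. by apply: in_L2M; exact: cst_continuous. Qed.

(** The minimum over l is taken at q / r. In the degenerate case r = 0 an affine function of l
    bounded below must be constant. *)
Lemma quadratic_discr (p q r : R) : 0 <= r -> (forall l, 0 <= p - 2 * l * q + l ^+ 2 * r) -> q ^+ 2 <= p * r.
Proof.
move=> r0 H; have [r00|r1] := eqVneq r 0.
  have [->|q0] := eqVneq q 0; first by rewrite r00 mulr0 expr0n.
  (* At this l the affine function takes the value -1. *)
  have := H ((p + 1) / (2 * q)); rewrite r00.
  have -> : p - 2 * ((p + 1) / (2 * q)) * q + ((p + 1) / (2 * q)) ^+ 2 * 0 = -1 by field.
  by rewrite ler0N1.
have r2 : 0 < r by rewrite lt_def r1.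
have := H (q / r); have -> : p - 2 * (q / r) * q + (q / r) ^+ 2 * r = (p * r - q ^+ 2) / r by field.
by rewrite pmulr_lge0 ?invr_gt0// subr_ge0.
Qed.

Lemma cauchy_schwarz a b f g :
  integrable_on a b (fun x => f x ^+ 2) -> integrable_on a b (fun x => g x ^+ 2) ->
  integrable_on a b (fun x => f x * g x) ->
  itg a b (fun x => f x * g x) ^+ 2 <=
  itg a b (fun x => f x ^+ 2) * itg a b (fun x => g x ^+ 2).
Proof.
move=> If Ig Ifg; apply: quadratic_discr => [|l].
  by apply: itg_ge0 => x _; exact: sqr_ge0.
rewrite -!itgZ// -itgB//; last exact: integrable_onZ.
rewrite -itgD; [|by apply: integrable_onB => //; exact: integrable_onZ|exact: integrable_onZ].
apply: itg_ge0 => x _.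
rewrite (_ : _ + _ = (f x - l * g x) ^+ 2); first exact: sqr_ge0.
by ring.
Qed.

Lemma sqnorm_ge0 f : 0 <= sqnorm f.
Proof. by rewrite /sqnorm int01E; apply: itg_ge0 => x _; exact: sqr_ge0. Qed.

Lemma itg_norm_sqr_le f : in_L2 f -> itg 0 1 (fun x => `|f x|) ^+ 2 <= sqnorm f.
Proof.
move=> f2; have [mf If] := f2.
have c1 := continuous_integrable_on 0 1 (@cst_continuous _ _ (1 : R)).
have E : forall x, 0 <= x <= 1 -> `|f x| = `|f x| * 1 by move=> x _; rewrite mulr1.
have := @cauchy_schwarz 0 1 (fun x => `|f x|) (fun=> 1).
rewrite -(eq_itg E) (_ : itg 0 1 (fun x => `|f x| ^+ 2) = sqnorm f); last first.
  by rewrite /sqnorm int01E; apply: eq_itg => x _; rewrite real_normK ?num_real.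
rewrite (_ : itg 0 1 (fun=> 1 ^+ 2) = 1); last by rewrite itg_cst// expr1n mul1r subr0.
rewrite mulr1; apply.
- by apply: eq_integrable_on If => x _; rewrite real_normK ?num_real.
- by apply: eq_integrable_on c1 => x _; rewrite expr1n.
- by apply: eq_integrable_on (integrable_on_norm (in_L2_integrable f2)).
Qed.

(** Lebesgue differentiation: the primitive of the extension of d by zero vanishes identically, and
    its derivative is d almost everywhere. *)
Lemma itg0_ae (d : R -> R) : integrable_on 0 1 d -> (forall x, 0 <= x <= 1 -> itg 0 x d = 0) ->
  ae_eq mu `[0, 1]%classic d (cst 0).
Proof.
move=> Id d0; pose D := d \_ `[0, 1].
have ID : mu.-integrable setT (EFin \o D).
  by rewrite /D -restrict_EFin; apply/integrable_restrict => //; rewrite setTI.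
have IA A : measurable A -> mu.-integrable A (EFin \o D) by move=> mA; apply: integrableS ID.
have lD : locally_integrable setT D by apply: integrable_locally_restrict.
(* The base point -1 lies strictly to the left of every x in [0, 1], as [FTC1] demands. *)
have E x : \int[mu]_(t in `[-1, x]) D t = 0.
  rewrite /D -Rintegral_mkcondr.
  have [x0|x0] := ltP x 0.
    rewrite (_ : _ `&` _ = set0) ?Rintegral_set0// -subset0 => y [] /=.
    by rewrite !in_itv/= => /andP[_ yx] /andP[/le_lt_trans/(_ (le_lt_trans yx x0))]; rewrite ltxx.
  have [x1|x1] := leP x 1.
    rewrite (_ : _ `&` _ = `[0, x]%classic); first by apply: d0; rewrite x0.
    apply/seteqP; split=> y /=; rewrite !in_itv/=; first by move=> [/andP[_ ->] /andP[->]].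
    by move=> /andP[y0 yx]; split; apply/andP; split; lra.
  rewrite setIidr; first by apply: (d0 1); rewrite ler01 lexx.
  by move=> y /=; rewrite !in_itv/= => /andP[y0 y1]; apply/andP; split; lra.
have /= := @FTC1 R D (BLeft (-1)) (fun y => IA _ (measurable_itv _)) lD.
apply: filterS; first exact: (ae_filter_ringOfSetsType mu).
move=> x Hx; rewrite /= in_itv/= => x01.
have [|_] := Hx; first by rewrite lte_fin; case/andP: x01 => x0 _; lra.
have -> : (fun x => \int[mu]_(t in `[-1, x]) D t) = cst 0 by apply/funext => y; rewrite E.
by rewrite derive1_cst /D patchE mem_set//= in_itv.
Qed.

Lemma eq_itg_ae f g : measurable_fun (`[0, 1] : set R) f -> measurable_fun (`[0, 1] : set R) g ->
  ae_eq mu `[0, 1]%classic f g -> itg 0 1 f = itg 0 1 g.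
Proof.
move=> mf mg fg; rewrite /itg /Rintegral; congr fine.
apply: ae_eq_integral => //; try exact/measurable_EFinP.
move: fg; apply: filterS.
by move=> x /= fg x01; rewrite fg.
Qed.

Lemma AC_unique f g g' : AC01 f g -> AC01 f g' -> ae_eq mu `[0, 1]%classic g g'.
Proof.
move=> [_ Ig fE] [_ Ig' fE'].
have : ae_eq mu `[0, 1]%classic (fun x => g x - g' x) (cst 0).
  apply: itg0_ae; first exact: integrable_onB.
  move=> x x01; have S h : integrable_on 0 1 h -> integrable_on 0 x h.
    by apply: integrable_onS => //; case/andP: x01.
  rewrite itgB; [|exact: S|exact: S].
  by have := fE x x01; rewrite fE'// => /addrI ->; rewrite subrr.
apply: filterS.
by move=> x /= H x01; apply/eqP; rewrite -subr_eq0 H.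
Qed.

End SquareIntegrable.

Lemma eq_itg_ae_sub (R : realType) (f g : R -> R) y : y <= 1 ->
  integrable_on 0 1 f -> integrable_on 0 1 g ->
  ae_eq (@lebesgue_measure R) `[0, 1]%classic f g -> itg 0 y f = itg 0 y g.
Proof.
move=> y1 /(integrable_onS (lexx 0) y1)/integrable_on_measurable mf.
move=> /(integrable_onS (lexx 0) y1)/integrable_on_measurable mg fg; rewrite /itg /Rintegral; congr fine; apply: ae_eq_integral => //.
- exact/measurable_EFinP.
- exact/measurable_EFinP.
- apply: filterS fg => s /= H s01; rewrite H//.
  by move: s01; rewrite /= !in_itv/= => /andP[-> sy]; exact: le_trans sy y1.
Qed.

Section MonotoneLimit.
Variable R : realType.
Local Notation mu := (@lebesgue_measure R).

(** Monotone convergence turns a uniform bound on the integrals into integrability of the limit. It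
    serves to integrate 1/q across the collisions. *)
Lemma monotone_limit_integrable (h : nat -> R -> R) (k : R -> R) (M : R) :
  (forall n, continuous (h n)) -> (forall n x, 0 <= h n x) ->
  (forall n m x, (n <= m)%N -> h n x <= h m x) ->
  (forall x, h n x @[n --> \oo] --> k x) -> (forall n, itg 0 1 (h n) <= M) -> integrable_on 0 1 k.
Proof.
move=> ch h0 hm hk hM.
have mh n : measurable_fun (`[0, 1]%classic : set R) (h n) by exact: continuous_measurable_itv.
have mk : measurable_fun (`[0, 1]%classic : set R) k.
  by apply: (@measurable_fun_cvg _ _ _ _ h) => // x _; exact: hk.
have k0 x : 0 <= k x.
  by rewrite -(cvg_lim (@norm_hausdorff _ _) (hk x)); apply: limr_ge; [apply/cvg_ex; exists (k x)|apply: nearW => n; exact: h0].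
apply/integrableP; split; first exact/measurable_EFinP.
have Cv := @cvg_monotone_convergence _ _ _ mu `[0, 1]%classic (measurable_itv _) (fun n x => (h n x)%:E)
  (fun n => (measurable_EFinP _ _).2 (mh n)) (fun n x _ => h0 n x) (fun x _ n m nm => hm n m x nm).
have E : (\int[mu]_(x in `[0%R, 1%R]) `|(EFin \o k) x| = \int[mu]_(x in `[0%R, 1%R]) (limn (fun n => (h n x)%:E)))%E.
  apply: eq_integral => x _; rewrite /= ger0_norm//; apply/esym/cvg_lim => //.
  by apply/fine_cvgP; split; [exact: nearW|exact: hk].
rewrite E; apply: (@le_lt_trans _ _ M%:E); last exact: ltry.
rewrite -(cvg_lim _ Cv)//; apply: lime_le; first by apply/cvg_ex; eexists; exact: Cv.
apply: nearW => n /=; have := hM n; rewrite -lee_fin /itg /Rintegral fineK//.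
exact: integrable_fin_num (continuous_integrable_on 0 1 (ch n)).
Qed.

End MonotoneLimit.

(** * Weak derivatives *)

Section WeakDerivative.
Variable R : realType.
Implicit Types (f g h u v w : R -> R) (a b c d e x y s t : R).
Local Notation mu := (@lebesgue_measure R).

Lemma eq_of_derive f g f' : (forall x, is_derive x 1 f (f' x)) ->
  (forall x, is_derive x 1 g (f' x)) -> f 0 = g 0 -> forall x, f x = g x.
Proof.
move=> df dg fg0 x.
have : f x - g x = f 0 - g 0.
  apply: (@is_derive_0_is_cst _ (fun x => f x - g x)) => y.
  by apply: is_derive_eq (derB (df y) (dg y)) _; rewrite subrr.
by rewrite fg0 subrr => /eqP; rewrite subr_eq0 => /eqP.
Qed.

Lemma is_derive_shiftD f c x a : is_derive (x + c) 1 f a -> is_derive x 1 (fun y => f (y + c)) a.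
Proof.
move=> fa; have D : is_derive x 1 (fun y : R => y + c) 1.
  by apply: is_derive_eq (derD (is_derive_id x 1) (is_derive_cst c x 1)) _; rewrite addr0.
by apply: is_derive_eq (@der_comp _ f (fun y => y + c) x a 1 fa D) _; rewrite mulr1.
Qed.

Lemma shift1_of_derive f f' : (forall x, is_derive x 1 f (f' x)) -> periodic1 f' ->
  forall x, f (x + 1) = f x + (f 1 - f 0).
Proof.
move=> df pf' x.
apply: (@eq_of_derive (fun x => f (x + 1)) (fun x => f x + (f 1 - f 0)) f').
- by move=> y; apply: is_derive_shiftD; rewrite -pf'.
- move=> y; apply: is_derive_eq (derD (df y) (is_derive_cst _ y 1)) _; by rewrite addr0.
- by rewrite add0r; ring.
Qed.

Lemma prim_shift1 f x : continuous f -> periodic1 f -> prim f (x + 1) = prim f x + itg 0 1 f.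
Proof.
move=> cf pf; have D y := is_derive_prim y cf.
by rewrite (shift1_of_derive D pf) prim0 subr0 [prim f 1]prim_ge0.
Qed.

Lemma periodic1_nat f n x : periodic1 f -> f (x + n%:R) = f x.
Proof.
by move=> pf; elim: n => [|n IH]; rewrite ?addr0// -natr1 addrA pf.
Qed.

Lemma periodic1_int f (n : int) x : periodic1 f -> f (x + n%:~R) = f x.
Proof.
move=> pf; case: n => n; first exact: periodic1_nat.
by rewrite NegzE mulrNz -(periodic1_nat n.+1 _ pf) subrK.
Qed.

Lemma cos2pi_shift (x : R) : cos (2 * pi * (x + 1)) = cos (2 * pi * x).
Proof. by rewrite mulrDr mulr1 [2 * pi]mulrC mulr_natr cosD2pi. Qed.

Lemma cos2pi_le (s d : R) : 0 <= d <= 1 / 2 -> d <= s <= 1 - d -> cos (2 * pi * s) <= cos (2 * pi * d).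
Proof.
move=> /andP[d0 d1] /andP[ds sd]; have p0 := pi_gt0 R.
have K t : d <= t <= 1 / 2 -> cos (2 * pi * t) <= cos (2 * pi * d).
  move=> /andP[dt t1]; rewrite leNgt ltr_cos ?in_itv/= -?leNgt.
  - by rewrite ler_wpM2l//; lra.
  - by apply/andP; split; nra.
  - by apply/andP; split; nra.
have [s1|s1] := leP s (1 / 2); first by apply: K; rewrite ds.
have -> : cos (2 * pi * s) = cos (2 * pi * (1 - s)).
  by rewrite [1 - s]addrC cos2pi_shift mulrN cosN.
by apply: K; apply/andP; split; lra.
Qed.

Lemma cos2pi_lt (s d : R) : 0 <= s -> s < d -> d <= 1 / 2 -> cos (2 * pi * d) < cos (2 * pi * s).
Proof.
move=> s0 sd d1; have p0 := pi_gt0 R.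
rewrite ltr_cos ?in_itv/=.
- by rewrite ltr_pM2l//; lra.
- by apply/andP; split; nra.
- by apply/andP; split; nra.
Qed.

Lemma cos2pi_norm (x : R) : cos (2 * pi * x) = cos (2 * pi * `|x|).
Proof.
have [x0|x0] := leP 0 x; first by rewrite ger0_norm.
by rewrite ltr0_norm// mulrN cosN.
Qed.

Lemma test_kernel a d n : test_function (fun x : R => (1 - cos (2 * pi * d) + cos (2 * pi * x + 2 * pi * - a)) ^+ n).
Proof.
split=> [x|k].
  by rewrite -!mulrDr (_ : x + 1 - a = x - a + 1) ?cos2pi_shift//; ring.
apply: Ck_onX; first exact: openT.
apply: Ck_onD; [exact: openT|exact: Ck_on_cst openT|].
by have [] := @Ck_on_trig R k setT (2 * pi) (2 * pi * - a) openT.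
Qed.

(* Powers of a trigonometric kernel that exceeds 1 exactly near a concentrate the
   integral at a, as in the classical proof of uniqueness of Fourier coefficients. *)
Lemma test_kernel_le0 w a : continuous w ->
  (forall psi, test_function psi -> int01 (fun x => w x * psi x) = 0) ->
  0 < a < 1 -> w a <= 0.
Proof.
move=> cw Hw /andP[a0 a1]; rewrite leNgt; apply/negP => wa.
have wa2 : 0 < w a / 2 by lra.
have [d' d'0 d'P] := (continuous_atP w a).1 (cw a) _ wa2.
(* The first bound keeps w above w a / 2 on [a - d, a + d], the second keeps d in the range where
   the cosine decreases. The last two keep this interval inside [0, 1] and |x - a| at most 1 - d, so
   that the cosine does not come back up. *)
pose d := Num.min (d' / 2) (Num.min (1 / 4) (Num.min a (1 - a))).
have d0 : 0 < d by rewrite /d !lt_min; apply/andP; split; [lra|apply/andP; split; [lra|apply/andP; split; lra]].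
have dd' : d <= d' / 2 by rewrite ge_min lexx.
have d14 : d <= 1 / 4 by rewrite /d !ge_min lexx !orbT.
have da : d <= a by rewrite /d !ge_min lexx !orbT.
have d1a : d <= 1 - a by rewrite /d !ge_min lexx !orbT.
pose K x : R := 1 - cos (2 * pi * d) + cos (2 * pi * x + 2 * pi * - a).
have KE x : K x = 1 - cos (2 * pi * d) + cos (2 * pi * `|x - a|).
  by rewrite /K -mulrDr [cos (2 * pi * (x - a))]cos2pi_norm.
have wP x : `|x - a| <= d -> w a / 2 <= w x.
  move=> xa; have : `|x - a| < d' by lra.
  by move=> /d'P; rewrite ltr_norml => /andP[? _]; lra.
pose eta : R := cos (2 * pi * (d / 2)) - cos (2 * pi * d).
have eta0 : 0 < eta by rewrite subr_gt0 cos2pi_lt//; lra.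
have Kin x : `|x - a| <= d / 2 -> 1 + eta <= K x.
  move=> xa; rewrite KE /eta.
  suff : cos (2 * pi * (d / 2)) <= cos (2 * pi * `|x - a|) by lra.
  have [->|xd] := eqVneq `|x - a| (d / 2); first by [].
  by apply/ltW/cos2pi_lt; rewrite ?lt_neqAle ?xd//; lra.
have Kmid x : `|x - a| <= d -> 1 <= K x.
  move=> xa; rewrite KE.
  suff : cos (2 * pi * d) <= cos (2 * pi * `|x - a|) by lra.
  have [->|xd] := eqVneq `|x - a| d; first by [].
  by apply/ltW/cos2pi_lt; rewrite ?lt_neqAle ?xd//; lra.
have Kout x : 0 <= x <= 1 -> d <= `|x - a| -> `|K x| <= 1.
  move=> /andP[x0 x1] dx; rewrite KE ler_norml.
  have xa : `|x - a| <= 1 - d by rewrite ler_norml; apply/andP; split; lra.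
  have := cos_geN1 (2 * pi * `|x - a|); have := cos_le1 (2 * pi * d).
  have := @cos2pi_le `|x - a| d; rewrite dx xa (ltW d0) => /(_ ltac:(lra) isT) *.
  by apply/andP; split; lra.
have [M M0 MP] := bounded_itv 0 1 cw.
(* By Bernoulli's inequality the points within d / 2 of a contribute at least n (w a / 2) eta d,
   which has to beat a contribution of at least -M from elsewhere. *)
pose n := (Num.trunc ((M + 1) / (w a / 2 * eta * d))).+1.
have nP : M + 1 <= n%:R * (w a / 2 * eta * d).
  by rewrite -ler_pdivrMr ?mulr_gt0//; apply/ltW/truncnS_gt.
have tf := test_kernel a d n.
have := Hw _ tf; rewrite int01E -/(K _) => H0.
have cKn : continuous (fun x => K x ^+ n).
  by move=> x; apply: (@Ck_on_continuous _ 0 setT) => //; exact: tf.2.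
have cwK : continuous (fun x => w x * K x ^+ n) by exact: cts_mul.
have I b c : integrable_on b c (fun x => w x * K x ^+ n) by apply: continuous_integrable_on.
have Icst b c e : integrable_on b c (fun=> e).
  by apply: continuous_integrable_on; exact: cst_continuous.
have lowM x : 0 <= x <= 1 -> - M <= w x * K x ^+ n.
  move=> x01; have [xd|dx] := leP `|x - a| d.
    have := wP x xd => wx; apply: (@le_trans _ _ 0); first by lra.
    by rewrite mulr_ge0 ?exprn_ge0//; have := Kmid x xd; lra.
  suff : `|w x * K x ^+ n| <= M by rewrite ler_norml => /andP[].
  rewrite normrM normrX -[M]mulr1 ler_pM//; first exact: MP.
  by rewrite exprn_ile1// Kout// ltW.
have lowin x : a - d / 2 <= x <= a + d / 2 -> w a / 2 * (1 + n%:R * eta) <= w x * K x ^+ n.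
  move=> /andP[x1 x2]; have xa : `|x - a| <= d / 2 by rewrite ler_norml; apply/andP; split; lra.
  apply: ler_pM.
  - lra.
  - by rewrite addr_ge0// mulr_ge0// ltW.
  - by apply: wP; lra.
  - apply: (@le_trans _ _ ((1 + eta) ^+ n)).
      have B m : 1 + m%:R * eta <= (1 + eta) ^+ m.
        elim: m => [|m IH]; first by rewrite mul0r addr0 expr0.
        rewrite exprS -natr1; have m0 : 0 <= m%:R :> R by [].
        have : (1 + eta) * (1 + m%:R * eta) <= (1 + eta) * (1 + eta) ^+ m by rewrite ler_pM2l//; lra.
        apply: le_trans; nra.
      exact: B.
    by apply: lerXn2r; rewrite ?nnegrE; have := Kin x xa; lra.
suff: itg 0 1 (fun x => w x * K x ^+ n) > 0 by rewrite H0 ltxx.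
rewrite (@itg_split _ 0 (a - d / 2) 1)//; last by apply/andP; split; lra.
rewrite (@itg_split _ (a - d / 2) (a + d / 2) 1)//; last by apply/andP; split; lra.
have A1 : - M * (a - d / 2 - 0) <= itg 0 (a - d / 2) (fun x => w x * K x ^+ n).
  rewrite -itg_cst; last lra.
  by apply: itg_le => // x /andP[x0 x1]; apply: lowM; apply/andP; split; lra.
have A2 : - M * (1 - (a + d / 2)) <= itg (a + d / 2) 1 (fun x => w x * K x ^+ n).
  rewrite -itg_cst; last lra.
  by apply: itg_le => // x /andP[x0 x1]; apply: lowM; apply/andP; split; lra.
have A3 : (w a / 2 * (1 + n%:R * eta)) * ((a + d / 2) - (a - d / 2)) <=
    itg (a - d / 2) (a + d / 2) (fun x => w x * K x ^+ n).
  rewrite -itg_cst; last lra.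
  by apply: itg_le => // x x1; exact: lowin.
have A4 : 0 < w a * d by rewrite mulr_gt0.
have A5 : 0 < M * d by rewrite mulr_gt0.
have E : - M * (a - d / 2 - 0) + (w a / 2 * (1 + n%:R * eta) * ((a + d / 2) - (a - d / 2)) +
    - M * (1 - (a + d / 2))) = n%:R * (w a / 2 * eta * d) - M + M * d + w a * d / 2 by field.
by apply: lt_le_trans (lerD A1 (lerD A3 A2)); rewrite E; lra.
Qed.

(** Every test function differs from the derivative of a periodic test function by its mean. Hence u
    minus its mean is orthogonal to all test functions; the kernel argument, used for both signs,
    makes it vanish inside ]0, 1[, and continuity reaches the endpoints. *)
Lemma du_bois_reymond u : continuous u ->
  (forall phi, test_function phi -> int01 (fun x => u x * derive1 phi x) = 0) ->
  forall x, 0 <= x <= 1 -> u x = u 0.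
Proof.
move=> cu Hu; pose m := itg 0 1 u; pose w x := u x - m.
have cw : continuous w by apply: cts_sub => //; exact: cst_continuous.
have I f : continuous f -> integrable_on 0 1 f by exact: continuous_integrable_on.
have Hw psi : test_function psi -> int01 (fun x => w x * psi x) = 0.
  move=> [ppsi cpsi]; have cp : continuous psi.
    by move=> x; apply: (@Ck_on_continuous _ 0 setT).
  pose k := itg 0 1 psi; pose phi x := prim psi x - k * x.
  have D x : is_derive x 1 phi (psi x - k).
    apply: is_derive_eq (derB (is_derive_prim x cp) (derZ k (is_derive_id x 1))) _.
    by rewrite mulr1.
  have tphi : test_function phi.
    split=> [x|[|j]].
    - by rewrite /phi prim_shift1// /k; ring.
    - by apply/Ck_on0 => x _; exact: is_derive_continuous (D x).
    - apply: (Ck_onSP openT (fun x _ => D x)); apply: Ck_onD; [exact: openT|exact: cpsi|].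
      exact: Ck_on_cst openT.
  have := Hu _ tphi; rewrite !int01E.
  rewrite (eq_itg (g := fun x => u x * psi x - k * u x)); last first.
    by move=> x _; rewrite (derive1_val (D x)); ring.
  rewrite itgB ?itgZ; try (by apply: I; do ?apply: cts_scale; do ?apply: cts_mul).
  rewrite (eq_itg (f := fun x => w x * psi x) (g := fun x => u x * psi x - m * psi x)); last first.
    by move=> x _; rewrite /w; ring.
  rewrite itgB ?itgZ; try (by apply: I; do ?apply: cts_scale; do ?apply: cts_mul).
  by rewrite -/k -/m mulrC.
have w0 x : 0 < x < 1 -> w x = 0.
  move=> x01; apply/eqP; rewrite eq_le (test_kernel_le0 cw Hw x01)/=.
  rewrite -oppr_le0; apply: (@test_kernel_le0 (fun x => - w x)) => //; first exact: cts_opp.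
  move=> psi tpsi; rewrite -[RHS]oppr0 -(Hw _ tpsi) !int01E -itgN; last first.
    apply: I; apply: cts_mul => // x1.
    by apply: (@Ck_on_continuous _ 0 setT) => //; exact: tpsi.2.
  by apply: eq_itg => x' _; rewrite mulNr.
have w1 x : 0 <= x <= 1 -> w x = 0.
  move=> /andP[x0 x1]; apply/eqP; rewrite -normr_le0; apply/ler_addgt0Pr => e e0; rewrite add0r.
  have [d d0 dP] := (continuous_atP w x).1 (cw x) e e0.
  pose d' := Num.min (d / 2) (1 / 4).
  have d'0 : 0 < d' by rewrite lt_min; apply/andP; split; lra.
  have d'd : d' <= d / 2 by rewrite ge_min lexx.
  have d'4 : d' <= 1 / 4 by rewrite ge_min lexx orbT.
  have [y yx y01] : exists2 y, `|y - x| < d & 0 < y < 1.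
    have [x2|x2] := leP x (1 / 2).
      by exists (x + d'); [rewrite ltr_norml; apply/andP; split; lra|apply/andP; split; lra].
    by exists (x - d'); [rewrite ltr_norml; apply/andP; split; lra|apply/andP; split; lra].
  by have := dP y yx; rewrite (w0 y)// sub0r normrN => /ltW.
move=> x x01; apply/eqP; rewrite -subr_eq0.
rewrite (_ : u x - u 0 = w x - w 0); last by rewrite /w; ring.
by rewrite !w1 ?subrr ?lexx ?ler01.
Qed.

Lemma test_function_C1 phi : test_function phi ->
  [/\ phi 1 = phi 0, forall x, is_derive x 1 phi (derive1 phi x),
      continuous (derive1 phi) & AC01 phi (derive1 phi)].
Proof.
move=> [p c]; have D x : is_derive x 1 phi (derive1 phi x).
  by apply: (@Ck_on_is_derive _ 0 setT).
have cd : continuous (derive1 phi).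
  by move=> x; have /Ck_onS[_ /Ck_on0] := c 1%N; apply.
split => //; first by have := p 0; rewrite add0r.
exact: C1_AC.
Qed.

(** f and the primitive G of g act alike on derivatives of test functions, so f - G is constant. The
    boundary terms of G vanish because testing with the constant 1 shows that g has mean zero. *)
Lemma weak_derivative_AC f g : continuous f -> weak_derivative f g -> AC01 f g.
Proof.
move=> cf [g2 wg]; have Ig := in_L2_integrable g2.
have aG := AC_prim 0 Ig; pose G x := 0 + itg 0 (clamp01 x) g.
have [cG _ _] := aG.
have g0 : itg 0 1 g = 0.
  have t1 : test_function (fun=> 1 : R) by split => // k; exact: Ck_on_cst openT.
  have := wg _ t1; rewrite !int01E.
  rewrite (eq_itg (g := fun=> 0)); last by move=> x _; rewrite derive1_cst mulr0.
  rewrite itg_cst// mul0r [in RHS](eq_itg (g := g)); last by move=> x _; rewrite mulr1.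
  by move=> /eqP; rewrite eq_sym oppr_eq0 => /eqP.
have G0 : G 0 = 0 by rewrite /G clamp01_id ?lexx ?ler01// itg_xx addr0.
have G1 : G 1 = 0 by rewrite /G clamp01_id ?lexx ?ler01// g0 addr0.
have cu : continuous (fun x => f x - G x) by exact: cts_sub.
have E := @du_bois_reymond (fun x => f x - G x) cu.
have {}E x : 0 <= x <= 1 -> f x - G x = f 0 - G 0.
  apply: E => phi tphi; have [p01 dphi cphi aphi] := test_function_C1 tphi.
  rewrite int01E (eq_itg (g := fun x => f x * derive1 phi x - G x * derive1 phi x)); last first.
    by move=> y _; ring.
  rewrite itgB; try (by apply: continuous_integrable_on; exact: cts_mul).
  have := wg _ tphi; rewrite !int01E => ->.
  by rewrite (itg_parts aG aphi) -/(G 1) -/(G 0) G0 G1; ring.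
split => // x x01; have := E x x01; rewrite G0 /G clamp01_id//; lra.
Qed.

Lemma AC_weak_derivative f g : f 1 = f 0 -> in_L2 g -> AC01 f g -> weak_derivative f g.
Proof.
move=> f10 g2 fg; split => // phi tphi; have [p01 dphi cphi aphi] := test_function_C1 tphi.
by rewrite !int01E (itg_parts fg aphi) p01 f10; ring.
Qed.

Lemma periodic1_10 f : periodic1 f -> f 1 = f 0.
Proof. by move=> /(_ 0); rewrite add0r. Qed.

Lemma H1_AC f : H1 f -> in_L2 (wderiv f) /\ AC01 f (wderiv f).
Proof.
move=> [pf cf wf]; have : weak_derivative f (wderiv f) by exact: (xgetPex _ wf).
by move=> w; split; [exact: w.1|exact: weak_derivative_AC].
Qed.

Lemma H1_continuous f : H1 f -> continuous f. Proof. by case. Qed.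

Lemma H1_periodic f : H1 f -> periodic1 f. Proof. by case. Qed.

Lemma AC_H1 f g : periodic1 f -> in_L2 g -> AC01 f g -> H1 f.
Proof.
move=> pf g2 fg; have [cf _ _] := fg; split => //; exists g.
by apply: AC_weak_derivative => //; exact: periodic1_10.
Qed.

Lemma H1_wderiv_ae f g : H1 f -> AC01 f g -> ae_eq mu `[0, 1]%classic (wderiv f) g.
Proof. by move=> /H1_AC[_ fw] fg; exact: AC_unique fw fg. Qed.

(** [wderiv f] is an arbitrary choice determined up to null sets; its norm may be computed from any
    derivative at hand. *)
Lemma sqnorm_wderiv f g : H1 f -> AC01 f g -> sqnorm (wderiv f) = sqnorm g.
Proof.
move=> hf fg; have [w2 fw] := H1_AC hf; have ae := H1_wderiv_ae hf fg.
have mg : measurable_fun (`[0, 1] : set R) g by case: fg => _ /integrable_on_measurable.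
rewrite /sqnorm !int01E; apply: eq_itg_ae.
- exact: (measurable_funX 2 w2.1).
- exact: (measurable_funX 2 mg).
- by apply: filterS ae => x /= H x01; rewrite H.
Qed.

Lemma H1_smooth f f' : periodic1 f -> (forall x, is_derive x 1 f (f' x)) -> continuous f' -> H1 f.
Proof.
move=> pf df cf'; apply: AC_H1 (C1_AC df cf') => //; exact: continuous_in_L2.
Qed.

Lemma H1D f g : H1 f -> H1 g -> H1 (fun x => f x + g x).
Proof.
move=> hf hg; have [f2 fw] := H1_AC hf; have [g2 gw] := H1_AC hg.
apply: AC_H1 (ACD fw gw); last exact: in_L2D.
by move=> x; rewrite (H1_periodic hf) (H1_periodic hg).
Qed.

Lemma H1Z c f : H1 f -> H1 (fun x => c * f x).
Proof.
move=> hf; have [f2 fw] := H1_AC hf.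
apply: AC_H1 (ACZ c fw); last exact: in_L2Z.
by move=> x; rewrite (H1_periodic hf).
Qed.

End WeakDerivative.

(** * Time changes and the Levi-Civita transform *)

Section TimeChange.
Variable R : realType.
Implicit Types (f g k h u v w z : R -> R) (a b c d e x y s t : R).
Local Notation mu := (@lebesgue_measure R).

(** Extreme preimages replace the inverse of a monotone function that may have flat pieces. *)
Lemma inf_preimage f t : continuous f -> {homo f : x y / x <= y} ->
  (exists x, f x = t) -> (exists a, f a < t) ->
  f (inf [set x | f x = t]) = t /\ forall x, x < inf [set x | f x = t] -> f x < t.
Proof.
move=> cf mf [x0 fx0] [a fa]; set S := [set x | f x = t].
have lb x : S x -> a <= x.
  by move=> Sx; rewrite leNgt; apply/negP => /ltW/mf; rewrite Sx leNgt fa.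
have hS : has_inf S by split; [exists x0|exists a => x /lb].
have infS x : S x -> inf S <= x by move=> Sx; exact: (ge_inf hS.2).
have fi : f (inf S) = t.
  apply/eqP; rewrite eq_le; apply/andP; split; first by rewrite -fx0; apply/mf/infS.
  rewrite leNgt; apply/negP => fi.
  have e0 : 0 < t - f (inf S) by rewrite subr_gt0.
  have [d d0 dP] := (continuous_atP f (inf S)).1 (cf _) _ e0.
  have [x Sx xi] := inf_adherent d0 hS.
  have := dP x; rewrite Sx ger0_norm ?subr_ge0 ?infS// ltrBlDl => /(_ xi).
  by rewrite ger0_norm ?ltxx// ltW.
split => // x xi; rewrite lt_neqAle; apply/andP; split.
  by apply/eqP => fx; move: xi; rewrite ltNge infS.
by rewrite -fi; apply/mf/ltW.
Qed.

Lemma sup_preimage f t : continuous f -> {homo f : x y / x <= y} ->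
  (exists x, f x = t) -> (exists a, t < f a) ->
  exists2 b, f b = t & forall x, b < x -> t < f x.
Proof.
move=> cf mf [x0 fx0] [a fa]; pose f' x := - f (- x).
have [] := @inf_preimage f' (- t).
- apply: cts_opp; apply: (cts_comp cf) => x; exact: opp_continuous.
- by move=> x y xy; rewrite /f' lerN2; apply: mf; rewrite lerN2.
- by exists (- x0); rewrite /f' opprK fx0.
- by exists (- a); rewrite /f' opprK ltrN2.
set i := inf _ => fi iP; exists (- i); first by apply: oppr_inj.
move=> x ix; have : f' (- x) < - t by apply: iP; rewrite ltrNl.
by rewrite /f' opprK ltrN2.
Qed.

Variable z : R -> R.
Hypotheses (cz : continuous z) (pz : periodic1 z) (z0 : 0 < sqnorm z).
Let C := sqnorm z.
Let z2 x := z x ^+ 2.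
Let cz2 : continuous z2. Proof. exact: cts_exp. Qed.

Lemma time_changeE x : time_change z x = C^-1 * prim z2 x.
Proof. by []. Qed.

Lemma is_derive_time_change x : is_derive x 1 (time_change z) (z x ^+ 2 / C).
Proof. by apply: is_derive_eq (derZ C^-1 (is_derive_prim x cz2)) _; rewrite mulrC. Qed.

Lemma time_change_continuous : continuous (time_change z).
Proof. exact: continuous_derive is_derive_time_change. Qed.

Lemma time_change0 : time_change z 0 = 0.
Proof. by rewrite time_changeE prim0 mulr0. Qed.

Lemma time_change1 : time_change z 1 = 1.
Proof. by rewrite time_changeE prim_ge0// mulVf// gt_eqF. Qed.

Lemma time_change_shift x : time_change z (x + 1) = time_change z x + 1.
Proof.
rewrite !time_changeE prim_shift1//; last by move=> y; rewrite /z2 pz.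
by rewrite mulrDr -int01E mulVf// gt_eqF.
Qed.

Lemma time_change_int (n : int) x : time_change z (x + n%:~R) = time_change z x + n%:~R.
Proof.
have N m y : time_change z (y + m%:R) = time_change z y + m%:R.
  by elim: m => [|m IH]; rewrite ?addr0// -natr1 addrA time_change_shift IH addrA.
case: n => n; first exact: N.
rewrite NegzE mulrNz; apply: (addIr n.+1%:R); rewrite subrK.
by rewrite -N subrK.
Qed.

Lemma time_changeB x y : x <= y -> time_change z y - time_change z x = C^-1 * itg x y z2.
Proof. by move=> xy; rewrite !time_changeE -mulrBr primB. Qed.

Lemma time_change_homo : {homo time_change z : x y / x <= y}.
Proof.
move=> x y xy; rewrite -subr_ge0 time_changeB//.
apply: mulr_ge0; first by rewrite invr_ge0 ltW.
by apply: itg_ge0 => s _; exact: sqr_ge0.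
Qed.

Lemma time_change_surj01 t : 0 <= t <= 1 -> exists2 x, 0 <= x <= 1 & time_change z x = t.
Proof.
move=> t01; have [] := @IVT R (time_change z) 0 1 t ler01.
- by apply: continuous_within; exact: time_change_continuous.
- by rewrite time_change0 time_change1 min_l// max_r.
- by move=> x; rewrite in_itv/= => x01 <-; exists x.
Qed.

Lemma time_change_surj t : exists x, time_change z x = t.
Proof.
have [|x _ xE] := @time_change_surj01 (t - (Num.floor t)%:~R).
  by rewrite subr_ge0 floor_le_tmp/= lerBlDl -intrD1 ltW// floorD1_gt.
by exists (x + (Num.floor t)%:~R); rewrite time_change_int xE subrK.
Qed.

Lemma time_change_itv01 x : 0 <= x <= 1 -> 0 <= time_change z x <= 1.
Proof.
move=> /andP[x0 x1]; rewrite -time_change0 -[X in _ <= _ <= X]time_change1.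
by rewrite !time_change_homo.
Qed.

Lemma inv_time_changeP t : time_change z (inv_time_change z t) = t /\
  forall x, x < inv_time_change z t -> time_change z x < t.
Proof.
apply: inf_preimage; [exact: time_change_continuous|exact: time_change_homo|exact: time_change_surj|].
by have [a aE] := time_change_surj (t - 1); exists a; rewrite aE gtrBl.
Qed.

(** Monotonicity makes t_z constant on [x, y], so its derivative z^2 / C vanishes inside, and at the
    ends by continuity. This is why q does not depend on the preimage chosen. *)
Lemma time_change_flat x y : time_change z x = time_change z y -> x < y ->
  forall s, x <= s <= y -> z s = 0.
Proof.
move=> txy xy s /andP[xs sy].
have ts r : x <= r <= y -> time_change z r = time_change z x.
  move=> /andP[xr ry]; apply/eqP; rewrite eq_le {1}txy.
  by rewrite !time_change_homo.
have z20 r : x < r < y -> z2 r = 0.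
  move=> /andP[xr ry].
  have D : is_derive r 1 (time_change z) 0.
    apply: (@near_is_derive _ (fun=> time_change z x)) => //.
    have : \forall q \near r, r \in `]x, y[ -> q \in `]x, y[.
      near=> q => _; rewrite in_itv/=; apply/andP; split; near: q.
        exact: lt_nbhsr.
      exact: lt_nbhsl.
    apply: filterS => q; rewrite !in_itv/= xr ry => /(_ isT) /andP[xq qy].
    by rewrite ts// !ltW.
  have /eqP := derive1_val (is_derive_time_change r); rewrite (derive1_val D).
  by rewrite eq_sym mulf_eq0 invr_eq0 (gt_eqF z0) orbF => /eqP.
suff : z2 s = 0 by rewrite /z2 => /eqP; rewrite sqrf_eq0 => /eqP.
apply/eqP; rewrite -normr_le0; apply/ler_addgt0Pr => e e0; rewrite add0r.
have [d d0 dP] := (continuous_atP z2 s).1 (@cz2 s) e e0.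
have [r rs rxy] : exists2 r, `|r - s| < d & x < r < y.
  pose d' := Num.min (d / 2) ((y - x) / 4).
  have d'0 : 0 < d' by rewrite lt_min; apply/andP; split; lra.
  have d'd : d' <= d / 2 by rewrite ge_min lexx.
  have d'4 : d' <= (y - x) / 4 by rewrite ge_min lexx orbT.
  have [x2|x2] := leP s ((x + y) / 2).
    by exists (s + d'); [rewrite ltr_norml; apply/andP; split; lra|apply/andP; split; lra].
  by exists (s - d'); [rewrite ltr_norml; apply/andP; split; lra|apply/andP; split; lra].
by have := dP r rs; rewrite (z20 r)// sub0r normrN => /ltW.
Unshelve. all: by end_near. Qed.

Lemma time_change_inj_sq x y : time_change z x = time_change z y -> z x ^+ 2 = z y ^+ 2.
Proof.
wlog xy : x y / x < y => [H|] txy.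
  by have [/H->//|/H->//|->//] := ltgtP x y.
by rewrite !(time_change_flat txy xy) ?lexx ?ltW.
Qed.

Lemma levi_civita_time_change x : levi_civita z (time_change z x) = z x ^+ 2.
Proof. by apply: time_change_inj_sq; have [] := inv_time_changeP (time_change z x). Qed.

Lemma levi_civita_ge0 t : 0 <= levi_civita z t.
Proof. exact: sqr_ge0. Qed.

Lemma levi_civita_periodic : periodic1 (levi_civita z).
Proof.
move=> t; have [x <-] := time_change_surj t.
by rewrite -time_change_shift !levi_civita_time_change pz.
Qed.

(* On the side of t where t' lies, compare with the extreme preimage of t: preimages
   of nearby t' are then close to it, although the inverse time change may jump. *)
Lemma levi_civita_continuous : continuous (levi_civita z).
Proof.
move=> t; apply/continuous_atP => e e0.
have [[a aE] [b bE]] := (time_change_surj (t - 1), time_change_surj (t + 1)).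
have [tm mP] := inv_time_changeP t; set m := inv_time_change z t in tm mP.
have [|M tM MP] := sup_preimage time_change_continuous time_change_homo (time_change_surj t).
  by exists b; rewrite bE ltrDl.
have [d1 d10 d1P] := (continuous_atP z2 m).1 (@cz2 m) e e0.
have [d2 d20 d2P] := (continuous_atP z2 M).1 (@cz2 M) e e0.
have A1 : time_change z (m - d1 / 2) < t by apply: mP; lra.
have A2 : t < time_change z (M + d2 / 2) by apply: MP; lra.
exists (Num.min (t - time_change z (m - d1 / 2)) (time_change z (M + d2 / 2) - t)).
  by rewrite lt_min !subr_gt0 A1.
move=> s; rewrite lt_min => /andP[]; have [x <-] := time_change_surj s.
rewrite levi_civita_time_change.
have [xt|tx|E] := ltgtP (time_change z x) t.
- move=> B _; rewrite -tm levi_civita_time_change; apply: d1P.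
  have xm : x < m by rewrite ltNge; apply/negP => /time_change_homo; rewrite tm leNgt xt.
  rewrite ltr0_norm ?subr_lt0// opprB ltrBlDr -ltrBlDl.
  rewrite ltNge; apply/negP => /= H.
  have /time_change_homo : x <= m - d1 / 2 by apply: le_trans H _; rewrite lerD2l lerN2 ler_pdivrMr// mulr_natr mulr2n lerDl ltW.
  by rewrite leNgt; move: B; rewrite ltr0_norm ?subr_lt0// opprB ltrD2l ltrN2 => ->.
- move=> _ B; rewrite -tM levi_civita_time_change; apply: d2P.
  have xm : M < x by rewrite ltNge; apply/negP => /time_change_homo; rewrite tM leNgt tx.
  rewrite gtr0_norm ?subr_gt0// ltrBlDl.
  rewrite ltNge; apply/negP => /= H.
  have /time_change_homo : M + d2 / 2 <= x by apply: le_trans _ H; rewrite lerD2l ler_pdivrMr// mulr_natr mulr2n lerDl ltW.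
  by rewrite leNgt; move: B; rewrite gtr0_norm ?subr_gt0// ltrD2r => ->.
- by move=> _ _; rewrite -E levi_civita_time_change subrr normr0.
Qed.

(** The chain rule for the primitive of k composed with t_z; flat pieces of t_z are allowed, since
    no inverse occurs. *)
Lemma itg_time_change k : continuous k ->
  itg 0 1 k = C^-1 * itg 0 1 (fun x => z x ^+ 2 * k (time_change z x)).
Proof.
move=> ck; have ctz : continuous (fun x => z x ^+ 2 / C).
  by apply: cts_mul => //; exact: cst_continuous.
have a1 := C1_AC is_derive_time_change ctz.
have [_ _ /(_ 1)] := AC_comp (fun x => is_derive_prim x ck) ck a1.
rewrite lexx ler01 time_change0 time_change1 prim0 add0r prim_ge0// => /(_ isT) ->.
rewrite -itgZ; last first.
  apply: continuous_integrable_on; apply: cts_mul => //.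
  by apply: (cts_comp ck); exact: time_change_continuous.
by apply: eq_itg => x _; ring.
Qed.

End TimeChange.

(** * Expansions with uniform remainder *)

Section UniformDifferentiability.
Variables (R : realType) (H : Type) (D : set H) (N : H -> R).
Hypothesis N_ge0 : forall h, D h -> 0 <= N h.

(* Frechet expansion F h = F0 + L h + o(N h), uniform in the parameter x in A. *)
Definition udiff (X : Type) (A : set X) (F0 : X -> R) (F L : H -> X -> R) : Prop :=
  [/\ exists2 K : R, 0 <= K & forall x, A x -> `|F0 x| <= K,
      exists2 K : R, 0 <= K & forall h, D h -> forall x, A x -> `|L h x| <= K * N h
    & forall e : R, 0 < e -> exists2 d : R, 0 < d & forall h, D h -> N h < d ->
        forall x, A x -> `|F h x - F0 x - L h x| <= e * N h].

Section Rules.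
Variables (X : Type) (A : set X).
Implicit Types (F G L M : H -> X -> R).

Lemma udiff_lip (F0 : X -> R) F L : udiff A F0 F L ->
  exists2 K : R, 0 <= K & exists2 d : R, 0 < d & forall h, D h -> N h < d ->
    forall x, A x -> `|F h x - F0 x| <= K * N h.
Proof.
move=> [_ [K K0 KP] HF]; exists (K + 1); first lra.
have [d d0 dP] := HF 1 ltr01; exists d => // h Dh hd x Ax.
rewrite (_ : F h x - F0 x = L h x + (F h x - F0 x - L h x)); last by ring.
by rewrite mulrDl (le_trans (ler_normD _ _))// lerD// ?KP// dP.
Qed.

Lemma udiff_small (F0 : X -> R) F L (e : R) : udiff A F0 F L -> 0 < e ->
  exists2 d : R, 0 < d & forall h, D h -> N h < d -> forall x, A x -> `|F h x - F0 x| <= e.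
Proof.
move=> /udiff_lip[K K0 [d d0 dP]] e0.
exists (Num.min d (e / (K + 1))); first by rewrite lt_min d0 divr_gt0//; lra.
move=> h Dh; rewrite lt_min => /andP[hd he] x Ax.
apply: (le_trans (dP h Dh hd x Ax)); have N0 := N_ge0 Dh.
move: he; rewrite ltr_pdivlMr; last lra.
by nra.
Qed.

Lemma udiff_ext (F0 G0 : X -> R) F G L M : udiff A F0 F L -> (forall x, A x -> F0 x = G0 x) ->
  (forall h, D h -> forall x, A x -> F h x = G h x) ->
  (forall h, D h -> forall x, A x -> L h x = M h x) -> udiff A G0 G M.
Proof.
move=> [[B B0 BP] [K K0 KP] HF] FG0 FG LM; split.
- by exists B => // x Ax; rewrite -FG0// BP.
- by exists K => // h Dh x Ax; rewrite -LM// KP.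
move=> e e0; have [d d0 dP] := HF e e0; exists d => // h Dh hd x Ax.
by rewrite -FG0// -FG// -LM// dP.
Qed.

Lemma udiff_quadratic (F0 : X -> R) L F (K1 K2 : R) : (exists2 K : R, 0 <= K & forall x, A x -> `|F0 x| <= K) ->
  0 <= K1 -> 0 <= K2 ->
  (forall h, D h -> forall x, A x -> `|L h x| <= K1 * N h) ->
  (forall h, D h -> forall x, A x -> `|F h x - F0 x - L h x| <= K2 * N h ^+ 2) ->
  udiff A F0 F L.
Proof.
move=> B K10 K20 HL HF; split => //; first by exists K1.
move=> e e0; exists (e / (K2 + 1)); first by rewrite divr_gt0//; lra.
move=> h Dh; rewrite ltr_pdivlMr; last lra.
move=> he x Ax; apply: (le_trans (HF h Dh x Ax)); have N0 := N_ge0 Dh.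
by nra.
Qed.

Lemma udiff_cst (F0 : X -> R) : (exists2 K : R, 0 <= K & forall x, A x -> `|F0 x| <= K) ->
  udiff A F0 (fun _ => F0) (fun _ _ => 0).
Proof.
move=> B; apply: (@udiff_quadratic _ _ _ 0 0) => // h Dh x Ax.
  by rewrite normr0 mul0r.
by rewrite subrr subr0 normr0 mul0r.
Qed.

Lemma udiffD (F0 G0 : X -> R) F G L M : udiff A F0 F L -> udiff A G0 G M ->
  udiff A (fun x => F0 x + G0 x) (fun h x => F h x + G h x) (fun h x => L h x + M h x).
Proof.
move=> [[B B0 BP] [K K0 KP] HF] [[B' B0' BP'] [K' K0' KP'] HF']; split.
- exists (B + B'); first lra.
  by move=> x Ax; rewrite (le_trans (ler_normD _ _))// lerD// ?BP// BP'.
- exists (K + K'); first lra.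
  by move=> h Dh x Ax; rewrite mulrDl (le_trans (ler_normD _ _))// lerD// ?KP// KP'.
move=> e e0; have e2 : 0 < e / 2 by lra.
have [d d0 dP] := HF _ e2; have [d' d0' dP'] := HF' _ e2.
exists (Num.min d d'); first by rewrite lt_min d0.
move=> h Dh; rewrite lt_min => /andP[hd hd'] x Ax.
rewrite (_ : _ - _ = (F h x - F0 x - L h x) + (G h x - G0 x - M h x)); last by ring.
rewrite (le_trans (ler_normD _ _))//.
have := dP h Dh hd x Ax; have := dP' h Dh hd' x Ax; lra.
Qed.

Lemma udiffM (F0 G0 : X -> R) F G L M : udiff A F0 F L -> udiff A G0 G M ->
  udiff A (fun x => F0 x * G0 x) (fun h x => F h x * G h x)
    (fun h x => L h x * G0 x + F0 x * M h x).
Proof.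
move=> uF uG; have [[B B0 BP] [K K0 KP] HF] := uF; have [[B' B0' BP'] [K' K0' KP'] HG] := uG.
have [E E0 [d1 d10 d1P]] := udiff_lip uG.
split.
- exists (B * B'); first by rewrite mulr_ge0.
  by move=> x Ax; rewrite normrM ler_pM// ?BP// BP'.
- exists (K * B' + B * K'); first by rewrite addr_ge0// mulr_ge0.
  move=> h Dh x Ax; rewrite (le_trans (ler_normD _ _))// !normrM mulrDl lerD//.
    by rewrite mulrAC ler_pM// ?KP// BP'.
  by rewrite -mulrA ler_pM// ?BP// KP'.
(* W adds up the coefficients of the three error terms. Requiring N h < e / W as well turns a
   product of two first-order quantities into a multiple of e / W * N h. *)
move=> e e0; pose W := B' + E + K * E + B + 1.
have W0 : 0 < W by rewrite /W; nra.
have eW : 0 < e / W by rewrite divr_gt0.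
have [d2 d20 d2P] := HF _ eW; have [d3 d30 d3P] := HG _ eW.
exists (Num.min d1 (Num.min d2 (Num.min d3 (Num.min 1 (e / W))))).
  by rewrite !lt_min d10 d20 d30 ltr01 eW.
move=> h Dh; rewrite !lt_min => /andP[h1 /andP[h2 /andP[h3 /andP[h4 h5]]]] x Ax.
have N0 := N_ge0 Dh.
rewrite (_ : _ - _ = (F h x - F0 x - L h x) * (G0 x + (G h x - G0 x)) + L h x * (G h x - G0 x)
  + F0 x * (G h x - G0 x - M h x)); last by ring.
rewrite (le_trans (ler_normD _ _))// (le_trans (lerD (ler_normD _ _) (lexx _)))// !normrM.
have a1 := d2P h Dh h2 x Ax; have a2 := d3P h Dh h3 x Ax; have a3 := d1P h Dh h1 x Ax.
have a4 := KP h Dh x Ax; have a5 := BP x Ax; have a6 := BP' x Ax.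
have b1 : `|G0 x + (G h x - G0 x)| <= B' + E.
  rewrite (le_trans (ler_normD _ _))// lerD// (le_trans a3)//.
  by rewrite -[X in _ <= X]mulr1 ler_wpM2l// ltW.
have c1 : `|F h x - F0 x - L h x| * `|G0 x + (G h x - G0 x)| <= (e / W * N h) * (B' + E) by apply: ler_pM.
have c2 : `|L h x| * `|G h x - G0 x| <= (K * N h) * (E * N h) by apply: ler_pM.
have c3 : `|F0 x| * `|G h x - G0 x - M h x| <= B * (e / W * N h) by apply: ler_pM.
have uW : e / W * W = e by rewrite divfK// gt_eqF.
move: c1 c2 c3 h5 eW; set u := e / W in uW *; set n := N h in N0 *; move=> c1 c2 c3 nu u0.
have c4 : K * n * (E * n) <= K * E * (u * n).
  rewrite (_ : K * n * (E * n) = K * E * (n * n)); last by ring.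
  by rewrite ler_wpM2l ?mulr_ge0// ler_wpM2r// ltW.
have un : 0 <= u * n by rewrite mulr_ge0// ltW.
apply: (@le_trans _ _ (u * n * (B' + E) + K * E * (u * n) + B * (u * n))); first lra.
by rewrite -uW /W; lra.
Qed.

Lemma udiffZ (F0 : X -> R) F L c : udiff A F0 F L ->
  udiff A (fun x => c * F0 x) (fun h x => c * F h x) (fun h x => c * L h x).
Proof.
move=> uF; have uc : udiff A (fun=> c) (fun _ _ => c) (fun _ _ => 0).
  by apply: udiff_cst; exists `|c|.
by apply: udiff_ext (udiffM uc uF) _ _ _ => // h Dh x Ax; rewrite mul0r add0r.
Qed.

Lemma udiffV (F0 : X -> R) F L (c : R) : 0 < c -> (forall x, A x -> c <= F0 x) -> udiff A F0 F L ->
  udiff A (fun x => (F0 x)^-1) (fun h x => (F h x)^-1) (fun h x => - L h x / F0 x ^+ 2).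
Proof.
move=> c0 cF uF; have [_ [K K0 KP] HF] := uF; have [E E0 [d1 d10 d1P]] := udiff_lip uF.
have F00 x : A x -> 0 < F0 x by move=> Ax; exact: lt_le_trans (cF x Ax).
have ci x y : A x -> c <= y -> y^-1 <= c^-1.
  by move=> Ax cy; rewrite lef_pV2 ?posrE// (lt_le_trans c0 cy).
have ci0 : 0 <= c^-1 by rewrite invr_ge0 ltW.
split.
- exists c^-1; first by rewrite invr_ge0 ltW.
  by move=> x Ax; rewrite gtr0_norm ?invr_gt0 ?F00// (ci x)// cF.
- exists (K * c^-1 ^+ 2); first by rewrite mulr_ge0// sqr_ge0.
  move=> h Dh x Ax; rewrite normrM normrN mulrAC ler_pM// ?KP// normrV ?unitfE ?expf_neq0 ?gt_eqF ?F00//.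
  rewrite normrX gtr0_norm ?F00// -exprVn lerXn2r ?nnegrE// ?invr_ge0 ?(ltW (F00 x Ax))//.
  by rewrite (ci x)// cF.
move=> e e0; pose W := (c^-1 * 2) * c^-1 + K * E * ((c^-1 * 2) * c^-1 ^+ 2) + 1.
have W0 : 0 < W.
  have a : 0 <= (c^-1 * 2) * c^-1 by rewrite !mulr_ge0.
  have b : 0 <= K * E * ((c^-1 * 2) * c^-1 ^+ 2) by rewrite !mulr_ge0// exprn_ge0.
  by rewrite /W; lra.
have u0 : 0 < e / W by rewrite divr_gt0.
have uW : e / W * W = e by rewrite divfK// gt_eqF.
have [d2 d20 d2P] := HF _ u0.
(* For small h this keeps F h above c / 2, so that its inverse is at most 2 / c. *)
have c2 : 0 < c / 2 by lra.
have [d3 d30 d3P] := udiff_small uF c2.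
exists (Num.min d1 (Num.min d2 (Num.min d3 (e / W)))).
  by rewrite !lt_min d10 d20 d30 u0.
move=> h Dh; rewrite !lt_min => /andP[h1 /andP[h2 /andP[h3 h4]]] x Ax.
have n0 := N_ge0 Dh.
have a1 := d1P h Dh h1 x Ax; have a2 := d2P h Dh h2 x Ax; have a3 := d3P h Dh h3 x Ax.
have a4 := KP h Dh x Ax; have a5 := cF x Ax.
have Fc : c / 2 <= F h x by move: a3; rewrite ler_norml => /andP[]; lra.
have FV : (F h x)^-1 <= c^-1 * 2.
  rewrite (_ : c^-1 * 2 = (c / 2)^-1); last by rewrite invfM invrK.
  by rewrite lef_pV2 ?posrE//; lra.
have FV0 : 0 < (F h x)^-1 by rewrite invr_gt0; lra.
have F0V := ci x _ Ax a5; have F0V0 : 0 < (F0 x)^-1 by rewrite invr_gt0 F00.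
have F0n : F0 x != 0 by rewrite gt_eqF ?F00.
have Fn : F h x != 0 by rewrite gt_eqF//; lra.
rewrite (_ : _ - _ = - ((F h x - F0 x - L h x) * ((F h x)^-1 * (F0 x)^-1))
  + L h x * (F h x - F0 x) * ((F h x)^-1 * (F0 x)^-1 ^+ 2)); last first.
  by field; rewrite F0n Fn.
rewrite (le_trans (ler_normD _ _))// normrN !normrM.
rewrite [`|(F h x)^-1|]gtr0_norm// [`|(F0 x)^-1|]gtr0_norm// -[(F0 x)^-1 * (F0 x)^-1]expr2.
move: u0 uW h4 a2; set u := e / W; move=> u0 uW h4 a2.
set n := N h in n0 a1 a2 a4 h4 *.
have b1 : `|F h x - F0 x - L h x| * ((F h x)^-1 * (F0 x)^-1) <= u * n * ((c^-1 * 2) * c^-1).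
  by apply: ler_pM => //; [rewrite mulr_ge0// ltW|apply: ler_pM => //; rewrite ltW].
have b2 : `|L h x| * `|F h x - F0 x| <= K * E * (u * n).
  apply: (@le_trans _ _ (K * n * (E * n))); first exact: ler_pM.
  rewrite (_ : K * n * (E * n) = K * E * (n * n)); last by ring.
  by rewrite ler_wpM2l ?mulr_ge0// ler_wpM2r// ltW.
have b3 : `|L h x| * `|F h x - F0 x| * ((F h x)^-1 * (F0 x)^-1 ^+ 2) <= K * E * (u * n) * ((c^-1 * 2) * c^-1 ^+ 2).
  have [g1 g2] := (ltW FV0, ltW F0V0).
  apply: ler_pM => //; first by rewrite ?mulr_ge0.
  by apply: ler_pM => //; [rewrite exprn_ge0|apply: lerXn2r; rewrite ?nnegrE].
apply: (le_trans (lerD b1 b3)).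
have un : 0 <= u * n by rewrite mulr_ge0// ltW.
by rewrite -uW /W; lra.
Qed.

Lemma udiff_comp (F0 : X -> R) F L (p p' : R -> R) : (forall x : R, is_derive x 1 p (p' x)) ->
  continuous p' -> udiff A F0 F L ->
  udiff A (fun x => p (F0 x)) (fun h x => p (F h x)) (fun h x => p' (F0 x) * L h x).
Proof.
move=> dp cp' uF; have [[B B0 BP] [K K0 KP] HF] := uF; have [E E0 [d1 d10 d1P]] := udiff_lip uF.
have cp := continuous_derive dp.
have [m m0 mP] := bounded_itv (- B) B cp; have [m' m'0 m'P] := bounded_itv (- B) B cp'.
have BP' x : A x -> - B <= F0 x <= B by move=> Ax; rewrite -ler_norml BP.
split.
- by exists m; [exact: ltW|move=> x Ax; rewrite mP ?BP'].
- exists (m' * K); first by rewrite mulr_ge0// ltW.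
  by move=> h Dh x Ax; rewrite normrM -mulrA ler_pM// ?KP// m'P// BP'.
move=> e e0; pose W := m' + E + 1; have W0 : 0 < W by rewrite /W; lra.
have u0 : 0 < e / W by rewrite divr_gt0.
have uW : e / W * W = e by rewrite divfK// gt_eqF.
have [r r0 rP] := uniform_continuous_itv (- B) B cp' u0.
have [d2 d20 d2P] := HF _ u0.
have r2 : 0 < r / 2 by lra.
have [d3 d30 d3P] := udiff_small uF r2.
exists (Num.min d1 (Num.min d2 d3)); first by rewrite !lt_min d10 d20.
move=> h Dh; rewrite !lt_min => /andP[h1 /andP[h2 h3]] x Ax.
have n0 := N_ge0 Dh.
have a1 := d1P h Dh h1 x Ax; have a2 := d2P h Dh h2 x Ax; have a3 := d3P h Dh h3 x Ax.
have [c c1 c2] := MVT_between (F0 x) (F h x) dp.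
have pc : `|p' c - p' (F0 x)| <= e / W.
  apply/ltW/rP; first exact: BP'.
  by apply: le_lt_trans c1 _; apply: le_lt_trans a3 _; lra.
rewrite (_ : _ - _ = p' (F0 x) * (F h x - F0 x - L h x) + (p' c - p' (F0 x)) * (F h x - F0 x)); last first.
  by rewrite c2; ring.
rewrite (le_trans (ler_normD _ _))// !normrM.
have b1 : `|p' (F0 x)| * `|F h x - F0 x - L h x| <= m' * (e / W * N h).
  by apply: ler_pM => //; rewrite m'P// BP'.
have b2 : `|p' c - p' (F0 x)| * `|F h x - F0 x| <= e / W * (E * N h) by apply: ler_pM.
apply: (le_trans (lerD b1 b2)).
have un : 0 <= e / W * N h by rewrite mulr_ge0// ltW.
rewrite (_ : _ + _ = (e / W * N h) * (m' + E)); last by ring.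
by rewrite (_ : e * N h = (e / W * N h) * W) ?ler_wpM2l//; [rewrite /W; lra|rewrite mulrAC uW].
Qed.

End Rules.

(** A product rule under the integral in which F is expanded uniformly but u only in L^1. It is
    meant for u = z z', whose pointwise values are not controlled by the norm of H^1. *)
Lemma udiff_itg (F0 : R -> R) (F L : H -> R -> R) (u0 : R -> R) (u v : H -> R -> R) (K1 K2 : R) :
  udiff [set x | 0 <= x <= 1] F0 F L -> continuous F0 ->
  (forall h, D h -> continuous (F h)) -> (forall h, D h -> continuous (L h)) ->
  integrable_on 0 1 u0 -> (forall h, D h -> integrable_on 0 1 (u h)) ->
  (forall h, D h -> integrable_on 0 1 (v h)) -> 0 <= K1 -> 0 <= K2 ->
  (forall h, D h -> itg 0 1 (fun x => `|v h x|) <= K1 * N h) ->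
  (forall h, D h -> itg 0 1 (fun x => `|u h x - u0 x - v h x|) <= K2 * N h ^+ 2) ->
  udiff [set: unit] (fun=> itg 0 1 (fun x => F0 x * u0 x))
    (fun h _ => itg 0 1 (fun x => F h x * u h x))
    (fun h _ => itg 0 1 (fun x => L h x * u0 x + F0 x * v h x)).
Proof.
move=> uF cF0 cF cL Iu0 Iu Iv K10 K20 HV HU.
have [[B B0 BP] [K K0 KP] HF] := uF; have [E E0 [d1 d10 d1P]] := udiff_lip uF.
have I1 h : D h -> integrable_on 0 1 (fun x => L h x * u0 x).
  by move=> Dh; apply: integrable_onM => //; exact: cL.
have I2 h : D h -> integrable_on 0 1 (fun x => F0 x * v h x).
  by move=> Dh; apply: integrable_onM => //; exact: Iv.
have I3 h : D h -> integrable_on 0 1 (fun x => F h x * u h x).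
  by move=> Dh; apply: integrable_onM; [exact: cF|exact: Iu].
have I4 : integrable_on 0 1 (fun x => F0 x * u0 x) by exact: integrable_onM.
pose U := itg 0 1 (fun x => `|u0 x|).
have U0 : 0 <= U by apply: itg_ge0 => x _.
have IU := integrable_on_norm Iu0.
split.
- by exists `|itg 0 1 (fun x => F0 x * u0 x)|.
- exists (K * U + B * K1); first by rewrite addr_ge0// mulr_ge0.
  move=> h Dh _ _; have IV := integrable_on_norm (Iv h Dh).
  apply: (@le_trans _ _ (itg 0 1 (fun x => (K * N h) * `|u0 x| + B * `|v h x|))).
    apply: itg_norm_le.
    + by apply: integrable_onD; [exact: I1|exact: I2].
    + by apply: integrable_onD; exact: integrable_onZ.
    + move=> x x01; rewrite (le_trans (ler_normD _ _))// !normrM lerD// ler_wpM2r//.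
        exact: KP.
      exact: BP.
  rewrite itgD; [|exact: integrable_onZ|exact: integrable_onZ].
  rewrite !itgZ// -/U; have := HV h Dh => HV'.
  rewrite mulrDl mulrAC lerD// -mulrA ler_wpM2l//.
move=> e e0; pose W := U + E * K1 + (B + E) * K2 + 1.
have W0 : 0 < W.
  have p1 : 0 <= E * K1 by rewrite mulr_ge0.
  have p2 : 0 <= (B + E) * K2 by rewrite mulr_ge0// addr_ge0.
  by rewrite /W; lra.
have q0 : 0 < e / W by rewrite divr_gt0.
have qW : e / W * W = e by rewrite divfK// gt_eqF.
have [d2 d20 d2P] := HF _ q0.
exists (Num.min d1 (Num.min d2 (Num.min 1 (e / W)))); first by rewrite !lt_min d10 d20 ltr01.
move=> h Dh; rewrite !lt_min => /andP[h1 /andP[h2 /andP[h3 h4]]] _ _.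
have n0 := N_ge0 Dh; have IV := integrable_on_norm (Iv h Dh).
have Ir : integrable_on 0 1 (fun x => `|u h x - u0 x - v h x|).
  by apply/integrable_on_norm/integrable_onB; [apply: integrable_onB => //; exact: Iu|exact: Iv].
rewrite -itgB//; last exact: I3.
rewrite -itgB; [|by apply: integrable_onB => //; exact: I3|by apply: integrable_onD; [exact: I1|exact: I2]].
apply: (@le_trans _ _ (itg 0 1 (fun x => (e / W * N h) * `|u0 x| + ((E * N h) * `|v h x| +
    (B + E) * `|u h x - u0 x - v h x|)))).
  apply: itg_norm_le.
  - apply: integrable_onB; first by apply: integrable_onB => //; exact: I3.
    by apply: integrable_onD; [exact: I1|exact: I2].
  - by do 2?apply: integrable_onD; exact: integrable_onZ.
  - move=> x x01; have a1 := d1P h Dh h1 x x01; have a2 := d2P h Dh h2 x x01.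
    rewrite (_ : _ - _ = (F h x - F0 x - L h x) * u0 x + ((F h x - F0 x) * v h x +
      F h x * (u h x - u0 x - v h x))); last by ring.
    have a3 : `|F h x| <= B + E.
      rewrite (_ : F h x = F0 x + (F h x - F0 x)); last by ring.
      rewrite (le_trans (ler_normD _ _))// lerD//; first exact: BP.
      by apply: (le_trans a1); rewrite -[X in _ <= X]mulr1 ler_wpM2l// ltW.
    rewrite (le_trans (ler_normD _ _))// lerD//; first by rewrite normrM ler_wpM2r.
    by rewrite (le_trans (ler_normD _ _))// lerD// normrM ler_wpM2r.
rewrite itgD; [|exact: integrable_onZ|by apply: integrable_onD; exact: integrable_onZ].
rewrite itgD; [|exact: integrable_onZ|exact: integrable_onZ].
rewrite !itgZ// -/U.
have b1 : E * N h * itg 0 1 (fun x => `|v h x|) <= E * K1 * (e / W * N h).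
  apply: (@le_trans _ _ (E * N h * (K1 * N h))).
    by apply: ler_wpM2l; [rewrite mulr_ge0|exact: HV].
  rewrite (_ : _ * _ = E * K1 * (N h * N h)); last by ring.
  by rewrite ler_wpM2l ?mulr_ge0// ler_wpM2r// ltW.
have b2 : (B + E) * itg 0 1 (fun x => `|u h x - u0 x - v h x|) <= (B + E) * K2 * (e / W * N h).
  rewrite -mulrA ler_wpM2l ?addr_ge0//; apply: (le_trans (HU h Dh)).
  by rewrite ler_wpM2l// expr2 ler_wpM2r// ltW.
have un : 0 <= e / W * N h by rewrite mulr_ge0// ltW.
apply: (@le_trans _ _ (e / W * N h * U + (E * K1 * (e / W * N h) + (B + E) * K2 * (e / W * N h)))).
  by rewrite lerD2l lerD.
rewrite (_ : _ + _ = (e / W * N h) * (U + E * K1 + (B + E) * K2)); last by ring.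
by rewrite (_ : e * N h = (e / W * N h) * W) ?ler_wpM2l//; [rewrite /W; lra|rewrite mulrAC qW].
Qed.

End UniformDifferentiability.

(** * First variation of the one-body action *)

Lemma sqnormE (R : realType) (f : R -> R) : sqnorm f = itg 0 1 (fun x => f x ^+ 2).
Proof. by []. Qed.

Lemma levi_civitaE (R : realType) (z : R -> R) t : levi_civita z t = z (inv_time_change z t) ^+ 2.
Proof. by []. Qed.

(* Keeps unification from unfolding integrals when it compares distinct terms. *)
Opaque itg sqnorm wderiv prim time_change levi_civita.

(** * Sobolev bounds on the circle *)

Section SobolevNorm.
Variable R : realType.
Implicit Types (f g h u v w z : R -> R) (a b c d e x y s t : R).

Definition H1_norm1 h : R := Num.sqrt (sqnorm h + sqnorm (wderiv h)).

Lemma H1_norm1_ge0 h : 0 <= H1_norm1 h. Proof. exact: sqrtr_ge0. Qed.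

Lemma H1_norm1_sqr h : H1_norm1 h ^+ 2 = sqnorm h + sqnorm (wderiv h).
Proof. by rewrite sqr_sqrtr// addr_ge0 ?sqnorm_ge0. Qed.

Lemma le_of_sqr_le a b : 0 <= b -> a ^+ 2 <= b ^+ 2 -> a <= b.
Proof.
move=> b0 ab; have [//|ba] := leP a b.
have : b ^+ 2 < a ^+ 2 by rewrite ltrXn2r// ltW.
by rewrite ltNge ab.
Qed.

Lemma sqnorm_le_H1 h : sqnorm h <= H1_norm1 h ^+ 2.
Proof. by rewrite H1_norm1_sqr lerDl sqnorm_ge0. Qed.

Lemma sqnorm_wderiv_le_H1 h : sqnorm (wderiv h) <= H1_norm1 h ^+ 2.
Proof. by rewrite H1_norm1_sqr lerDr sqnorm_ge0. Qed.

Lemma itg_abs_le_H1 h : continuous h -> itg 0 1 (fun x => `|h x|) <= H1_norm1 h.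
Proof.
move=> ch; apply: le_of_sqr_le; first exact: H1_norm1_ge0.
by apply: (le_trans (itg_norm_sqr_le (continuous_in_L2 ch))); exact: sqnorm_le_H1.
Qed.

Lemma itg_abs_wderiv_le_H1 h : H1 h -> itg 0 1 (fun x => `|wderiv h x|) <= H1_norm1 h.
Proof.
move=> hh; have [h2 _] := H1_AC hh; apply: le_of_sqr_le; first exact: H1_norm1_ge0.
by apply: (le_trans (itg_norm_sqr_le h2)); exact: sqnorm_wderiv_le_H1.
Qed.

Lemma itg_ge0_mono f x : integrable_on 0 1 f -> 0 <= x <= 1 ->
  (forall s, 0 <= s <= 1 -> 0 <= f s) -> itg 0 x f <= itg 0 1 f.
Proof.
move=> If x01 f0; rewrite (itg_split x01 If) lerDl.
by apply: itg_ge0 => s /andP[xs s1]; apply: f0; rewrite s1 (le_trans _ xs)//; case/andP: x01.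
Qed.

Lemma itg_ge0_sub f x y : integrable_on 0 1 f -> 0 <= x -> x <= y -> y <= 1 ->
  (forall s, 0 <= s <= 1 -> 0 <= f s) -> itg x y f <= itg 0 1 f.
Proof.
move=> If x0 xy y1 f0; have y0 := le_trans x0 xy; have x1 := le_trans xy y1.
apply: le_trans (itg_ge0_mono If (x := y) _ f0); last by rewrite y0.
rewrite (@itg_split _ 0 x y) ?x0//; last by apply: integrable_onS If.
by rewrite lerDr; apply: itg_ge0 => s /andP[s0 sx]; apply: f0; rewrite s0 (le_trans sx).
Qed.

(** |h x| exceeds |h y| by at most int |h'|. Averaging over y leaves two L^1 norms, each bounded by
    the norm of H^1 through Cauchy-Schwarz. *)
Lemma sup_le_H1 h x : H1 h -> 0 <= x <= 1 -> `|h x| <= 2 * H1_norm1 h.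
Proof.
move=> hh x01; have [h2 ah] := H1_AC hh; have ch := H1_continuous hh.
have Ia := integrable_on_norm (in_L2_integrable h2).
have K y : 0 <= y <= 1 -> `|h x| - itg 0 1 (fun s => `|wderiv h s|) <= `|h y|.
  move=> y01; rewrite lerBlDr (_ : h x = h y + (h x - h y)); last by ring.
  rewrite (le_trans (ler_normD _ _))// lerD2l.
  have W a b : 0 <= a -> a <= b -> b <= 1 -> `|h b - h a| <= itg 0 1 (fun s => `|wderiv h s|).
    move=> a0 ab b1; rewrite (AC_incr ah)//.
    apply: (le_trans (itg_norm _)); first by apply: integrable_onS (in_L2_integrable h2).
    by apply: itg_ge0_sub.
  case/andP: x01 => x0 x1; case/andP: y01 => y0 y1.
  by have [xy|yx] := leP x y; [rewrite distrC; exact: W|apply: W => //; exact: ltW].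
have Icst c : integrable_on 0 1 (fun=> c) by apply: continuous_integrable_on; exact: cst_continuous.
have := itg_le (Icst _) (integrable_on_norm (continuous_integrable_on 0 1 ch)) K.
rewrite itg_cst// subr0 mulr1 lerBlDr => /le_trans; apply.
apply: le_trans (lerD (itg_abs_le_H1 ch) (itg_abs_wderiv_le_H1 hh)) _.
by rewrite -mulr2n mulr_natl.
Qed.

(** The factor [sqnorm g + 1] dominates the square root of [sqnorm g] and so avoids it. *)
Lemma itg_cauchy_H1 g h : in_L2 g -> H1 h ->
  `|itg 0 1 (fun x => g x * wderiv h x)| <= (sqnorm g + 1) * H1_norm1 h.
Proof.
move=> g2 hh; have [h2 _] := H1_AC hh; have g0 := sqnorm_ge0 g.
apply: le_of_sqr_le; first by rewrite mulr_ge0 ?H1_norm1_ge0//; lra.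
rewrite real_normK ?num_real//.
apply: (le_trans (cauchy_schwarz g2.2 h2.2 (in_L2_prod g2 h2))).
rewrite exprMn; apply: ler_pM; try (by rewrite -sqnormE; exact: sqnorm_ge0).
  by rewrite -sqnormE; nra.
by rewrite -sqnormE; exact: sqnorm_wderiv_le_H1.
Qed.

End SobolevNorm.

Section OneBody.
Variable R : realType.
Variable z : R -> R.
Hypotheses (hz : H1 z) (z0 : 0 < sqnorm z).
Implicit Types (f g h u v w : R -> R) (a b c d e x y s t : R).
Local Notation C := (sqnorm z).
Local Notation g := (wderiv z).
Let cz : continuous z. Proof. exact: H1_continuous. Qed.
Let pz : periodic1 z. Proof. exact: H1_periodic. Qed.
Let g2 : in_L2 g. Proof. by have [] := H1_AC hz. Qed.
Let Ig : integrable_on 0 1 g. Proof. exact: in_L2_integrable. Qed.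
Let az : AC01 z g. Proof. by have [] := H1_AC hz. Qed.

Definition admissible : set (R -> R) := [set h | H1 h /\ 0 < sqnorm (fun x => z x + h x)].
Local Notation D := admissible.
Local Notation N := (@H1_norm1 R).
Local Notation I01 := [set x : R | 0 <= x <= 1].
Let N0 h : D h -> 0 <= N h. Proof. by move=> _; exact: H1_norm1_ge0. Qed.

(* int f q dt in terms of z: integration by parts moves the derivative from f(t_z) onto
   z^2, so that only the primitive of f gets composed with the varying time change. *)
Lemma potential_formula f w w' : continuous f -> continuous w -> periodic1 w -> 0 < sqnorm w ->
  AC01 w w' -> itg 0 1 (fun t => f t * levi_civita w t) =
  prim f 1 * w 1 ^+ 2 - 2 * itg 0 1 (fun x => prim f (time_change w x) * (w x * w' x)).
Proof.
move=> cf cw pw w0 aw; have dt := is_derive_time_change cw.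
have ctw : continuous (time_change w) := continuous_derive dt.
have cw2 : continuous (fun x => w x ^+ 2) by exact: cts_exp.
have cdt : continuous (fun x => w x ^+ 2 / sqnorm w).
  by apply: cts_mul => //; exact: cst_continuous.
rewrite (itg_time_change cw w0); last first.
  by apply: cts_mul => //; exact: levi_civita_continuous.
have a1 := AC_comp (fun x => is_derive_prim x cf) cf (C1_AC dt cdt).
have a2 := AC_mul aw aw; have [cww Iww _] := a2.
have := itg_parts a1 a2; rewrite time_change0 time_change1// prim0 mul0r subr0.
rewrite (eq_itg (g := fun x => 2 * (prim f (time_change w x) * (w x * w' x)))); last first.
  by move=> x _; ring.
have Iw : integrable_on 0 1 (fun x => prim f (time_change w x) * (w x * w' x)).
  apply: integrable_onM; last by apply: integrable_onM => //; case: aw.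
  by case: a1.
rewrite itgZ// => ->; rewrite -expr2.
rewrite (_ : itg 0 1 (fun x => f (time_change w x) * (w x ^+ 2 / sqnorm w) * (w x * w x)) =
  (sqnorm w)^-1 * itg 0 1 (fun x => w x ^+ 2 * (f (time_change w x) * levi_civita w (time_change w x)))); first by ring.
rewrite -itgZ; last first.
  apply: continuous_integrable_on; apply: cts_mul => //; apply: cts_mul.
    exact: cts_comp.
  by apply: cts_comp => //; exact: levi_civita_continuous.
by apply: eq_itg => x _; rewrite levi_civita_time_change//; ring.
Qed.

Lemma udiff_pull (X Y : Type) (A : set X) (B : set Y) (p : Y -> X) (F0 : X -> R) (F L : (R -> R) -> X -> R) :
  (forall y : Y, B y -> A (p y)) -> udiff D N A F0 F L ->
  udiff D N B (fun y : Y => F0 (p y)) (fun h (y : Y) => F h (p y)) (fun h (y : Y) => L h (p y)).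
Proof.
move=> pAB [[K K0 KP] [K' K'0 K'P] HF]; split.
- by exists K => // y By; apply: KP; exact: pAB.
- by exists K' => // h Dh y By; apply: K'P => //; exact: pAB.
- by move=> e /HF[d d0 dP]; exists d => // h Dh hd y By; apply: dP => //; exact: pAB.
Qed.

Let DH h : D h -> H1 h. Proof. by case. Qed.
Let Dc h : D h -> continuous h. Proof. by case=> /H1_continuous. Qed.

Lemma udiff_prim_sqr : udiff D N I01 (fun x => itg 0 x (fun s => z s ^+ 2))
  (fun h x => itg 0 x (fun s => (z s + h s) ^+ 2)) (fun h x => 2 * itg 0 x (fun s => z s * h s)).
Proof.
have [M M0 MP] := bounded_itv 0 1 cz.
have cI f a b : continuous f -> integrable_on a b f by apply: continuous_integrable_on.
have cz2 : continuous (fun s => z s ^+ 2) by exact: cts_exp.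
apply: (@udiff_quadratic _ _ _ _ N0 _ _ _ _ _ (2 * M) 1) => //.
- exists C; first exact: ltW.
  move=> x x01; rewrite ger0_norm; last by apply: itg_ge0 => s _; exact: sqr_ge0.
  by apply: itg_ge0_mono => //; [exact: cI|move=> s _; exact: sqr_ge0].
- by rewrite mulr_ge0// ltW.
- move=> h Dh x x01; have ch := Dc Dh; rewrite normrM normr_nat -mulrA ler_wpM2l//.
  have cn : continuous (fun s => `|h s|) by apply: cts_comp => //; exact: norm_continuous.
  apply: (@le_trans _ _ (itg 0 x (fun s => M * `|h s|))).
    apply: itg_norm_le; [exact/cI/cts_mul|exact/cI/cts_scale|].
    move=> s /andP[s0 sx]; rewrite normrM ler_wpM2r//; apply: MP.
    by rewrite s0 (le_trans sx)//; case/andP: x01.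
  apply: (@le_trans _ _ (itg 0 1 (fun s => M * `|h s|))).
    by apply: itg_ge0_mono => //; [exact/cI/cts_scale|move=> s _; rewrite mulr_ge0// ltW].
  by rewrite itgZ; [rewrite ler_wpM2l ?(ltW M0)// itg_abs_le_H1|exact: cI].
- move=> h Dh x x01; have ch := Dc Dh; rewrite mul1r -itgZ; last exact/cI/cts_mul.
  have ch2 : continuous (fun s => h s ^+ 2) by exact: cts_exp.
  rewrite -itgB; [|exact/cI/cts_exp/cts_add|exact: cI].
  rewrite -itgB; [|by apply/cI/cts_sub => //; exact/cts_exp/cts_add|exact/cI/cts_scale/cts_mul].
  rewrite (eq_itg (g := fun s => h s ^+ 2)); last by move=> s _; ring.
  rewrite ger0_norm; last by apply: itg_ge0 => s _; exact: sqr_ge0.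
  apply: le_trans (sqnorm_le_H1 h); rewrite sqnormE.
  by apply: itg_ge0_mono => //; [exact: cI|move=> s _; exact: sqr_ge0].
Qed.

Lemma udiff_sqnorm (X : Type) (A : set X) : udiff D N A (fun=> C)
  (fun h _ => sqnorm (fun s => z s + h s)) (fun h _ => 2 * itg 0 1 (fun s => z s * h s)).
Proof.
by apply: (@udiff_pull _ _ _ _ (fun=> 1) _ _ _ _ udiff_prim_sqr) => y _; rewrite /= ler01 lexx.
Qed.

(** The differential of z -> t_z in the direction h. Its second term comes from the normalisation by
    C and makes it vanish at both ends of the period. *)
Definition time_variation h x : R :=
  2 / C * (prim (fun s => z s * h s) x - itg 0 1 (fun s => z s * h s) * time_change z x).

Lemma udiff_time_change : udiff D N I01 (time_change z)
  (fun h => time_change (fun s => z s + h s)) time_variation.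
Proof.
have uV := @udiffV _ _ _ _ N0 _ _ _ _ _ C z0 (fun _ _ => lexx _) (udiff_sqnorm I01).
have uM := udiffM N0 uV udiff_prim_sqr.
have n0 : C != 0 by rewrite gt_eqF.
have E x : 0 <= x <= 1 -> C^-1 * itg 0 x (fun s => z s ^+ 2) = time_change z x.
  by move=> /andP[x0 _]; rewrite time_changeE prim_ge0.
apply: udiff_ext uM E _ _ => h Dh x x01; case/andP: (x01) => x0 x1.
  by rewrite time_changeE prim_ge0.
by rewrite /time_variation time_changeE !prim_ge0//; field.
Qed.

Lemma time_variation_derive h x : continuous h -> is_derive x 1 (time_variation h)
  (2 / C * (z x * h x - itg 0 1 (fun s => z s * h s) * (z x ^+ 2 / C))).
Proof.
move=> ch; apply/derZ/derB; first by apply: (@is_derive_prim _ (fun s => z s * h s)); exact: cts_mul.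
by apply: derZ; exact: is_derive_time_change.
Qed.

Let n0 : C != 0. Proof. by rewrite gt_eqF. Qed.
Let ctz : continuous (time_change z). Proof. exact: time_change_continuous. Qed.
Let hzh h : D h -> H1 (fun x => z x + h x). Proof. by case=> hh _; exact: H1D. Qed.
Let azh h : D h -> AC01 (fun x => z x + h x) (fun x => g x + wderiv h x).
Proof. by case=> hh _; exact: (ACD az (H1_AC hh).2). Qed.

Lemma udiff_kinetic : udiff D N [set: unit] (fun=> sqnorm g)
  (fun h _ => sqnorm (wderiv (fun x => z x + h x)))
  (fun h _ => 2 * itg 0 1 (fun x => g x * wderiv h x)).
Proof.
apply: (@udiff_quadratic _ _ _ _ N0 _ _ _ _ _ (2 * (sqnorm g + 1)) 1) => //.
- by exists `|sqnorm g|.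
- by rewrite mulr_ge0// addr_ge0// sqnorm_ge0.
- by move=> h [hh _] _ _; rewrite normrM normr_nat -mulrA ler_wpM2l// itg_cauchy_H1.
move=> h Dh _ _; have [hh _] := Dh; have [h2 _] := H1_AC hh.
rewrite (sqnorm_wderiv (hzh Dh) (azh Dh)) mul1r.
have -> : sqnorm (fun x => g x + wderiv h x) = sqnorm g + 2 * itg 0 1 (fun x => g x * wderiv h x) + sqnorm (wderiv h).
  rewrite !sqnormE -itgZ; last exact: in_L2_prod.
  rewrite -itgD; [|exact: g2.2|exact/integrable_onZ/in_L2_prod].
  rewrite -itgD; [|apply: integrable_onD; [exact: g2.2|exact/integrable_onZ/in_L2_prod]|exact: h2.2].
  by apply: eq_itg => x _; ring.
set p := sqnorm g; set q := itg _ _ _; set r := sqnorm _.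
rewrite (_ : _ - _ = r); last by ring.
by rewrite ger0_norm ?sqnorm_ge0// sqnorm_wderiv_le_H1.
Qed.

Lemma udiff_Qfun : udiff D N [set: unit] (fun=> Qfun z) (fun h _ => Qfun (fun x => z x + h x))
  (fun h _ => 4 * C * itg 0 1 (fun x => g x * wderiv h x) +
     (4 * sqnorm g - 4 / C ^+ 2) * itg 0 1 (fun x => z x * h x)).
Proof.
have u1 := udiffM N0 (udiff_sqnorm [set: unit]) udiff_kinetic.
have u2 := @udiffV _ _ _ _ N0 _ _ _ _ _ C z0 (fun _ _ => lexx _) (udiff_sqnorm [set: unit]).
apply: udiff_ext (udiffD (udiffZ N0 2 u1) (udiffZ N0 2 u2)) _ _ _ => [x _|h Dh x _|h Dh x _].
- by rewrite /Qfun mulrA.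
- by rewrite /Qfun mulrA.
- set p := sqnorm g; set q := itg 0 1 (fun s => z s * h s); set r := itg _ _ _; set m := C.
  have m0 : m != 0 := n0.
  by field.
Qed.

(** The power of the force with respect to tau: f(t_z) times the derivative of z^2. *)
Definition work_density f x : R := f (time_change z x) * (2 * (z x * g x)).

Definition work f x : R := itg 0 (clamp01 x) (work_density f).

(** The additive constant is chosen so that int z^2 e = 2 C^2 int z'^2 - 2, which is the energy
    relation averaged over a period. *)
Definition energy f x : R :=
  2 * C * sqnorm g - 2 / C + (work f x - C^-1 * itg 0 1 (fun s => work f s * z s ^+ 2)).

(** The zeroth-order part of dQ, with coefficient 4 int z'^2 - 4 / C^2, is absorbed here: it is 2 /
    C times the constant 2 C int z'^2 - 2 / C in [energy]. *)
Definition first_variation f h : R :=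
  4 * C * itg 0 1 (fun x => g x * wderiv h x) +
  itg 0 1 (fun x => 2 / C * (energy f x + f (time_change z x) * z x ^+ 2) * (z x * h x)).

Lemma work_density_integrable f : continuous f -> integrable_on 0 1 (work_density f).
Proof.
move=> cf; apply: integrable_onM; first exact: cts_comp.
by apply: integrable_onZ; exact: integrable_onM.
Qed.

Lemma work_AC f : continuous f -> AC01 (work f) (work_density f).
Proof.
move=> cf; have := AC_prim 0 (work_density_integrable cf).
apply: eq_AC => // [|x _]; last by rewrite add0r.
exact: continuous_prim01 (work_density_integrable cf).
Qed.

Lemma energy_AC f : continuous f -> AC01 (energy f) (work_density f).
Proof.
move=> cf; have aw := work_AC cf; have [cw _ _] := aw.
have := ACD (AC_cst (2 * C * sqnorm g - 2 / C - C^-1 * itg 0 1 (fun s => work f s * z s ^+ 2))) aw.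
apply: eq_AC.
- apply: cts_add; first exact: cst_continuous.
  by apply: cts_sub => //; exact: cst_continuous.
- by move=> x _; rewrite /energy; ring.
- by move=> x _; rewrite add0r.
Qed.

Lemma udiff_potential f : continuous f -> udiff D N [set: unit]
  (fun=> itg 0 1 (fun t => f t * levi_civita z t))
  (fun h _ => itg 0 1 (fun t => f t * levi_civita (fun x => z x + h x) t))
  (fun h _ => 2 * prim f 1 * (z 1 * h 1) - 2 * itg 0 1 (fun x =>
     f (time_change z x) * time_variation h x * (z x * g x) +
     prim f (time_change z x) * (z x * wderiv h x + h x * g x))).
Proof.
move=> cf; have dF x := is_derive_prim x cf; have cF : continuous (prim f) := continuous_derive dF.
have uF := udiff_comp N0 dF cf udiff_time_change.
have [M M0 MP] := bounded_itv 0 1 cz.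
have Izg : integrable_on 0 1 (fun x => z x * g x) by exact: integrable_onM.
have IV h : D h -> integrable_on 0 1 (fun x => z x * wderiv h x + h x * g x).
  move=> Dh; have [h2 _] := H1_AC (DH Dh); apply: integrable_onD; apply: integrable_onM => //.
    exact: in_L2_integrable.
  exact: Dc.
have IU h : D h -> integrable_on 0 1 (fun x => (z x + h x) * (g x + wderiv h x)).
  move=> Dh; have [h2 _] := H1_AC (DH Dh); apply: integrable_onM.
    by apply: cts_add => //; exact: Dc.
  by apply: integrable_onD => //; exact: in_L2_integrable.
(* The two constants at the end bound the L^1 norms of the linear part z h' + h z' and of the
   quadratic remainder h h', by [sup_le_H1]. *)
have uI := @udiff_itg _ _ _ _ N0 _ _ _ (fun x => z x * g x)
  (fun h x => (z x + h x) * (g x + wderiv h x)) (fun h x => z x * wderiv h x + h x * g x)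
  (M + 2 * itg 0 1 (fun x => `|g x|)) 2 uF.
have Ug0 : 0 <= itg 0 1 (fun x => `|g x|) by apply: itg_ge0.
have {}uI := uI (cts_comp cF ctz) _ _ Izg IU IV _ _ _ _.
have {uI} : udiff D N [set: unit] (fun=> itg 0 1 (fun x => prim f (time_change z x) * (z x * g x)))
    (fun h _ => itg 0 1 (fun x => prim f (time_change (fun s => z s + h s) x) * ((z x + h x) * (g x + wderiv h x))))
    (fun h _ => itg 0 1 (fun x => f (time_change z x) * time_variation h x * (z x * g x) +
      prim f (time_change z x) * (z x * wderiv h x + h x * g x))).
  apply: uI.
  - move=> h Dh; have [_ s0] := Dh.
    by apply: (cts_comp cF); apply: time_change_continuous; apply: cts_add => //; exact: Dc.
  - move=> h Dh; apply: cts_mul; first exact: cts_comp.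
    exact: continuous_derive (fun x => time_variation_derive x (Dc Dh)).
  - by rewrite addr_ge0 ?mulr_ge0// ltW.
  - by [].
  - move=> h Dh; have [h2 _] := H1_AC (DH Dh); have hN := itg_abs_wderiv_le_H1 (DH Dh).
    have Ih := integrable_on_norm (in_L2_integrable h2); have Ig' := integrable_on_norm Ig.
    apply: (@le_trans _ _ (itg 0 1 (fun x => M * `|wderiv h x| + (2 * N h) * `|g x|))).
      apply: itg_le; [exact/integrable_on_norm/IV|by apply: integrable_onD; exact: integrable_onZ|].
      move=> x x01; rewrite (le_trans (ler_normD _ _))// !normrM lerD// ler_wpM2r//.
        exact: MP.
      exact: sup_le_H1 (DH Dh) x01.
    rewrite itgD; [|exact: integrable_onZ|exact: integrable_onZ].
    rewrite !itgZ//; set U := itg 0 1 (fun x => `|g x|).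
    rewrite (_ : (M + 2 * U) * N h = M * N h + 2 * N h * U); last by ring.
    by rewrite lerD2r ler_wpM2l// ltW.
  - move=> h Dh; have [h2 _] := H1_AC (DH Dh); have hN := itg_abs_wderiv_le_H1 (DH Dh).
    have Ih := integrable_on_norm (in_L2_integrable h2).
    apply: (@le_trans _ _ (itg 0 1 (fun x => (2 * N h) * `|wderiv h x|))).
      apply: itg_le.
      + by apply/integrable_on_norm/integrable_onB; [apply: integrable_onB => //; exact: IU|exact: IV].
      + exact: integrable_onZ.
      + move=> x x01; rewrite (_ : _ - _ = h x * wderiv h x); last by ring.
        by rewrite normrM ler_wpM2r// sup_le_H1//; exact: DH.
    rewrite itgZ// expr2 mulrA ler_wpM2l// mulr_ge0//; exact: N0.
move=> uI.
have uB : udiff D N [set: unit] (fun=> z 1 ^+ 2) (fun h _ => (z 1 + h 1) ^+ 2) (fun h _ => 2 * z 1 * h 1).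
  have one01 : 0 <= (1 : R) <= 1 by rewrite ler01 lexx.
  apply: (@udiff_quadratic _ _ _ _ N0 _ _ _ _ _ (2 * `|z 1| * 2) 4) => //.
  - by exists `|z 1 ^+ 2|.
  - move=> h Dh _ _; rewrite !normrM normr_nat -[X in _ <= X]mulrA.
    by apply: ler_wpM2l; [rewrite mulr_ge0|apply: sup_le_H1 => //; exact: DH].
  - move=> h Dh _ _; rewrite (_ : _ - _ = h 1 ^+ 2); last by ring.
    rewrite normrX (_ : 4 * _ = (2 * N h) ^+ 2); last by ring.
    by rewrite lerXn2r ?nnegrE ?mulr_ge0 ?N0// sup_le_H1//; exact: DH.
apply: udiff_ext (udiffD (udiffZ N0 (prim f 1) uB) (udiffZ N0 (- 2) uI)) _ _ _.
- by move=> _ _; rewrite (potential_formula cf cz pz z0 az) mulNr.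
- move=> h Dh _ _; have hw := hzh Dh; have [_ s0] := Dh.
  by rewrite (potential_formula cf (H1_continuous hw) (H1_periodic hw) s0 (azh Dh)) mulNr.
- by move=> h Dh _ _; rewrite mulNr mulrA mulrA [prim f 1 * 2]mulrC -!mulrA.
Qed.

(* Two integrations by parts turn the raw variation into a weak second-order equation. *)
Lemma potential_variation f h : continuous f -> H1 h ->
  2 * prim f 1 * (z 1 * h 1) - 2 * itg 0 1 (fun x =>
     f (time_change z x) * time_variation h x * (z x * g x) +
     prim f (time_change z x) * (z x * wderiv h x + h x * g x)) =
  itg 0 1 (fun x => 2 / C * (work f x - C^-1 * itg 0 1 (fun s => work f s * z s ^+ 2) +
     f (time_change z x) * z x ^+ 2) * (z x * h x)).
Proof.
move=> cf hh; have [h2 ah] := H1_AC hh; have ch := H1_continuous hh.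
have Ih := in_L2_integrable h2.
have dF x := is_derive_prim x cf; have cF : continuous (prim f) := continuous_derive dF.
have cdt : continuous (fun x => z x ^+ 2 / C).
  by apply: cts_mul; [exact: cts_exp|exact: cst_continuous].
have aFt := AC_comp dF cf (C1_AC (is_derive_time_change cz) cdt).
have azh' := AC_mul az ah.
have cft : continuous (fun x => f (time_change z x)) by exact: cts_comp.
have cFt : continuous (fun x => prim f (time_change z x)) by exact: cts_comp.
have cI (k : R -> R) : continuous k -> integrable_on 0 1 k by apply: continuous_integrable_on.
have cv : continuous (time_variation h) := continuous_derive (fun x => time_variation_derive x ch).
have [cw _ _] := work_AC cf.
have cz2 : continuous (fun x => z x ^+ 2) by exact: cts_exp.
have czh : continuous (fun x => z x * h x) by exact: cts_mul.
have I1 : integrable_on 0 1 (fun x => f (time_change z x) * time_variation h x * (z x * g x)).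
  by apply: integrable_onM; [exact: cts_mul|exact: integrable_onM].
have I2 : integrable_on 0 1 (fun x => prim f (time_change z x) * (z x * wderiv h x + h x * g x)).
  by apply: integrable_onM => //; apply: integrable_onD; exact: integrable_onM.
rewrite itgD//.
(* The derivative goes from z h back to the primitive of f; the boundary term produced here cancels
   the one in the raw variation. *)
have E2 : itg 0 1 (fun x => prim f (time_change z x) * (z x * wderiv h x + h x * g x)) =
    prim f 1 * (z 1 * h 1) - itg 0 1 (fun x => f (time_change z x) * (z x ^+ 2 / C) * (z x * h x)).
  have := itg_parts aFt azh'; rewrite time_change0 time_change1// prim0 mul0r subr0 => <-.
  by apply: eq_itg => x _; ring.
have dtv x := time_variation_derive x ch.
have cdtv : continuous (fun x => 2 / C * (z x * h x - itg 0 1 (fun s => z s * h s) * (z x ^+ 2 / C))).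
  by apply: cts_scale; apply: cts_sub => //; exact: cts_scale.
have tv0 : time_variation h 0 = 0 by rewrite /time_variation prim0 time_change0 mulr0 subrr mulr0.
have tv1 : time_variation h 1 = 0.
  by rewrite /time_variation prim_ge0// time_change1// mulr1 subrr mulr0.
(* The derivative goes from the work to the time variation, which vanishes at both ends. *)
have E1 : 2 * itg 0 1 (fun x => f (time_change z x) * time_variation h x * (z x * g x)) =
    - itg 0 1 (fun x => 2 / C * (z x * h x - itg 0 1 (fun s => z s * h s) * (z x ^+ 2 / C)) * work f x).
  have := itg_parts (C1_AC dtv cdtv) (work_AC cf); rewrite tv0 tv1 !mul0r subrr sub0r => <-.
  by rewrite -itgZ//; apply: eq_itg => x _; rewrite /work_density; ring.
rewrite E2; set A := itg 0 1 (fun x => f (time_change z x) * time_variation h x * _) in E1 *.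
set K := itg 0 1 (fun x => f (time_change z x) * (z x ^+ 2 / C) * (z x * h x)).
transitivity (2 * K - 2 * A); first by ring.
rewrite E1 opprK {A E1 E2}/K.
set k := itg 0 1 (fun s => z s * h s); set m := itg 0 1 (fun s => work f s * z s ^+ 2).
have cwz : continuous (fun x => work f x * z x ^+ 2) by exact: cts_mul.
have cwzh : continuous (fun x => work f x * (z x * h x)) by exact: cts_mul.
have cfzh : continuous (fun x => f (time_change z x) * (z x ^+ 2 / C) * (z x * h x)).
  by do ?apply: cts_mul => //; exact: cst_continuous.
have -> : itg 0 1 (fun x => 2 / C * (z x * h x - k * (z x ^+ 2 / C)) * work f x) =
    2 / C * itg 0 1 (fun x => work f x * (z x * h x)) - 2 * k / C ^+ 2 * m.
  rewrite /m -(itgZ (2 / C) (cI _ cwzh)) -(itgZ (2 * k / C ^+ 2) (cI _ cwz)).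
  rewrite -itgB; [|exact/cI/cts_scale|exact/cI/cts_scale].
  by apply: eq_itg => x _; field.
have -> : itg 0 1 (fun x => 2 / C * (work f x - C^-1 * m + f (time_change z x) * z x ^+ 2) * (z x * h x)) =
    2 / C * itg 0 1 (fun x => work f x * (z x * h x)) - 2 / C ^+ 2 * m * k +
    2 * itg 0 1 (fun x => f (time_change z x) * (z x ^+ 2 / C) * (z x * h x)).
  rewrite /k -(itgZ (2 / C) (cI _ cwzh)) -(itgZ (2 / C ^+ 2 * m) (cI _ czh)) -(itgZ 2 (cI _ cfzh)).
  rewrite -itgB; [|exact/cI/cts_scale|exact/cI/cts_scale].
  rewrite -itgD; [|by apply/cI/cts_sub; exact: cts_scale|by apply/cI/cts_scale].
  by apply: eq_itg => x _; field.
by field.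
Qed.

Lemma first_variationP f : continuous f -> udiff D N [set: unit]
  (fun=> Qfun z + itg 0 1 (fun t => f t * levi_civita z t))
  (fun h _ => Qfun (fun x => z x + h x) + itg 0 1 (fun t => f t * levi_civita (fun x => z x + h x) t))
  (fun h _ => first_variation f h).
Proof.
move=> cf; apply: udiff_ext (udiffD udiff_Qfun (udiff_potential cf)) _ _ _ => // h Dh _ _.
rewrite (potential_variation cf (DH Dh)) /first_variation -addrA; congr (_ + _).
have ch := Dc Dh; have [cw _ _] := work_AC cf.
have cI (k : R -> R) : continuous k -> integrable_on 0 1 k by apply: continuous_integrable_on.
rewrite -itgZ; last exact/cI/cts_mul.
rewrite -itgD; [|exact/cI/cts_scale/cts_mul|]; last first.
  apply/cI/cts_mul; last exact: cts_mul.
  apply/cts_scale/cts_add; first by apply: cts_sub => //; exact: cst_continuous.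
  by apply: cts_mul; [exact: cts_comp|exact: cts_exp].
by apply: eq_itg => x _; rewrite /energy; field.
Qed.

End OneBody.

Opaque H1_norm1.

(** * Stability of the Levi-Civita transform under perturbation *)

Section LeviCivitaPerturbation.
Variable R : realType.
Variable z : R -> R.
Hypotheses (hz : H1 z) (z0 : 0 < sqnorm z).
Implicit Types (f g h u v w : R -> R) (a b c d e x y s t : R).
Local Notation C := (sqnorm z).
Local Notation g := (wderiv z).
Local Notation D := (admissible z).
Local Notation N := (@H1_norm1 R).
Let cz : continuous z. Proof. exact: H1_continuous. Qed.
Let pz : periodic1 z. Proof. exact: H1_periodic. Qed.
Let g2 : in_L2 g. Proof. by have [] := H1_AC hz. Qed.
Let Ig : integrable_on 0 1 g. Proof. exact: in_L2_integrable. Qed.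
Let az : AC01 z g. Proof. by have [] := H1_AC hz. Qed.

Lemma frac_itv01 t : 0 <= t - (Num.floor t)%:~R <= 1.
Proof. by rewrite subr_ge0 floor_le_tmp/= lerBlDl -intrD1 ltW// floorD1_gt. Qed.

Lemma periodic1_frac f t : periodic1 f -> f t = f (t - (Num.floor t)%:~R).
Proof. by move=> pf; rewrite -[in LHS](subrK (Num.floor t)%:~R t) periodic1_int. Qed.

Lemma sqnorm_perturb_gt0 : exists2 d : R, 0 < d &
  forall h, H1 h -> N h < d -> 0 < sqnorm (fun x => z x + h x).
Proof.
have [M M0 MP] := bounded_itv 0 1 cz.
exists (C / (2 * M + 1)); first by rewrite divr_gt0//; lra.
move=> h hh; rewrite ltr_pdivlMr; last lra.
have ch := H1_continuous hh; have n0 := H1_norm1_ge0 h.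
have cI (k : R -> R) : continuous k -> integrable_on 0 1 k by apply: continuous_integrable_on.
have -> : sqnorm (fun x => z x + h x) = C + 2 * itg 0 1 (fun x => z x * h x) + sqnorm h.
  have czh : continuous (fun x => z x * h x) by exact: cts_mul.
  have cz2 : continuous (fun x => z x ^+ 2) by exact: cts_exp.
  rewrite !sqnormE -(itgZ 2 (cI _ czh)).
  rewrite -itgD; [|exact: cI|exact/cI/cts_scale].
  rewrite -itgD; [|apply/cI/cts_add => //; exact: cts_scale|exact/cI/cts_exp].
  by apply: eq_itg => x _; ring.
have : `|itg 0 1 (fun x => z x * h x)| <= M * N h.
  have cn : continuous (fun s => `|h s|) by apply: cts_comp => //; exact: norm_continuous.
  apply: (@le_trans _ _ (itg 0 1 (fun s => M * `|h s|))).
    apply: itg_norm_le; [exact/cI/cts_mul|exact/cI/cts_scale|].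
    by move=> s s01; rewrite normrM ler_wpM2r//; exact: MP.
  by rewrite itgZ; [rewrite ler_wpM2l ?(ltW M0)// itg_abs_le_H1|exact: cI].
have s0 := sqnorm_ge0 h.
move: s0; set s := sqnorm h; set m := itg _ _ _; set n := N h in n0 *.
set c := C; rewrite ler_norml => s0 /andP[m1 m2] nd; lra.
Qed.

(** Up to a period, t is the value of the perturbed time change at some x in [0, 1]. There the
    perturbed q equals (z + h)^2 at x, close to z(x)^2 = q(t_z(x)), and t_z(x) is close to t. No
    inverse time change has to be perturbed. *)
Lemma levi_civita_perturb e : 0 < e -> exists2 d : R, 0 < d & forall h, D h -> N h < d ->
  forall t, `|levi_civita (fun x => z x + h x) t - levi_civita z t| <= e.
Proof.
move=> e0; have e2 : 0 < e / 2 by lra.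
have cq := levi_civita_continuous cz pz z0.
have [M M0 MP] := bounded_itv 0 1 cz.
have [d1 d10 d1P] := uniform_continuous_itv 0 1 cq e2.
have d12 : 0 < d1 / 2 by lra.
have N0 h : D h -> 0 <= N h by move=> _; exact: H1_norm1_ge0.
have [d2 d20 d2P] := udiff_small N0 (udiff_time_change hz z0) d12.
have W0 : 0 < 4 * M + 4 by lra.
exists (Num.min d2 (Num.min 1 (e / 2 / (4 * M + 4)))); first by rewrite !lt_min d20 ltr01 divr_gt0.
move=> h Dh; rewrite !lt_min => /andP[h2 /andP[h1 h3]] t; have [hh s0] := Dh.
have n0 := H1_norm1_ge0 h.
have cw : continuous (fun x => z x + h x) by apply: cts_add => //; exact: H1_continuous.
have pw : periodic1 (fun x => z x + h x) by move=> x; rewrite pz (H1_periodic hh).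
rewrite (periodic1_frac t (levi_civita_periodic cw pw s0)) (periodic1_frac t (levi_civita_periodic cz pz z0)).
have := frac_itv01 t; set s := t - _ => s01.
have [x x01 xs] := time_change_surj01 cw s0 s01.
rewrite -{1}xs levi_civita_time_change//.
have A1 : `|(z x + h x) ^+ 2 - z x ^+ 2| <= e / 2.
  have -> : (z x + h x) ^+ 2 - z x ^+ 2 = h x * (2 * z x + h x) by ring.
  rewrite normrM; have hx := sup_le_H1 hh x01; have zx := MP x x01.
  apply: (@le_trans _ _ (2 * N h * (2 * M + 2))).
    apply: ler_pM => //; rewrite (le_trans (ler_normD _ _))// normrM normr_nat lerD//.
      by rewrite ler_wpM2l.
    by apply: (le_trans hx); rewrite -[X in _ <= X]mulr1 ler_wpM2l// ltW.
  move: h3; rewrite ltr_pdivlMr// => h3.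
  by apply/ltW; rewrite (_ : _ * _ = N h * (4 * M + 4))//; ring.
have A2 : `|levi_civita z (time_change z x) - levi_civita z s| <= e / 2.
  rewrite distrC; apply/ltW/d1P; first exact: time_change_itv01.
  by rewrite -xs; apply: le_lt_trans (d2P h Dh h2 x x01) _; lra.
rewrite levi_civita_time_change// in A2.
rewrite (_ : _ - _ = ((z x + h x) ^+ 2 - z x ^+ 2) + (z x ^+ 2 - levi_civita z s)); last by ring.
by rewrite (le_trans (ler_normD _ _))//; lra.
Qed.

(* Lipschitz bound in h whose constant depends on f only through sup |f|: this is what
   controls the quadratic remainder in the interaction terms. *)
Lemma potential_lipschitz : exists2 K : R, 0 <= K & exists2 d : R, 0 < d &
  forall h, D h -> N h < d -> forall f M, continuous f ->
    (forall t, 0 <= t <= 1 -> `|f t| <= M) ->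
    `|itg 0 1 (fun t => f t * levi_civita (fun x => z x + h x) t) -
      itg 0 1 (fun t => f t * levi_civita z t)| <= K * M * N h.
Proof.
have N0 h : D h -> 0 <= N h by move=> _; exact: H1_norm1_ge0.
have [E E0 [d1 d10 d1P]] := udiff_lip (udiff_time_change hz z0).
have [Mz Mz0 MzP] := bounded_itv 0 1 cz.
have Izg : integrable_on 0 1 (fun x => z x * g x) by exact: integrable_onM.
pose U := itg 0 1 (fun x => `|z x * g x|); pose G := itg 0 1 (fun x => `|g x|).
have U0 : 0 <= U by apply: itg_ge0.
have G0 : 0 <= G by apply: itg_ge0.
have EU0 : 0 <= E * U by rewrite mulr_ge0.
exists (4 * Mz + 4 + 2 * (E * U + Mz + 2 * G + 2)); first lra.
exists (Num.min d1 1); first by rewrite lt_min d10 ltr01.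
move=> h Dh; rewrite lt_min => /andP[hd h1] f M cf fM; have [hh s0] := Dh.
have n0 := N0 h Dh; have [h2 ah] := H1_AC hh; have Ih := in_L2_integrable h2.
have M0 : 0 <= M by apply: le_trans (normr_ge0 (f 0)) (fM 0 _); rewrite lexx ler01.
have hw := H1D hz hh.
have [cw pw] := (H1_continuous hw, H1_periodic hw).
have aw := ACD az ah.
rewrite (potential_formula cf cw pw s0 aw) (potential_formula cf cz pz z0 az).
set w := fun x => z x + h x in s0 hw cw pw aw *.
pose F := prim f; have dF x : is_derive x 1 F (f x) := is_derive_prim x cf.
have cF : continuous F := continuous_derive dF.
(* On [0, 1] the primitive F is M-Lipschitz and bounded by M, so M is the only trace of f in the
   estimates below. *)
have FL x y : 0 <= x <= 1 -> 0 <= y <= 1 -> `|F y - F x| <= M * `|y - x|.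
  have W a b : 0 <= a -> a <= b -> b <= 1 -> `|F b - F a| <= M * (b - a).
    move=> a0 ab b1; rewrite /F primB// -itg_cst//; apply: itg_norm_le.
    - exact: continuous_integrable_on.
    - by apply: continuous_integrable_on; exact: cst_continuous.
    - by move=> s /andP[as_ sb]; apply: fM; rewrite (le_trans a0)//= (le_trans sb).
  move=> /andP[x0 x1] /andP[y0 y1]; have [xy|/ltW yx] := leP x y.
    by rewrite [`|y - x|]ger0_norm ?subr_ge0// W.
  by rewrite distrC [`|y - x|]distrC [`|x - y|]ger0_norm ?subr_ge0// W.
have F1 x : 0 <= x <= 1 -> `|F x| <= M.
  move=> x01; have := FL 0 x; rewrite lexx ler01 => /(_ isT x01).
  rewrite /F prim0 !subr0 => /le_trans; apply; case/andP: x01 => x0 x1.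
  by rewrite ger0_norm// -[X in _ <= X]mulr1 ler_wpM2l.
have ctw := time_change_continuous cw; have ctz := time_change_continuous cz.
have IV : integrable_on 0 1 (fun x => z x * wderiv h x + h x * g x + h x * wderiv h x).
  by do ?apply: integrable_onD; apply: integrable_onM => //; exact: H1_continuous.
have I1 : integrable_on 0 1 (fun x => F (time_change w x) * (w x * (g x + wderiv h x))).
  apply: integrable_onM; first exact: cts_comp.
  by apply: integrable_onM => //; exact: integrable_onD.
have I2 : integrable_on 0 1 (fun x => F (time_change z x) * (z x * g x)).
  by apply: integrable_onM => //; exact: cts_comp.
have B1 : `|prim f 1 * w 1 ^+ 2 - prim f 1 * z 1 ^+ 2| <= M * ((4 * Mz + 4) * N h).
  have one01 : 0 <= (1 : R) <= 1 by rewrite ler01 lexx.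
  rewrite -mulrBr normrM; apply: ler_pM => //; first exact: F1.
  have -> : w 1 ^+ 2 - z 1 ^+ 2 = h 1 * (2 * z 1 + h 1) by rewrite /w; ring.
  have hx := sup_le_H1 hh one01; have zx := MzP 1 one01.
  rewrite normrM (_ : (4 * Mz + 4) * N h = 2 * N h * (2 * Mz + 2)); last by ring.
  apply: ler_pM => //; rewrite (le_trans (ler_normD _ _))// normrM normr_nat lerD//.
    by rewrite ler_wpM2l.
  by apply: (le_trans hx); rewrite -[X in _ <= X]mulr1 ler_wpM2l// ltW.
have B2 : `|itg 0 1 (fun x => F (time_change w x) * (w x * (g x + wderiv h x))) -
    itg 0 1 (fun x => F (time_change z x) * (z x * g x))| <= M * ((E * U + Mz + 2 * G + 2) * N h).
  rewrite -itgB//.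
  have IVn := integrable_on_norm IV; have Izgn := integrable_on_norm Izg.
  have Ihn := integrable_on_norm Ih; have Ign := integrable_on_norm Ig.
  apply: (@le_trans _ _ (itg 0 1 (fun x => (M * (E * N h)) * `|z x * g x| +
     M * `|z x * wderiv h x + h x * g x + h x * wderiv h x|))).
    apply: itg_norm_le; [exact: integrable_onB|by apply: integrable_onD; exact: integrable_onZ|].
    move=> x x01; rewrite [X in `|X|](_ : _ = (F (time_change w x) - F (time_change z x)) * (z x * g x) +
      F (time_change w x) * (z x * wderiv h x + h x * g x + h x * wderiv h x)); last first.
      by move: (F (time_change w x)) (F (time_change z x)) => p q; rewrite /w; ring.
    have tw01 := time_change_itv01 cw s0 x01; have tz01 := time_change_itv01 cz z0 x01.
    rewrite (le_trans (ler_normD _ _))// !(normrM (F _ - F _)) normrM lerD//.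
      rewrite ler_wpM2r// (le_trans (FL _ _ tz01 tw01))// ler_wpM2l//.
      exact: (d1P h Dh hd x x01).
    by rewrite [leLHS]normrM ler_wpM2r// F1.
  rewrite itgD; [|exact: integrable_onZ|exact: integrable_onZ].
  rewrite (itgZ _ Izgn) (itgZ _ IVn) -/U.
  have B3 : itg 0 1 (fun x => `|z x * wderiv h x + h x * g x + h x * wderiv h x|) <= (Mz + 2 * G + 2) * N h.
    apply: (@le_trans _ _ (itg 0 1 (fun x => (Mz + 2 * N h) * `|wderiv h x| + (2 * N h) * `|g x|))).
      apply: itg_le => //; first by apply: integrable_onD; exact: integrable_onZ.
      move=> x x01; have hx := sup_le_H1 hh x01; have zx := MzP x x01.
      rewrite (le_trans (ler_normD _ _))// (le_trans (lerD (ler_normD _ _) (lexx _)))// !normrM.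
      have p1 : `|z x| * `|wderiv h x| <= Mz * `|wderiv h x| by rewrite ler_wpM2r.
      have p2 : `|h x| * `|g x| <= 2 * N h * `|g x| by rewrite ler_wpM2r.
      have p3 : `|h x| * `|wderiv h x| <= 2 * N h * `|wderiv h x| by rewrite ler_wpM2r.
      by rewrite mulrDl addrAC lerD// lerD.
    rewrite itgD; [|exact: integrable_onZ|exact: integrable_onZ].
    rewrite (itgZ _ Ihn) (itgZ _ Ign) -/G.
    have K j : 0 <= j -> j <= N h -> (Mz + 2 * N h) * j + 2 * N h * G <= (Mz + 2 * G + 2) * N h.
      move=> j0 jn; rewrite [X in _ <= X](_ : _ = (Mz + 2) * N h + 2 * N h * G); last by ring.
      rewrite lerD2r; apply: ler_pM => //; first by rewrite addr_ge0 ?mulr_ge0// ltW.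
      by rewrite lerD2l -[X in _ <= X]mulr1 ler_wpM2l// ltW.
    by apply: K; [exact: itg_ge0|exact: itg_abs_wderiv_le_H1].
  rewrite [X in _ <= X](_ : _ = M * (E * N h) * U + M * ((Mz + 2 * G + 2) * N h)); last by ring.
  by rewrite lerD2l ler_wpM2l.
have comb (a1 a2 b1 b2 X Y : R) : `|a1 - a2| <= X -> `|b1 - b2| <= Y ->
    `|(a1 - 2 * b1) - (a2 - 2 * b2)| <= X + 2 * Y.
  move=> aX bY; rewrite (_ : _ - _ = (a1 - a2) - 2 * (b1 - b2)); last by ring.
  by rewrite (le_trans (ler_normB _ _))// lerD// normrM normr_nat ler_wpM2l.
apply: (le_trans (comb _ _ _ _ _ _ B1 B2)).
by rewrite le_eqVlt; apply/orP; left; apply/eqP; ring.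
Qed.

End LeviCivitaPerturbation.

(** * Decoupling of the interaction *)

Section Pair.
Variable R : realType.
Local Notation pair2 := ((R -> R) * (R -> R))%type.
Implicit Types (z h : pair2) (f g : R -> R) (a b c d e x y s t r : R).

Lemma itg_levi_civita (w : R -> R) : continuous w -> periodic1 w -> 0 < sqnorm w ->
  itg 0 1 (levi_civita w) = (sqnorm w)^-1 * sqnorm (fun x => w x ^+ 2).
Proof.
move=> cw pw w0; rewrite (itg_time_change cw w0); last exact: levi_civita_continuous.
congr (_ * _); rewrite sqnormE; apply: eq_itg => x _.
by rewrite levi_civita_time_change// expr2.
Qed.

(** Since t_z1 is onto, positivity of [gap] at every tau is the ordering of q2 and q1 at every
    time. *)
Lemma H1_inP z : H1_in z <-> [/\ H1_pair z, 0 < sqnorm z.1, 0 < sqnorm z.2 &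
  forall t, levi_civita z.2 t < levi_civita z.1 t].
Proof.
have E : H1 z.1 -> 0 < sqnorm z.1 -> forall t, gap z t =
    levi_civita z.1 (time_change z.1 t) - levi_civita z.2 (time_change z.1 t).
  move=> h1 s1 t; rewrite (levi_civita_time_change (H1_continuous h1) (H1_periodic h1) s1).
  by rewrite (levi_civitaE z.2).
split=> [[[h1 h2] s1 s2 gp]|[[h1 h2] s1 s2 lt]]; split => // t.
  have [x <-] := time_change_surj (H1_continuous h1) (H1_periodic h1) s1 t.
  by rewrite -subr_gt0 -E.
by rewrite E// subr_gt0.
Qed.

Section Fixed.
Variables (r : R) (z : pair2).
Hypothesis zin : H1_in z.
Let h1 : H1 z.1. Proof. by case: zin => -[]. Qed.
Let h2 : H1 z.2. Proof. by case: zin => -[]. Qed.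
Let s1 : 0 < sqnorm z.1. Proof. by case: zin. Qed.
Let s2 : 0 < sqnorm z.2. Proof. by case: zin. Qed.
Local Notation q1 := (levi_civita z.1).
Local Notation q2 := (levi_civita z.2).
Let cq1 : continuous q1.
Proof. by apply: levi_civita_continuous => //; [exact: H1_continuous|exact: H1_periodic]. Qed.
Let cq2 : continuous q2.
Proof. by apply: levi_civita_continuous => //; [exact: H1_continuous|exact: H1_periodic]. Qed.
Let lt21 t : q2 t < q1 t. Proof. by move: t; case: ((H1_inP z).1 zin). Qed.
Let cI (k : R -> R) : continuous k -> integrable_on 0 1 k.
Proof. by apply: continuous_integrable_on. Qed.

Lemma levi_civita_gap : exists2 c : R, 0 < c & forall t, c <= q1 t - q2 t.
Proof.
have cG : continuous (fun t => q1 t - q2 t) by exact: cts_sub.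
have [m _ mP] := EVT_min (@ler01 R) (continuous_within (a := 0) (b := 1) cG).
exists (q1 m - q2 m); first by rewrite subr_gt0.
move=> t; have P1 := levi_civita_periodic (H1_continuous h1) (H1_periodic h1) s1.
have P2 := levi_civita_periodic (H1_continuous h2) (H1_periodic h2) s2.
rewrite (periodic1_frac t P1) (periodic1_frac t P2); apply: mP.
by rewrite in_itv/= frac_itv01.
Qed.

Lemma mean_gap_gt (c : R) : (forall t, c <= q1 t - q2 t) -> c <= itg 0 1 q1 - itg 0 1 q2.
Proof.
move=> cP; rewrite -itgB; [|exact: cI|exact: cI].
rewrite -[X in X <= _](_ : itg 0 1 (fun=> c) = c); last by rewrite itg_cst// subr0 mulr1.
by apply: itg_le => [||t _] //; apply: cI; [exact: cst_continuous|exact: cts_sub].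
Qed.

(** The changes of variables by t_z1 and t_z2 turn both interaction terms into functionals of q1 and
    q2 alone. *)
Lemma B_rE : B_r r z = Qfun z.1 + Qfun z.2 - r * itg 0 1 (fun t => (q1 t - q2 t)^-1)
  - (1 - r) / (itg 0 1 q1 - itg 0 1 q2).
Proof.
have EI : Ifun z = - itg 0 1 (fun t => (q1 t - q2 t)^-1).
  rewrite /Ifun (itg_time_change (H1_continuous h1) s1); last first.
    by apply: cts_inv; [exact: cts_sub|move=> t; rewrite subr_eq0 gt_eqF].
  rewrite int01E; congr (- (_ * _)); apply: eq_itg => x _.
  by rewrite /gap (levi_civita_time_change (H1_continuous h1) (H1_periodic h1) s1) (levi_civitaE z.2).
have EA : Afun z = - (itg 0 1 q1 - itg 0 1 q2)^-1.
  have [c c0 cP] := levi_civita_gap; have b0 := lt_le_trans c0 (mean_gap_gt cP).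
  move: b0; rewrite /Afun.
  rewrite (itg_levi_civita (H1_continuous h1) (H1_periodic h1) s1).
  rewrite (itg_levi_civita (H1_continuous h2) (H1_periodic h2) s2).
  set a1 := sqnorm (fun x => z.1 x ^+ 2); set a2 := sqnorm (fun x => z.2 x ^+ 2).
  move: s1 s2; set n1 := sqnorm z.1; set n2 := sqnorm z.2 => p1 p2 b0.
  have E : a1 * n2 - a2 * n1 = (n1^-1 * a1 - n2^-1 * a2) * (n1 * n2).
    by field; rewrite !gt_eqF.
  rewrite E; move: b0; set b := n1^-1 * a1 - n2^-1 * a2 => b0.
  by field; rewrite !gt_eqF.
by rewrite /B_r /B_in /B_av EI EA; ring.
Qed.

(* The force on q1; q2 feels the opposite force. *)
Definition force t : R := r / (q1 t - q2 t) ^+ 2 + (1 - r) / (itg 0 1 q1 - itg 0 1 q2) ^+ 2.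

Lemma force_continuous : continuous force.
Proof.
apply: cts_add; last exact: cst_continuous.
apply: cts_scale; apply: cts_inv; first by apply: cts_exp; exact: cts_sub.
by move=> t; rewrite sqrf_eq0 subr_eq0 gt_eqF.
Qed.

End Fixed.

Lemma H1_norm_ge0 h : 0 <= H1_norm h.
Proof. exact: sqrtr_ge0. Qed.

Lemma H1_norm_sqr h : H1_norm h ^+ 2 = H1_norm1 h.1 ^+ 2 + H1_norm1 h.2 ^+ 2.
Proof.
rewrite /H1_norm sqr_sqrtr; first exact: (congr2 +%R (esym (H1_norm1_sqr h.1)) (esym (H1_norm1_sqr h.2))).
by apply: addr_ge0; apply: addr_ge0; exact: sqnorm_ge0.
Qed.

Lemma H1_norm_fst h : H1_norm1 h.1 <= H1_norm h.
Proof.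
by apply: le_of_sqr_le; [exact: H1_norm_ge0|rewrite H1_norm_sqr lerDl sqr_ge0].
Qed.

Lemma H1_norm_snd h : H1_norm1 h.2 <= H1_norm h.
Proof.
by apply: le_of_sqr_le; [exact: H1_norm_ge0|rewrite H1_norm_sqr lerDr sqr_ge0].
Qed.

Opaque H1_norm.

Lemma gap_perturb (p1 p2 q1 q2 c m : R) : `|p1 - q1| <= m -> `|p2 - q2| <= m ->
  c <= q1 - q2 -> m <= c / 4 -> c / 2 <= p1 - p2.
Proof. by rewrite !ler_norml => /andP[? ?] /andP[? ?] ? ?; lra. Qed.

Lemma B_r_triangle (a1 a2 a1' a2' p1 p2 p1' p2' v1 v2 b b' c c' r X Y Z : R) :
  `|(a1' + p1') - (a1 + p1) - v1| <= X -> `|(a2' + - p2') - (a2 + - p2) - v2| <= Y ->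
  `|(- r * b' - c') - (- r * b - c) - ((p1' - p1) - (p2' - p2))| <= Z ->
  `|(a1' + a2' - r * b' - c') - (a1 + a2 - r * b - c) - (v1 + v2)| <= X + Y + Z.
Proof.
move=> HX HY HZ; rewrite [X in `|X|](_ : _ = ((a1' + p1') - (a1 + p1) - v1) + ((a2' + - p2') - (a2 + - p2) - v2) +
  ((- r * b' - c') - (- r * b - c) - ((p1' - p1) - (p2' - p2)))); last by ring.
by apply: le_trans (ler_normD _ _) _; apply: lerD => //; apply: le_trans (ler_normD _ _) _; exact: lerD.
Qed.

(** * Critical points through the two one-body variations *)

Section Criticality.
Variables (r : R) (z : pair2).
Hypothesis zin : H1_in z.
Let h1 : H1 z.1. Proof. by case: zin => -[]. Qed.
Let h2 : H1 z.2. Proof. by case: zin => -[]. Qed.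
Let s1 : 0 < sqnorm z.1. Proof. by case: zin. Qed.
Let s2 : 0 < sqnorm z.2. Proof. by case: zin. Qed.
Local Notation q1 := (levi_civita z.1).
Local Notation q2 := (levi_civita z.2).
Local Notation f := (force r z).
Let cq1 : continuous q1.
Proof. by apply: levi_civita_continuous => //; [exact: H1_continuous|exact: H1_periodic]. Qed.
Let cq2 : continuous q2.
Proof. by apply: levi_civita_continuous => //; [exact: H1_continuous|exact: H1_periodic]. Qed.
Let cI (k : R -> R) : continuous k -> integrable_on 0 1 k.
Proof. by apply: continuous_integrable_on. Qed.

(* q2 and q1 decouple to first order: the interaction is replaced by the frozen force f,
   with an error quadratic in the L2 norm of the variation of (q1, q2). *)
Lemma interaction_expansion e : 0 < e -> exists2 d : R, 0 < d &
  forall h, H1_pair h -> H1_norm h < d -> H1_in (z + h) ->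
  forall p1 p2, p1 = levi_civita (z + h).1 -> p2 = levi_civita (z + h).2 ->
  `|(- r * itg 0 1 (fun t => (p1 t - p2 t)^-1) - (1 - r) / (itg 0 1 p1 - itg 0 1 p2)) -
    (- r * itg 0 1 (fun t => (q1 t - q2 t)^-1) - (1 - r) / (itg 0 1 q1 - itg 0 1 q2)) -
    ((itg 0 1 (fun t => f t * p1 t) - itg 0 1 (fun t => f t * q1 t)) -
     (itg 0 1 (fun t => f t * p2 t) - itg 0 1 (fun t => f t * q2 t)))| <= e * H1_norm h.
Proof.
move=> e0; have [c c0 cP] := levi_civita_gap zin.
have [K1 K10 [d1 d10 d1P]] := potential_lipschitz h1 s1.
have [K2 K20 [d2 d20 d2P]] := potential_lipschitz h2 s2.
pose K := K1 + K2; have K0 : 0 <= K by rewrite addr_ge0.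
pose W := (`|r| + `|1 - r|) * (4 / c ^+ 3 * K) + 1.
have c3 : 0 < 4 / c ^+ 3 by rewrite divr_gt0// exprn_gt0.
have W0 : 0 < W by rewrite ltr_wpDl// mulr_ge0 ?addr_ge0// mulr_ge0// ltW.
(* The bound c / 4 keeps the perturbed gap above c / 2. The bound e / W makes the remainders, each a
   multiple of m * H1_norm h, add up to at most e * H1_norm h. *)
pose m := Num.min (c / 4) (e / W).
have m0 : 0 < m by rewrite lt_min !divr_gt0.
have [d3 d30 d3P] := levi_civita_perturb h1 s1 m0.
have [d4 d40 d4P] := levi_civita_perturb h2 s2 m0.
exists (Num.min (Num.min d1 d2) (Num.min d3 d4)); first by rewrite !lt_min d10 d20 d30.
move=> h [hh1 hh2]; rewrite !lt_min => /andP[/andP[n1 n2] /andP[n3 n4]] zhin p1 p2 p1E p2E.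
have N0 := H1_norm_ge0 h.
have Dh1 : admissible z.1 h.1 by case: zhin.
have Dh2 : admissible z.2 h.2 by case: zhin.
have N1 := H1_norm_fst h; have N2 := H1_norm_snd h.
have D1 t : `|p1 t - q1 t| <= m by rewrite p1E; exact: (d3P h.1 Dh1 (le_lt_trans N1 n3) t).
have D2 t : `|p2 t - q2 t| <= m by rewrite p2E; exact: (d4P h.2 Dh2 (le_lt_trans N2 n4) t).
have cp1 : continuous p1.
  by rewrite p1E; case: zhin => -[a _] b _ _; apply: levi_civita_continuous => //; [exact: H1_continuous|exact: H1_periodic].
have cp2 : continuous p2.
  by rewrite p2E; case: zhin => -[_ a] _ b _; apply: levi_civita_continuous => //; [exact: H1_continuous|exact: H1_periodic].
have mc : m <= c / 4 by rewrite ge_min lexx.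
have me : m * W <= e by rewrite -ler_pdivlMr// ge_min lexx orbT.
have pc t : c / 2 <= p1 t - p2 t.
  exact: gap_perturb (D1 t) (D2 t) (cP t) mc.
pose b := itg 0 1 q1 - itg 0 1 q2; pose b' := itg 0 1 p1 - itg 0 1 p2.
have bc : c <= b := mean_gap_gt zin cP.
have b'c : c / 2 <= b'.
  by rewrite /b' p1E p2E; apply: (mean_gap_gt zhin) => t; rewrite -p1E -p2E.
pose G t := q1 t - q2 t; pose G' t := p1 t - p2 t.
have cG : continuous G by exact: cts_sub.
have cG' : continuous G' by exact: cts_sub.
have c20 : 0 < c / 2 by rewrite divr_gt0.
have G0 t : G t != 0 by apply: lt0r_neq0; exact: lt_le_trans c0 (cP t).
have G'0 t : G' t != 0 by apply: lt0r_neq0; exact: lt_le_trans c20 (pc t).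
have L1 (k : R -> R) (M : R) : continuous k -> (forall t, 0 <= t <= 1 -> `|k t| <= M) ->
    `|itg 0 1 (fun t => k t * p1 t) - itg 0 1 (fun t => k t * q1 t)| <= K1 * M * H1_norm h.
  move=> ck kM; rewrite p1E; apply: (le_trans (d1P h.1 Dh1 (le_lt_trans N1 n1) k M ck kM)).
  have M0 : 0 <= M by apply: le_trans (normr_ge0 (k 0)) (kM 0 _); rewrite lexx ler01.
  exact: ler_wpM2l (mulr_ge0 K10 M0) _ _ N1.
have L2 (k : R -> R) (M : R) : continuous k -> (forall t, 0 <= t <= 1 -> `|k t| <= M) ->
    `|itg 0 1 (fun t => k t * p2 t) - itg 0 1 (fun t => k t * q2 t)| <= K2 * M * H1_norm h.
  move=> ck kM; rewrite p2E; apply: (le_trans (d2P h.2 Dh2 (le_lt_trans N2 n2) k M ck kM)).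
  have M0 : 0 <= M by apply: le_trans (normr_ge0 (k 0)) (kM 0 _); rewrite lexx ler01.
  exact: ler_wpM2l (mulr_ge0 K20 M0) _ _ N2.
pose delta t := G' t - G t.
have cd : continuous delta by exact: cts_sub.
have dm t : `|delta t| <= 2 * m.
  rewrite (_ : delta t = (p1 t - q1 t) - (p2 t - q2 t)); last by rewrite /delta /G /G'; ring.
  by rewrite (le_trans (ler_normB _ _))// mulr2n mulrDl mul1r lerD.
have cfq (k1 w : R -> R) : continuous k1 -> continuous w -> integrable_on 0 1 (fun t => k1 t * w t).
  by move=> ? ?; exact/cI/cts_mul.
have Dq (k : R -> R) (M : R) : continuous k -> (forall t, 0 <= t <= 1 -> `|k t| <= M) ->
    `|itg 0 1 (fun t => k t * delta t)| <= K * M * H1_norm h.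
  move=> ck kM.
  rewrite (_ : itg 0 1 _ = (itg 0 1 (fun t => k t * p1 t) - itg 0 1 (fun t => k t * q1 t)) -
      (itg 0 1 (fun t => k t * p2 t) - itg 0 1 (fun t => k t * q2 t))).
    rewrite (le_trans (ler_normB _ _))// /K.
    by apply: le_trans (lerD (L1 k M ck kM) (L2 k M ck kM)) _; rewrite !mulrDl.
  rewrite -itgB; [|exact: cfq|exact: cfq].
  rewrite -itgB; [|exact: cfq|exact: cfq].
  rewrite -itgB; [|by apply/cI/cts_sub; exact: cts_mul|by apply/cI/cts_sub; exact: cts_mul].
  by apply: eq_itg => t _; rewrite /delta /G /G'; ring.
have V (x y : R) : c <= x -> c / 2 <= y -> `|(x ^+ 2)^-1 * y^-1| <= 4 / c ^+ 3 / 2.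
  move=> cx cy; have x0 := lt_le_trans c0 cx; have y0 : 0 < y by apply: lt_le_trans cy; rewrite divr_gt0.
  rewrite ger0_norm; last by rewrite mulr_ge0 ?invr_ge0 ?exprn_ge0 ?ltW.
  rewrite (_ : 4 / c ^+ 3 / 2 = (c ^+ 2)^-1 * (c / 2)^-1); last by field; rewrite gt_eqF.
  apply: ler_pM; rewrite ?invr_ge0 ?exprn_ge0 ?(ltW x0) ?(ltW y0)//.
    by rewrite lef_pV2 ?posrE ?exprn_gt0// lerXn2r ?nnegrE// ltW.
  by rewrite lef_pV2 ?posrE// divr_gt0.
(* The variation serves as its own weight: sup |delta| gives the small factor 2 m, the Lipschitz
   bound gives [H1_norm h]. *)
have Id2 : itg 0 1 (fun t => delta t * delta t) <= K * (2 * m) * H1_norm h.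
  apply: le_trans (ler_norm _) _; exact: Dq.
have R1 : `|itg 0 1 (fun t => (delta t * delta t) * ((G t ^+ 2)^-1 * (G' t)^-1))| <=
    4 / c ^+ 3 * K * m * H1_norm h.
  have cdd : continuous (fun t => delta t * delta t) by exact: cts_mul.
  have cVV : continuous (fun t => (G t ^+ 2)^-1 * (G' t)^-1).
    apply: cts_mul; apply: cts_inv => //; first exact: cts_exp.
    by move=> t; rewrite sqrf_eq0.
  apply: (@le_trans _ _ (itg 0 1 (fun t => (4 / c ^+ 3 / 2) * (delta t * delta t)))).
    apply: itg_norm_le; [exact: cfq|exact/cI/cts_scale|].
    move=> t _; rewrite normrM mulrC -expr2 normrX real_normK ?num_real//.
    by rewrite ler_wpM2r ?sqr_ge0//; apply: V; [exact: cP|exact: pc].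
  rewrite (itgZ _ (cI cdd)).
  rewrite [X in _ <= X](_ : _ = 4 / c ^+ 3 / 2 * (K * (2 * m) * H1_norm h)); last by field; rewrite gt_eqF.
  by rewrite ler_wpM2l// ltW// divr_gt0.
have bE : b' - b = itg 0 1 delta.
  rewrite (itgB (cI cG') (cI cG)) (itgB (cI cp1) (cI cp2)) (itgB (cI cq1) (cI cq2)).
  by [].
have bd : `|b' - b| <= K * H1_norm h.
  rewrite bE (eq_itg (g := fun t => 1 * delta t)); last by move=> t _; rewrite mul1r.
  rewrite -[K]mulr1; apply: (Dq (fun=> 1) 1); first exact: cst_continuous.
  by move=> t _; rewrite normr1.
have bd2 : `|b' - b| <= 2 * m.
  rewrite bE [X in _ <= X](_ : 2 * m = itg 0 1 (fun=> 2 * m)); last by rewrite itg_cst// subr0 mulr1.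
  by apply: itg_norm_le; [exact: cI|apply/cI; exact: cst_continuous|move=> t _; exact: dm].
have R2 : `|(b' - b) * (b' - b) * ((b ^+ 2)^-1 * b'^-1)| <= 4 / c ^+ 3 * K * m * H1_norm h.
  rewrite normrM; apply: (@le_trans _ _ ((K * H1_norm h * (2 * m)) * (4 / c ^+ 3 / 2))).
    by apply: ler_pM => //; [rewrite normrM; apply: ler_pM|exact: V].
  by rewrite le_eqVlt; apply/orP; left; apply/eqP; field; rewrite gt_eqF.
have cVG : continuous (fun t => (G t)^-1) by exact: cts_inv.
have cVG' : continuous (fun t => (G' t)^-1) by exact: cts_inv.
have cf : continuous f by exact: force_continuous.
have cVG2 : continuous (fun t => (G t ^+ 2)^-1).
  by apply: cts_inv; [exact: cts_exp|move=> t; rewrite sqrf_eq0].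
have cdd : continuous (fun t => (delta t * delta t) * ((G t ^+ 2)^-1 * (G' t)^-1)).
  by do ?apply: cts_mul.
have EF : (itg 0 1 (fun t => f t * p1 t) - itg 0 1 (fun t => f t * q1 t)) -
     (itg 0 1 (fun t => f t * p2 t) - itg 0 1 (fun t => f t * q2 t)) =
    r * itg 0 1 (fun t => (G t ^+ 2)^-1 * delta t) + (1 - r) / b ^+ 2 * (b' - b).
  rewrite bE -itgB; [|exact: cfq|exact: cfq].
  rewrite -itgB; [|exact: cfq|exact: cfq].
  rewrite -itgB; [|by apply/cI/cts_sub; exact: cts_mul|by apply/cI/cts_sub; exact: cts_mul].
  rewrite -(itgZ r (cfq _ _ cVG2 cd)) -(itgZ _ (cI cd)) -itgD; [|exact/cI/cts_scale/cts_mul|exact/cI/cts_scale].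
  by apply: eq_itg => t _; rewrite /force -/(G t) -/b /delta /G' /G; ring.
have EG : itg 0 1 (fun t => (G' t)^-1) - itg 0 1 (fun t => (G t)^-1) =
    - itg 0 1 (fun t => (G t ^+ 2)^-1 * delta t) +
    itg 0 1 (fun t => (delta t * delta t) * ((G t ^+ 2)^-1 * (G' t)^-1)).
  rewrite -itgB; [|exact: cI|exact: cI].
  rewrite -itgN; last exact: cfq.
  rewrite -itgD; [|by apply/cI/cts_opp; exact: cts_mul|exact: cI].
  by apply: eq_itg => t _; rewrite /delta; field; rewrite G0 G'0.
have b0 : b != 0 by apply: lt0r_neq0; exact: lt_le_trans c0 bc.
have b'0 : b' != 0 by apply: lt0r_neq0; exact: lt_le_trans c20 b'c.
rewrite EF -/b -/b'.
have -> : - r * itg 0 1 (fun t => (p1 t - p2 t)^-1) = - r * itg 0 1 (fun t => (G t)^-1) -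
   r * (- itg 0 1 (fun t => (G t ^+ 2)^-1 * delta t) +
    itg 0 1 (fun t => (delta t * delta t) * ((G t ^+ 2)^-1 * (G' t)^-1))).
  by rewrite -EG; ring.
move: R1 R2; set X := itg 0 1 (fun t => delta t * delta t * _); set Y := itg 0 1 (fun t => _ * delta t).
set Z := itg 0 1 (fun t => (G t)^-1); move=> R1 R2.
rewrite [X in `|X|](_ : _ = - (r * X + (1 - r) * ((b' - b) * (b' - b) * ((b ^+ 2)^-1 * b'^-1)))); last first.
  by field; rewrite b0 b'0.
rewrite normrN (le_trans (ler_normD _ _))// !(normrM r) (normrM (1 - r)).
apply: (@le_trans _ _ ((`|r| + `|1 - r|) * (4 / c ^+ 3 * K * m * H1_norm h))).
  rewrite [X in _ <= X]mulrDl; apply: lerD.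
    exact: ler_wpM2l (normr_ge0 r) _ _ R1.
  exact: ler_wpM2l (normr_ge0 (1 - r)) _ _ R2.
apply: (@le_trans _ _ (m * W * H1_norm h)); last by rewrite ler_wpM2r.
have mN : 0 <= m * H1_norm h by rewrite mulr_ge0// ltW.
rewrite (_ : m * W * H1_norm h = (`|r| + `|1 - r|) * (4 / c ^+ 3 * K * m * H1_norm h) + m * H1_norm h).
  by rewrite lerDl.
by rewrite /W; ring.
Qed.

Theorem B_r_expansion e : 0 < e -> exists2 d : R, 0 < d &
  forall h, H1_pair h -> H1_norm h < d -> H1_in (z + h) ->
  `|B_r r (z + h) - B_r r z -
    (first_variation z.1 f h.1 + first_variation z.2 (fun t => - f t) h.2)| <= e * H1_norm h.
Proof.
move=> e0; have e3 : 0 < e / 3 by rewrite divr_gt0.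
have cf : continuous f by exact: force_continuous.
have cNf : continuous (fun t => - f t) by exact: cts_opp.
have [_ _ /(_ _ e3)[d1 d10 d1P]] := first_variationP h1 s1 cf.
have [_ _ /(_ _ e3)[d2 d20 d2P]] := first_variationP h2 s2 cNf.
have [d3 d30 d3P] := interaction_expansion e3.
exists (Num.min d1 (Num.min d2 d3)); first by rewrite !lt_min d10 d20.
move=> h hh; rewrite !lt_min => /andP[n1 /andP[n2 n3]] zhin.
have N1 := H1_norm_fst h; have N2 := H1_norm_snd h; have [hh1 hh2] := hh.
have Dh1 : admissible z.1 h.1 by case: zhin.
have Dh2 : admissible z.2 h.2 by case: zhin.
have E1 := d1P h.1 Dh1 (le_lt_trans N1 n1) tt I.
have E2 := d2P h.2 Dh2 (le_lt_trans N2 n2) tt I.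
have E3 := d3P h hh n3 zhin _ _ erefl erefl.
have cp2 : continuous (levi_civita (z + h).2).
  by case: zhin => -[_ a] _ b _; apply: levi_civita_continuous => //; [exact: H1_continuous|exact: H1_periodic].
have EN (w : R -> R) : continuous w -> itg 0 1 (fun t => - f t * w t) = - itg 0 1 (fun t => f t * w t).
  move=> cw; rewrite -itgN; last exact/cI/cts_mul.
  by apply: eq_itg => t _; rewrite mulNr.
rewrite (EN _ cp2) (EN _ cq2) in E2.
rewrite (B_rE r zhin) (B_rE r zin).
apply: le_trans (B_r_triangle E1 E2 E3) _.
have e30 := ltW e3.
apply: (@le_trans _ _ (e / 3 * H1_norm h + e / 3 * H1_norm h + e / 3 * H1_norm h)).
  apply: lerD; last exact: lexx.
  by apply: lerD; [exact: ler_wpM2l e30 _ _ N1|exact: ler_wpM2l e30 _ _ N2].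
have third (n : R) : e / 3 * n + e / 3 * n + e / 3 * n = e * n by field.
by rewrite third.
Qed.

Lemma H1_in_open : exists2 d : R, 0 < d & forall h, H1_pair h -> H1_norm h < d -> H1_in (z + h).
Proof.
have [c c0 cP] := levi_civita_gap zin.
have [d1 d10 d1P] := sqnorm_perturb_gt0 h1 s1.
have [d2 d20 d2P] := sqnorm_perturb_gt0 h2 s2.
have c4 : 0 < c / 4 by rewrite divr_gt0.
have [d3 d30 d3P] := levi_civita_perturb h1 s1 c4.
have [d4 d40 d4P] := levi_civita_perturb h2 s2 c4.
exists (Num.min (Num.min d1 d2) (Num.min d3 d4)); first by rewrite !lt_min d10 d20 d30.
move=> h [hh1 hh2]; rewrite !lt_min => /andP[/andP[n1 n2] /andP[n3 n4]].
have N1 := H1_norm_fst h; have N2 := H1_norm_snd h.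
have P1 := d1P h.1 hh1 (le_lt_trans N1 n1); have P2 := d2P h.2 hh2 (le_lt_trans N2 n2).
apply/H1_inP; split.
- by split; [exact: (H1D h1 hh1)|exact: (H1D h2 hh2)].
- exact: P1.
- exact: P2.
move=> t; have D1 := d3P h.1 (conj hh1 P1) (le_lt_trans N1 n3) t.
have D2 := d4P h.2 (conj hh2 P2) (le_lt_trans N2 n4) t.
have := gap_perturb D1 D2 (cP t) (lexx _).
rewrite -subr_gt0 => /(lt_le_trans _); apply; by rewrite divr_gt0.
Qed.

End Criticality.

Lemma itg_wderivZ (w g : R -> R) c : H1 w -> in_L2 g ->
  itg 0 1 (fun x => g x * wderiv (fun x => c * w x) x) = c * itg 0 1 (fun x => g x * wderiv w x).
Proof.
move=> hw g2; have [w2 aw] := H1_AC hw; have hcw := H1Z c hw; have [cw2 _] := H1_AC hcw.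
have ae := H1_wderiv_ae hcw (ACZ c aw).
rewrite -itgZ; last exact: in_L2_prod.
apply: eq_itg_ae.
- by apply: measurable_funM; [exact: g2.1|exact: cw2.1].
- by apply: measurable_funM; [exact: measurable_cst|apply: measurable_funM; [exact: g2.1|exact: w2.1]].
- by apply: filterS ae => x /= H x01; rewrite H//; ring.
Qed.

Lemma first_variationZ (w k h : R -> R) c : H1 w -> 0 < sqnorm w -> continuous k -> H1 h ->
  first_variation w k (fun x => c * h x) = c * first_variation w k h.
Proof.
move=> hw w0 ck hh; have [w2 _] := H1_AC hw; have cw := H1_continuous hw; have ch := H1_continuous hh.
have [cE _ _] := energy_AC hw ck.
rewrite /first_variation itg_wderivZ// mulrDr; congr (_ + _); first by ring.
rewrite -itgZ; first by apply: eq_itg => x _; ring.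
apply: continuous_integrable_on; apply: cts_mul; last exact: cts_mul.
apply/cts_scale/cts_add => //; apply: cts_mul; last exact: cts_exp.
by apply: cts_comp => //; exact: time_change_continuous.
Qed.

Lemma H1_norm1Z (h : R -> R) c : H1 h -> H1_norm1 (fun x => c * h x) ^+ 2 = c ^+ 2 * H1_norm1 h ^+ 2.
Proof.
move=> hh; have [h2 ah] := H1_AC hh; have ch := H1_continuous hh.
have S g : in_L2 g -> sqnorm (fun x => c * g x) = c ^+ 2 * sqnorm g.
  move=> g2; rewrite (sqnormE g) (sqnormE (fun x => c * g x)) -itgZ; last exact: g2.2.
  by apply: eq_itg => x _; rewrite exprMn.
have E1 := H1_norm1_sqr (fun x => c * h x); have E2 := H1_norm1_sqr h.
have E3 := sqnorm_wderiv (H1Z c hh) (ACZ c ah).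
apply: (etrans E1); apply: (etrans (congr2 +%R (S _ (continuous_in_L2 ch)) (etrans E3 (S _ h2)))).
exact: etrans (esym (mulrDr _ _ _)) (congr1 _ (esym E2)).
Qed.

Lemma H1_normZ h c : H1_pair h -> 0 <= c ->
  H1_norm ((fun x => c * h.1 x), (fun x => c * h.2 x)) = c * H1_norm h.
Proof.
move=> [hh1 hh2] c0; set k := (_, _).
have E : H1_norm k ^+ 2 = (c * H1_norm h) ^+ 2.
  apply: (etrans (H1_norm_sqr k)).
  apply: (etrans (congr2 +%R (H1_norm1Z c hh1) (H1_norm1Z c hh2))).
  apply: (etrans (esym (mulrDr _ _ _))); apply: (etrans (congr1 _ (esym (H1_norm_sqr h)))).
  by rewrite exprMn.
have k0 := H1_norm_ge0 k; have n0 := mulr_ge0 c0 (H1_norm_ge0 h).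
apply/eqP; rewrite eq_le; apply/andP; split.
  by apply: (le_of_sqr_le n0); rewrite E.
by apply: (le_of_sqr_le k0); rewrite E.
Qed.

Lemma fun0Z (w : R -> R) : (fun=> 0 : R) = (fun x => 0 * w x).
Proof. by apply/funext => x; rewrite mul0r. Qed.

Theorem critical_pointP r z : critical_point (@H1_in R) (B_r r) z <->
  [/\ H1_in z, forall k, H1 k -> first_variation z.1 (force r z) k = 0
    & forall k, H1 k -> first_variation z.2 (fun t => - force r z t) k = 0].
Proof.
split=> [[zin zc]|[zin c1 c2]]; last first.
  split => // e e0; have [d d0 dP] := B_r_expansion r zin e0.
  exists d => // h hh hd zhin; have := dP h hh hd zhin.
  by rewrite (c1 _ hh.1) (c2 _ hh.2) addr0 subr0.
have [[h1 h2] s1 s2 _] := zin; have cf : continuous (force r z) by exact: force_continuous.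
have cNf : continuous (fun t => - force r z t) by exact: cts_opp.
have [d1 d10 d1P] := H1_in_open zin.
have fv0 (w k : R -> R) : H1 w -> 0 < sqnorm w -> continuous k -> first_variation w k (fun=> 0) = 0.
  by move=> hw w0 ck; rewrite (fun0Z w) first_variationZ// mul0r.
(* along the ray z + s h, criticality and the expansion bound the linear term by e s |h| *)
have K h : H1_pair h -> (forall s, H1_pair ((fun x => s * h.1 x), (fun x => s * h.2 x))) ->
    first_variation z.1 (force r z) h.1 + first_variation z.2 (fun t => - force r z t) h.2 = 0.
  move=> [hh1 hh2] hs; set L := _ + _.
  pose n := H1_norm h; have n0 : 0 <= n := H1_norm_ge0 h.
  suff B e : 0 < e -> `|L| <= e * (2 * n).
    apply/eqP; rewrite -normr_le0; apply/ler_addgt0Pr => e e0; rewrite add0r.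
    have n1 : 0 < 2 * n + 1 by rewrite ltr_wpDl// mulr_ge0.
    apply: le_trans (B (e / (2 * n + 1)) (divr_gt0 e0 n1)) _.
    by rewrite mulrAC ler_pdivrMr// ler_pM2l// lerDl.
  move=> e0; have [d2 d20 d2P] := zc e e0; have [d3 d30 d3P] := B_r_expansion r zin e0.
  pose m := Num.min d1 (Num.min d2 d3); have m0 : 0 < m by rewrite !lt_min d10 d20.
  have n1 : 0 < n + 1 by rewrite ltr_wpDl.
  pose s := m / (n + 1); have s0 : 0 < s by rewrite divr_gt0.
  pose hs' : pair2 := ((fun x => s * h.1 x), (fun x => s * h.2 x)).
  have Ns : H1_norm hs' = s * n := H1_normZ (conj hh1 hh2) (ltW s0).
  have Nm : H1_norm hs' < m.
    by rewrite Ns /s mulrAC ltr_pdivrMr// ltr_pM2l// ltrDl.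
  move: Nm; rewrite !lt_min => /andP[m1 /andP[m2 m3]].
  have zhin := d1P hs' (hs s) m1.
  have A1 := d2P hs' (hs s) m2 zhin; have A2 := d3P hs' (hs s) m3 zhin.
  rewrite (first_variationZ s h1 s1 cf hh1) (first_variationZ s h2 s2 cNf hh2) -mulrDr in A2.
  rewrite -(ler_pM2l s0) -[X in X * `|L|](gtr0_norm s0) -normrM.
  apply: (@le_trans _ _ (e * H1_norm hs' + e * H1_norm hs')); last first.
    by rewrite Ns le_eqVlt; apply/orP; left; apply/eqP; ring.
  apply: le_trans (lerD A1 A2).
  have tri (a b : R) : `|b| <= `|a| + `|a - b|.
    by rewrite -[X in `|X| <= _](subKr a b); exact: ler_normB.
  exact: tri.
have h0 : H1 (fun=> 0 : R) by rewrite (fun0Z z.1); exact: H1Z.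
(* Varying one component at a time separates the two first variations. *)
split => // h hh.
  have := K (h, fun=> 0) (conj hh h0); rewrite /= fv0// addr0; apply => s.
  by split; exact: H1Z.
have := K (fun=> 0, h) (conj h0 hh); rewrite /= fv0// add0r; apply => s.
by split; exact: H1Z.
Qed.
End Pair.

(** * The Euler-Lagrange equation *)

Section Periodization.
Variable R : realType.
Implicit Types (u v w : R -> R) (x y d e : R).

Lemma periodize_periodic u : periodic1 (fun x => u (x - (Num.floor x)%:~R)).
Proof.
move=> x; congr u; have -> : Num.floor (x + 1) = Num.floor x + 1.
  by rewrite floorDrz ?floor1// rpred1.
by rewrite intrD; ring.
Qed.

(** Points less than 1 apart lie in the same period or in adjacent ones; in the second case both
    values are compared with the common end value u 1 = u 0. *)
Lemma periodize_continuous u : continuous u -> u 1 = u 0 ->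
  continuous (fun x => u (x - (Num.floor x)%:~R)).
Proof.
move=> cu u10.
have W e : 0 < e -> exists2 d : R, 0 < d & forall x y, x <= y -> y - x < d ->
    `|u (y - (Num.floor y)%:~R) - u (x - (Num.floor x)%:~R)| < e.
  move=> e0; have e2 : 0 < e / 2 by rewrite divr_gt0.
  have [d d0 dP] := @uniform_continuous_itv R u 0 1 cu _ e2.
  exists (Num.min d 1); first by rewrite lt_min d0 ltr01.
  move=> x y xy; rewrite lt_min => /andP[yd y1].
  have [x0 x1] := andP (frac_itv01 x); have [z0 z1] := andP (frac_itv01 y).
  have /andP[fx1 fx2] := floor_itv x; have /andP[fy1 fy2] := floor_itv y.
  have [/eqP E|N] := eqVneq (Num.floor y) (Num.floor x).
    rewrite (eqP E); apply: lt_trans (dP _ _ _ _) _; rewrite ?x0//; last by rewrite ltr_pdivrMr// ltr_pMr// ltr1n.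
    by rewrite opprB addrA addrNK ger0_norm ?subr_ge0.
  have L : Num.floor x <= Num.floor y by exact: le_floor.
  have E : Num.floor y = Num.floor x + 1.
    apply/eqP; rewrite eq_le; apply/andP; split; last by rewrite lezD1 lt_neqAle eq_sym N.
    rewrite -ltzD1 -(ltr_int R) !intrD.
    move: fx1 fx2 fy1 fy2; rewrite !intrD => fx1 fx2 fy1 fy2; lra.
  move: x0 x1 z0 z1; rewrite E intrD; set s := y - _; set t := x - _ => x0 x1 z0 z1.
  have st : s + 1 - t = y - x by rewrite /s /t; ring.
  have A1 : `|u t - u 1| < e / 2.
    by apply: (dP 1 t); rewrite ?ler01 ?lexx// ltr_norml; apply/andP; split; lra.
  have A2 : `|u s - u 0| < e / 2.
    by apply: (dP 0 s); rewrite ?ler01 ?lexx// subr0 ger0_norm//; lra.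
  rewrite (_ : u s - u t = (u s - u 0) - (u t - u 1)); last by rewrite u10; ring.
  by apply: le_lt_trans (ler_normB _ _) _; rewrite [ltRHS](splitr e) ltrD.
move=> x; apply/continuous_atP => e e0; have [d d0 dP] := W e e0.
exists d => // y yd; have [xy|/ltW yx] := leP x y.
  by apply: dP => //; exact: le_lt_trans (ler_norm _) yd.
by rewrite distrC; apply: dP => //; rewrite distrC in yd; exact: le_lt_trans (ler_norm _) yd.
Qed.

(** Passes from one period to a classical derivative on the line: periodicity of u makes the mean of
    w zero, so the primitive of w is periodic and coincides with u - u 0 everywhere. *)
Lemma periodic_AC_derive u w : periodic1 u -> AC01 u w -> continuous w -> periodic1 w ->
  forall x, is_derive x 1 u (w x).
Proof.
move=> pu [cu _ uE] cw pw x.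
have dp y := is_derive_prim y cw.
have w0 : itg 0 1 w = 0.
  have := uE 1; rewrite lexx ler01 => /(_ isT).
  by rewrite (periodic1_10 pu) => /esym/eqP; rewrite -subr_eq0 [u 0 + _]addrC addrK => /eqP.
have pP : periodic1 (fun y => u 0 + prim w y) by move=> y; rewrite prim_shift1// w0 addr0.
have -> : u = (fun y => u 0 + prim w y).
  apply/funext => y; rewrite (periodic1_frac y pu) (periodic1_frac y pP).
  by have /andP[y0 y1] := frac_itv01 y; rewrite prim_ge0// uE ?y0.
by apply: is_derive_eq (derD (is_derive_cst (u 0) x 1) (dp x)) _; rewrite add0r.
Qed.

End Periodization.

Section EulerLagrange.
Variable R : realType.
Variables z f : R -> R.
Hypotheses (hz : H1 z) (z0 : 0 < sqnorm z) (cf : continuous f) (pf : periodic1 f).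
Implicit Types (h k u v w e : R -> R) (a b c d x y s t : R).
Local Notation C := (sqnorm z).
Local Notation g := (wderiv z).
Let cz : continuous z. Proof. exact: H1_continuous. Qed.
Let pz : periodic1 z. Proof. exact: H1_periodic. Qed.
Let g2 : in_L2 g. Proof. by have [] := H1_AC hz. Qed.
Let az : AC01 z g. Proof. by have [] := H1_AC hz. Qed.
Let n0 : C != 0. Proof. exact: lt0r_neq0. Qed.
Let ctz : continuous (time_change z). Proof. exact: time_change_continuous. Qed.
Let cft : continuous (fun x => f (time_change z x)). Proof. exact: cts_comp. Qed.
Let cI k a b : continuous k -> integrable_on a b k. Proof. exact: continuous_integrable_on. Qed.

(* e is the energy as a function of tau. *)
Record EL_solution v e : Prop := ELSolution {
  EL_z : forall x : R, is_derive x 1 z (v x);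
  EL_v : forall x : R, is_derive x 1 v ((e x + f (time_change z x) * z x ^+ 2) / (2 * C ^+ 2) * z x);
  EL_e : forall x : R, is_derive x 1 e (2 * f (time_change z x) * z x * v x);
  EL_energy : forall x, z x ^+ 2 * e x = 2 * C ^+ 2 * v x ^+ 2 - 2;
  EL_periodic : periodic1 e }.

Lemma derive_periodic u v : (forall x : R, is_derive x 1 u (v x)) -> periodic1 u -> periodic1 v.
Proof.
move=> du pu x; have D := is_derive_shiftD (du (x + 1)).
have E : (fun y => u (y + 1)) = u by apply/funext => y; rewrite pu.
by rewrite E in D; rewrite -(derive1_val D); exact: derive1_val (du x).
Qed.

Lemma itg_wderiv w w' k : H1 w -> AC01 w w' -> measurable_fun (`[0, 1] : set R) k ->
  itg 0 1 (fun x => k x * wderiv w x) = itg 0 1 (fun x => k x * w' x).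
Proof.
move=> hw aw mk; have ae := H1_wderiv_ae hw aw; have [w2 _] := H1_AC hw.
have [_ Iw _] := aw.
apply: eq_itg_ae.
- by apply: measurable_funM; [exact: mk|exact: w2.1].
- by apply: measurable_funM; [exact: mk|exact: integrable_on_measurable Iw].
- by apply: filterS ae => x /= H x01; rewrite H.
Qed.

(** [work] is built from the weak derivative; any other derivative of z agrees with it almost
    everywhere and gives the same integrals. *)
Lemma work_eq v : AC01 z v -> AC01 (work z f) (fun x => f (time_change z x) * (2 * (z x * v x))).
Proof.
move=> av; have aw := work_AC hz cf; have [cw _ _] := aw.
have Iv : integrable_on 0 1 v by case: av.
have I : integrable_on 0 1 (fun x => f (time_change z x) * (2 * (z x * v x))).
  by apply: integrable_onM => //; apply/integrable_onZ/integrable_onM.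
split => // x x01; have [x0 x1] := andP x01.
rewrite /work !clamp01_id ?lexx ?ler01// itg_xx add0r.
have ae := AC_unique az av.
have I' := work_density_integrable hz cf.
apply: eq_itg_ae_sub => //.
apply: filterS ae => s /= H s01; rewrite /work_density H//.
Qed.

Lemma first_variation_AC v h h' : AC01 z v -> in_L2 v -> H1 h -> AC01 h h' ->
  first_variation z f h = 4 * C * itg 0 1 (fun x => v x * h' x) +
  itg 0 1 (fun x => 2 / C * (energy z f x + f (time_change z x) * z x ^+ 2) * (z x * h x)).
Proof.
move=> av v2 hh ah; rewrite /first_variation; congr (_ * _ + _).
rewrite (itg_wderiv hh ah g2.1).
have Ih : integrable_on 0 1 h' by case: ah.
have mh := integrable_on_measurable Ih.
have E k : itg 0 1 (fun x => k x * h' x) = itg 0 1 (fun x => h' x * k x) by apply: eq_itg => x _; exact: mulrC.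
by rewrite (E g) (E v); exact: itg_wderiv hz av mh.
Qed.

(** The Euler-Lagrange equation reads 4 C z'' = K. *)
Let K x := 2 / C * (energy z f x + f (time_change z x) * z x ^+ 2) * z x.

Let cK : continuous K.
Proof.
apply: cts_mul => //; apply/cts_scale/cts_add; first by have [] := energy_AC hz cf.
by apply: cts_mul => //; exact: cts_exp.
Qed.

(* Testing with h = phi, phi'' arbitrary of mean zero, identifies 4 C z with a second
   primitive of K up to an affine function; hence z is C^2 on [0, 1]. *)
Lemma stationary_AC : (forall h, H1 h -> first_variation z f h = 0) ->
  itg 0 1 K = 0 /\ exists c, AC01 z (fun x => (prim K x - c) / (4 * C)).
Proof.
move=> st; have g1 := in_L2_integrable g2.
have EV h h' : H1 h -> AC01 h h' -> 4 * C * itg 0 1 (fun x => g x * h' x) + itg 0 1 (fun x => K x * h x) = 0.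
  move=> hh ah; apply: (etrans _ (st h hh)); rewrite (first_variation_AC az g2 hh ah).
  rewrite (eq_itg (f := fun x => K x * h x)
    (g := fun x => 2 / C * (energy z f x + f (time_change z x) * z x ^+ 2) * (z x * h x))) //.
  by move=> x _; rewrite /K; ring.
have K0 : itg 0 1 K = 0.
  have a1 := AC_cst (1 : R).
  have h1 : H1 (fun=> 1 : R) by apply: AC_H1 a1 => //; apply: continuous_in_L2; exact: cst_continuous.
  have := EV _ _ h1 a1.
  rewrite (eq_itg (g := fun=> 0)); last by move=> x _; rewrite mulr0.
  rewrite itg_cst// mul0r mulr0 add0r; apply: etrans.
  by apply: eq_itg => x _; rewrite mulr1.
split => //.
have dw x := is_derive_prim x cK; have cw : continuous (prim K) := continuous_derive dw.
have dW x := is_derive_prim x cw; have cW : continuous (prim (prim K)) := continuous_derive dW.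
(* With this slope the second primitive of K minus c x vanishes at 0 and at 1, so the integration by
   parts against psi has no boundary terms. *)
pose c := prim (prim K) 1.
pose u x := 4 * C * z x - (prim (prim K) x - c * x).
have dl x : is_derive x 1 (fun y => prim (prim K) y - c * y) (prim K x - c).
  by apply: is_derive_eq (derB (dW x) (derZ c (is_derive_id x 1))) _; rewrite mulr1.
have cpc : continuous (fun x => prim K x - c) by apply: cts_sub => //; exact: cst_continuous.
have al := C1_AC dl cpc; have [cl _ _] := al.
have cu : continuous u by apply: cts_sub => //; exact: cts_scale.
have az4 := ACZ (4 * C) az.
have E : forall x, 0 <= x <= 1 -> u x = u 0.
  apply: du_bois_reymond => // chi tchi; have [chi01 dchi cdchi achi] := test_function_C1 tchi.
  have [pchi schi] := tchi; have cchi : continuous chi := continuous_derive dchi.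
  pose m := itg 0 1 chi; pose psi x := chi x - m.
  have dpsi x : is_derive x 1 psi (derive1 chi x).
    by apply: is_derive_eq (derB (dchi x) (is_derive_cst m x 1)) _; rewrite subr0.
  have cpsi : continuous psi := continuous_derive dpsi.
  have ppsi : periodic1 psi by move=> x; rewrite /psi pchi.
  have psi0 : itg 0 1 psi = 0.
    rewrite /psi itgB; [|exact: cI|apply: cI; exact: cst_continuous].
    by rewrite itg_cst// subr0 mulr1 subrr.
  pose phi := prim psi; have dphi x : is_derive x 1 phi (psi x) := is_derive_prim x cpsi.
  have pphi : periodic1 phi by move=> x; rewrite /phi prim_shift1// psi0 addr0.
  have hphi : H1 phi := H1_smooth pphi dphi cpsi.
  have aphi := C1_AC dphi cpsi; have apsi := C1_AC dpsi cdchi.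
  have := EV _ _ hphi aphi.
  have p0 : phi 0 = 0 by rewrite /phi prim0.
  have p1 : phi 1 = 0 by rewrite /phi prim_ge0.
  have w1 : prim K 1 = 0 by rewrite prim_ge0.
  have e1 : itg 0 1 (fun x => g x * psi x) = - itg 0 1 (fun x => z x * derive1 chi x).
    rewrite (itg_parts az apsi) (periodic1_10 pz) (periodic1_10 ppsi); ring.
  have e2 : itg 0 1 (fun x => K x * phi x) = - itg 0 1 (fun x => prim K x * psi x).
    by rewrite (itg_parts (C1_AC dw cK) aphi) w1 p0 !mul0r mulr0 subrr sub0r opprK.
  have e3 : itg 0 1 (fun x => (prim K x - c) * psi x) = - itg 0 1 (fun x => (prim (prim K) x - c * x) * derive1 chi x).
    rewrite (itg_parts al apsi) prim0 /c; ring.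
  have e4 : itg 0 1 (fun x => (prim K x - c) * psi x) = itg 0 1 (fun x => prim K x * psi x).
    rewrite (eq_itg (g := fun x => prim K x * psi x - c * psi x)); last by move=> x _; ring.
    rewrite itgB; [|exact/cI/cts_mul|exact/cI/cts_scale].
    by rewrite itgZ ?psi0 ?mulr0 ?subr0//; exact: cI.
  rewrite e1 e2 -e4 e3 opprK => EE.
  rewrite int01E (eq_itg (g := fun x => 4 * C * (z x * derive1 chi x) - (prim (prim K) x - c * x) * derive1 chi x)); last first.
    by move=> x _; rewrite /u; ring.
  have c1 : continuous (fun x => z x * derive1 chi x) by exact: cts_mul.
  have c2 : continuous (fun x => (prim (prim K) x - c * x) * derive1 chi x) by exact: cts_mul.
  rewrite itgB; [|exact/cI/cts_scale|exact: cI].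
  rewrite (itgZ _ (cI _ _ c1)); move: EE; rewrite mulrN => EE.
  by apply: oppr_inj; apply: etrans (etrans EE (esym (oppr0 _))); rewrite opprB addrC.
have C40 : 4 * C != 0 by rewrite mulf_neq0.
exists c; apply: eq_AC (ACD (AC_cst (u 0 / (4 * C))) (ACZ (4 * C)^-1 al)) => //.
- move=> x x01; rewrite -(E x x01) /u; field; exact: n0.
- by move=> x _; rewrite add0r mulrC.
Qed.

Local Notation V c := (fun x => (prim K x - c) / (4 * C)).

(** The difference D of the two sides has derivative zero, hence is constant, and its mean vanishes
    by the choice of the constant in [energy]. *)
Lemma energy_identity c : AC01 z (V c) ->
  forall x, 0 <= x <= 1 -> z x ^+ 2 * energy z f x = 2 * C ^+ 2 * V c x ^+ 2 - 2.
Proof.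
move=> av.
have dV x : is_derive x 1 (V c) (K x / (4 * C)).
  apply: is_derive_eq (derM (derB (is_derive_prim x cK) (is_derive_cst c x 1)) (is_derive_cst (4 * C)^-1 x 1)) _.
  by rewrite mulr0 addr0 subr0.
have cV : continuous (V c) := continuous_derive dV.
have aV : AC01 (V c) (fun x => K x / (4 * C)) by apply: C1_AC dV _; apply: cts_mul => //; exact: cst_continuous.
have v2 := continuous_in_L2 cV.
have [cE _ _] := energy_AC hz cf; have [cW _ _] := work_AC hz cf.
have aE : AC01 (energy z f) (fun x => f (time_change z x) * (2 * (z x * V c x))).
  pose m := C^-1 * itg 0 1 (fun s => work z f s * z s ^+ 2).
  apply: eq_AC cE _ _ (ACD (AC_cst (2 * C * sqnorm g - 2 / C - m)) (work_eq av)) => [x _|x _].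
    by rewrite /energy /m; ring.
  by rewrite add0r.
have aD := ACD (ACD (AC_mul (AC_mul av av) aE) (ACZ (- (2 * C ^+ 2)) (AC_mul aV aV))) (AC_cst 2).
set D := fun x => z x * z x * energy z f x + _ + 2 in aD.
have cD : continuous D by case: aD.
have a0 : AC01 D (fun=> 0).
  by apply: eq_AC aD => // x _; rewrite /K; field; exact: n0.
have DE x : 0 <= x <= 1 -> D x = D 0.
  by move=> x01; have [_ _ ->] := a0; rewrite // itg_cst ?mul0r ?addr0//; case/andP: x01.
have cVV : continuous (fun x => V c x ^+ 2) by exact: cts_exp.
have cWz : continuous (fun x => work z f x * z x ^+ 2) by apply: cts_mul => //; exact: cts_exp.
have cz2 : continuous (fun x => z x ^+ 2) by exact: cts_exp.
have D0 : D 0 = 0.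
  have E1 : itg 0 1 D = D 0.
    by rewrite (eq_itg DE) itg_cst ?ler01// subr0 mulr1.
  have sV : sqnorm g = itg 0 1 (fun x => V c x ^+ 2) by rewrite (sqnorm_wderiv hz av) sqnormE.
  have sC : C = itg 0 1 (fun x => z x ^+ 2) by rewrite sqnormE.
  pose m := itg 0 1 (fun s => work z f s * z s ^+ 2).
  pose l := 2 * C * sqnorm g - 2 / C - C^-1 * m.
  have EE : itg 0 1 D = l * C + m - 2 * C ^+ 2 * sqnorm g + 2.
    rewrite (eq_itg (g := fun x => l * z x ^+ 2 + work z f x * z x ^+ 2 - 2 * C ^+ 2 * V c x ^+ 2 + 2)); last first.
      by move=> x _; rewrite /D /energy /l /m; ring.
    rewrite itgD; [|apply: cI; apply: cts_sub; [apply: cts_add => //; exact: cts_scale|exact: cts_scale]|apply: cI; exact: cst_continuous].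
    rewrite itg_cst ?ler01// subr0 mulr1.
    rewrite itgB; [|apply: cI; apply: cts_add => //; exact: cts_scale|apply: cI; exact: cts_scale].
    rewrite (itgZ _ (cI _ _ cVV)) -sV itgD; [|apply: cI; exact: cts_scale|exact: cI].
    by rewrite (itgZ _ (cI _ _ cz2)) -sC.
  rewrite -E1 EE /l; field; exact: n0.
move=> x x01; have := DE x x01; rewrite D0 /D => H.
apply/eqP; rewrite -subr_eq0; apply/eqP; apply: etrans H; ring.
Qed.

Lemma energy_work x : energy z f x = energy z f 0 + (work z f x - work z f 0).
Proof. rewrite /energy; ring. Qed.

Lemma work0 : work z f 0 = 0.
Proof. by rewrite /work clamp01_id ?lexx ?ler01// itg_xx. Qed.

(** z and z' take the same values at 0 and 1, the latter because K has mean zero. The energy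
    identity then gives z(0)^2 e(0) = z(0)^2 e(1), and the factor cancels. *)
Lemma stationary_work : (forall h, H1 h -> first_variation z f h = 0) -> z 0 != 0 -> work z f 1 = 0.
Proof.
move=> st z00; have [K0 [c av]] := stationary_AC st.
have E0 := energy_identity av (x := 0); have E1 := energy_identity av (x := 1).
move: E0 E1; rewrite !lexx ler01 => /(_ isT) + /(_ isT).
rewrite (periodic1_10 pz) prim0 prim_ge0// K0 => <- /eqP.
rewrite -subr_eq0 -mulrBr mulf_eq0 sqrf_eq0 (negbTE z00)/= energy_work work0 subr0.
by rewrite [_ + _ - _]addrAC subrr add0r => /eqP.
Qed.

(** The equations are known on [0, 1] only. Vanishing total work lets the energy be continued
    periodically and continuously, so that they hold classically across the integers as well. *)
Lemma stationary_EL : (forall h, H1 h -> first_variation z f h = 0) -> work z f 1 = 0 ->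
  exists v e, EL_solution v e.
Proof.
move=> st w1; have [K0 [c av]] := stationary_AC st; have EI := energy_identity av.
have [cE _ _] := energy_AC hz cf.
have E10 : energy z f 1 = energy z f 0 by rewrite energy_work w1 work0 subr0 addr0.
pose e x := energy z f (x - (Num.floor x)%:~R).
have ce : continuous e := periodize_continuous cE E10.
have pe : periodic1 e by exact: periodize_periodic.
have eE x : 0 <= x <= 1 -> e x = energy z f x.
  case/andP=> x0; rewrite le_eqVlt => /predU1P[->|x1].
    by rewrite /e floor1 subrr E10.
  by rewrite /e (_ : Num.floor x = 0) ?subr0//; apply/eqP; rewrite floor_eq x0 add0r.
have ptz : periodic1 (fun x => f (time_change z x)) by move=> x; rewrite time_change_shift// pf.
pose k x := 2 / C * (e x + f (time_change z x) * z x ^+ 2) * z x.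
have ck : continuous k.
  apply: cts_mul => //; apply/cts_scale/cts_add => //.
  by apply: cts_mul => //; exact: cts_exp.
have pk : periodic1 k by move=> x; rewrite /k pe ptz pz.
have kK x : 0 <= x <= 1 -> k x = K x by move=> x01; rewrite /k eE.
have pkK x : 0 <= x <= 1 -> prim k x = prim K x.
  case/andP=> x0 x1; apply: (etrans (prim_ge0 k x0)); apply: (etrans _ (esym (prim_ge0 K x0))).
  apply: eq_itg => s /andP[s0 sx]; apply: kK; rewrite s0/=; exact: le_trans sx x1.
pose v x := (prim k x - c) / (4 * C).
have dv x : is_derive x 1 v (k x / (4 * C)).
  apply: is_derive_eq (derM (derB (is_derive_prim x ck) (is_derive_cst c x 1)) (is_derive_cst (4 * C)^-1 x 1)) _.
  by rewrite mulr0 addr0 subr0.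
have cv : continuous v := continuous_derive dv.
have pv : periodic1 v by move=> x; rewrite /v prim_shift1// (eq_itg kK) K0 addr0.
have vV x : 0 <= x <= 1 -> (prim K x - c) / (4 * C) = v x.
  by move=> x01; apply: (congr1 (fun y => (y - c) / (4 * C))); apply/esym/pkK.
have azv : AC01 z v := eq_AC cz (fun _ _ => erefl) vV av.
have dz := periodic_AC_derive pz azv cv pv.
pose p x := f (time_change z x) * (2 * (z x * v x)).
have cp : continuous p by apply: cts_mul => //; apply: cts_scale; exact: cts_mul.
have pp : periodic1 p by move=> x; rewrite /p ptz pz pv.
have ae : AC01 e p.
  apply: eq_AC (ACD (AC_cst (energy z f 0)) (work_eq azv)) => //.
    by move=> x x01; rewrite eE// (energy_work x) work0 subr0.
  by move=> x _; rewrite add0r.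
have de := periodic_AC_derive pe ae cp pp.
exists v, e; split=> // x.
- by apply: is_derive_eq (dv x) _; rewrite /k; field; exact: n0.
- by apply: is_derive_eq (de x) _; rewrite /p; ring.
- have P1 : periodic1 (fun x => z x ^+ 2 * e x - (2 * C ^+ 2 * v x ^+ 2 - 2)) by move=> y; rewrite pz pe pv.
  apply/eqP; rewrite -subr_eq0; apply/eqP; apply: etrans (periodic1_frac x P1) _ => /=.
  have F := frac_itv01 x; rewrite -(vV _ F) (eE _ F); apply/eqP; rewrite subr_eq0; apply/eqP; exact: EI.
Qed.

Lemma EL_first_variation v e : EL_solution v e -> forall h, H1 h -> first_variation z f h = 0.
Proof.
move=> [dz dv de eI pe] h hh.
have cv : continuous v := continuous_derive dv; have ce : continuous e := continuous_derive de.
have [h2 ah] := H1_AC hh; have [ch _ _] := ah.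
have pv : periodic1 v := derive_periodic dz pz.
have av := C1_AC dz cv; have v2 := continuous_in_L2 cv.
have cp : continuous (fun x => f (time_change z x) * (2 * (z x * v x))).
  by apply: cts_mul => //; apply: cts_scale; exact: cts_mul.
have cz2 : continuous (fun x => z x ^+ 2) by exact: cts_exp.
have cvv : continuous (fun x => v x ^+ 2) by exact: cts_exp.
have [cW _ _] := work_AC hz cf.
have WE x : 0 <= x <= 1 -> work z f x = e x - e 0.
  move=> x01; have [_ _ ->] := work_eq av => //; rewrite work0 add0r.
  have ae : AC01 e (fun x => 2 * f (time_change z x) * z x * v x).
    by apply: C1_AC de _; apply: cts_mul => //; apply: cts_mul => //; exact: cts_scale.
  have [_ _ /(_ x x01) ->] := ae; rewrite [e 0 + _]addrC addrK.
  by apply: eq_itg => s _; ring.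
(* the mean of z^2 e = 2 C^2 v^2 - 2 fixes the additive constant of the energy *)
have EE x : 0 <= x <= 1 -> energy z f x = e x.
  move=> x01; rewrite /energy (WE x x01).
  have -> : itg 0 1 (fun s => work z f s * z s ^+ 2) = 2 * C ^+ 2 * sqnorm g - 2 - e 0 * C.
    rewrite (sqnorm_wderiv hz av) !sqnormE.
    rewrite (eq_itg (g := fun s => 2 * C ^+ 2 * v s ^+ 2 - 2 - e 0 * z s ^+ 2)); last first.
      by move=> s s01; rewrite WE// -eI; ring.
    rewrite itgB; [|apply: cI; apply: cts_sub; [exact: cts_scale|exact: cst_continuous]|exact/cI/cts_scale].
    rewrite itgB; [|exact/cI/cts_scale|apply: cI; exact: cst_continuous].
    by rewrite !itgZ; [|exact: cI|exact: cI]; rewrite itg_cst ?ler01// subr0 mulr1 -sqnormE.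
  by field; exact: n0.
rewrite (first_variation_AC av v2 hh ah).
rewrite (eq_itg (f := fun x => 2 / C * (energy z f x + f (time_change z x) * z x ^+ 2) * (z x * h x))
  (g := fun x => 4 * C * ((e x + f (time_change z x) * z x ^+ 2) / (2 * C ^+ 2) * z x * h x))); last first.
  by move=> x x01; rewrite EE//; field; exact: n0.
have cv' : continuous (fun x => (e x + f (time_change z x) * z x ^+ 2) / (2 * C ^+ 2) * z x).
  apply: cts_mul => //; apply: cts_mul; last exact: cst_continuous.
  by apply: cts_add => //; exact: cts_mul.
rewrite itgZ; last by apply/cI/cts_mul.
rewrite (itg_parts (C1_AC dv cv') ah) (periodic1_10 pv) (periodic1_10 (H1_periodic hh)).
ring.
Qed.

End EulerLagrange.

(** * Conservation of energy *)

Section WorkInTime.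
Variable R : realType.
Variables z f : R -> R.
Hypotheses (hz : H1 z) (z0 : 0 < sqnorm z) (cf : continuous f).
Implicit Types (a b c d e x y s t : R).
Local Notation C := (sqnorm z).
Local Notation g := (wderiv z).
Local Notation T := (time_change z).
Local Notation q := (levi_civita z).
Let cz : continuous z. Proof. exact: H1_continuous. Qed.
Let pz : periodic1 z. Proof. exact: H1_periodic. Qed.
Let g2 : in_L2 g. Proof. by have [] := H1_AC hz. Qed.
Let az : AC01 z g. Proof. by have [] := H1_AC hz. Qed.

(* W is the work as a function of time; M controls the increments of q and of W. *)
Lemma work_in_time : exists W M : R -> R,
  [/\ W 0 = 0, W 1 = work z f 1,
    forall s t, 0 <= s -> s <= t -> t <= 1 -> `|q t - q s| <= M t - M s &
    forall e, 0 < e -> exists2 d : R, 0 < d & forall s t, 0 <= s -> s <= t -> t <= 1 -> t - s < d ->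
      `|W t - W s - f s * (q t - q s)| <= e * (M t - M s)].
Proof.
have cT : continuous T by exact: time_change_continuous.
(* X picks an arbitrary preimage under t_z; the work does not depend on the choice, because z
   vanishes where t_z is flat. *)
have /choice[X XP] t : exists x, 0 <= t <= 1 -> 0 <= x <= 1 /\ T x = t.
  have [t01|nt] := boolP (0 <= t <= 1); last by exists 0 => //.
  by have [x x01 xt] := time_change_surj01 cz z0 t01; exists x.
have [cW Iw _] := work_AC hz cf; have aW := work_AC hz cf.
have I2 : integrable_on 0 1 (fun x => 2 * (z x * g x)).
  by apply: integrable_onZ; apply: integrable_onM => //; exact: in_L2_integrable.
have IA := integrable_on_norm I2.
have aq : AC01 (fun x => z x * z x) (fun x => 2 * (z x * g x)).
  apply: eq_AC (AC_mul az az) => //; first exact: cts_mul.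
  by move=> x _; ring.
(* The total variation of z^2 up to x, which becomes the control function M. *)
pose A x := itg 0 (clamp01 x) (fun x => `|2 * (z x * g x)|).
have aA : AC01 A (fun x => `|2 * (z x * g x)|).
  apply: eq_AC (AC_prim 0 IA) => // [|x _]; first exact: continuous_prim01.
  by rewrite add0r.
have flat x y : 0 <= x -> x <= y -> y <= 1 -> T x = T y -> work z f x = work z f y.
  move=> x0; rewrite le_eqVlt => /predU1P[->//|xy] y1 Txy; apply/eqP; rewrite eq_sym -subr_eq0.
  rewrite (AC_incr aW x0 (ltW xy) y1) (eq_itg (g := fun=> 0)).
    by rewrite itg_cst ?mul0r// ltW.
  move=> s sxy; rewrite /work_density (time_change_flat cz z0 Txy xy sxy); ring.
have flat' x y : 0 <= x <= 1 -> 0 <= y <= 1 -> T x = T y -> work z f x = work z f y.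
  move=> /andP[x0 x1] /andP[y0 y1] E; have [xy|/ltW yx] := leP x y; first exact: flat.
  by apply/esym/flat.
have order s t : 0 <= s -> s <= t -> t <= 1 -> [/\ 0 <= X s, X s <= X t, X t <= 1, T (X s) = s & T (X t) = t].
  move=> s0 st t1.
  have [/andP[a0 a1] aT] := XP s (introT andP (conj s0 (le_trans st t1))).
  have [/andP[b0 b1] bT] := XP t (introT andP (conj (le_trans s0 st) t1)).
  split=> //; have [->|ne] := eqVneq s t => //.
  rewrite leNgt; apply/negP => /ltW /(time_change_homo cz z0); rewrite aT bT.
  by move=> /(conj st)/andP/le_anti E; rewrite E eqxx in ne.
exists (work z f \o X), (A \o X); split.
- have [x01 E] := XP 0 (introT andP (conj (lexx 0) ler01)).
  rewrite /= (flat' (X 0) 0) ?work0// ?lexx ?ler01//.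
  by rewrite E time_change0.
- have [x01 E] := XP 1 (introT andP (conj ler01 (lexx 1))).
  rewrite /= (flat' (X 1) 1)// ?lexx ?ler01//.
  by rewrite E time_change1.
- move=> s t s0 st t1; have [a0 ab b1 Ta Tb] := order s t s0 st t1.
  rewrite /= (AC_incr aA a0 ab b1) -{1}Tb -{1}Ta !levi_civita_time_change// !expr2.
  rewrite (AC_incr aq a0 ab b1); apply: itg_norm; exact: integrable_onS I2.
- move=> e e0; have [d d0 dP] := @uniform_continuous_itv R f 0 1 cf _ e0.
  exists d => // s t s0 st t1 std; have [a0 ab b1 Ta Tb] := order s t s0 st t1.
  have Iq := integrable_onS a0 b1 I2; have IW := integrable_onS a0 b1 Iw.
  have IAq := integrable_onS a0 b1 IA.
  rewrite /= (AC_incr aA a0 ab b1) (AC_incr aW a0 ab b1).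
  have -> : q t - q s = itg (X s) (X t) (fun x => 2 * (z x * g x)).
    by rewrite -{1}Tb -{1}Ta !levi_civita_time_change// !expr2 (AC_incr aq a0 ab b1).
  rewrite -(itgZ _ Iq) -(itgB IW (integrable_onZ _ Iq)) -(itgZ _ IAq).
  apply: itg_norm_le; [exact/integrable_onB/integrable_onZ|exact: integrable_onZ|].
  move=> x /andP[ax xb]; rewrite /work_density -mulrBl normrM ler_wpM2r//.
  have L1 := time_change_homo cz z0 ax; have L2 := time_change_homo cz z0 xb.
  rewrite Ta in L1; rewrite Tb in L2.
  apply/ltW/dP; first by rewrite s0 (le_trans st).
  by rewrite ger0_norm ?subr_ge0//; apply: le_lt_trans std; rewrite lerD2r.
Qed.

Lemma workN x : work z (fun t => - f t) x = - work z f x.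
Proof.
have Iw : integrable_on 0 1 (work_density z f) := work_density_integrable hz cf.
have /andP[c0 c1] := clamp01_itv x.
rewrite /work -(itgN (integrable_onS (lexx 0) c1 Iw)); apply: eq_itg => y _.
by rewrite /work_density mulNr.
Qed.

End WorkInTime.

Section Conservation.
Variable R : realType.
Variables (r : R) (z : (R -> R) * (R -> R)).
Hypothesis zin : H1_in z.
Implicit Types (a b c d e x y s t : R).
Local Notation q1 := (levi_civita z.1).
Local Notation q2 := (levi_civita z.2).
Local Notation f := (force r z).

(** k is minus the derivative of r'/u - m u, so the increment of this potential cancels k (a - b) up
    to the term r' (v - u)^2 / (u^2 v) of second order. *)
Lemma potential_estimate (k m c r' u v a b w1 w2 D1 D2 e1 : R) : 0 < c -> c <= u -> c <= v ->
  v - u = a - b -> k = r' / u ^+ 2 + m -> 0 <= e1 ->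
  `|a| <= D1 -> `|b| <= D2 ->
  `|w1 - k * a| <= e1 * D1 -> `|w2 - k * b| <= e1 * D2 -> `|r'| * `|v - u| <= e1 * c ^+ 3 ->
  `|w1 - w2 + (r' / v - m * v - (r' / u - m * u))| <= 2 * e1 * (D1 + D2).
Proof.
move=> c0 cu cv vu kE e10 aD bD W1 W2 S.
have u0 : 0 < u by exact: lt_le_trans cu. have v0 : 0 < v by exact: lt_le_trans cv.
have E : w1 - w2 + (r' / v - m * v - (r' / u - m * u)) =
   (w1 - k * a) - (w2 - k * b) + r' * (v - u) * (v - u) / (u ^+ 2 * v).
  have -> : v - u = a - b by [].
  have -> : v = u + (a - b) by rewrite -vu; ring.
  rewrite kE; field; rewrite !lt0r_neq0//.
  by rewrite -vu addrC subrK.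
rewrite E.
have B3 : `|r' * (v - u) * (v - u) / (u ^+ 2 * v)| <= e1 * (D1 + D2).
  rewrite normrM normfV [`|u ^+ 2 * v|]gtr0_norm ?mulr_gt0 ?exprn_gt0//.
  rewrite ler_pdivrMr ?mulr_gt0 ?exprn_gt0// !normrM.
  have uv : `|v - u| <= D1 + D2 by rewrite vu; apply: le_trans (ler_normB _ _) _; exact: lerD.
  have D0 : 0 <= D1 + D2 := le_trans (normr_ge0 _) uv.
  apply: le_trans (ler_pM _ _ S uv) _; rewrite ?mulr_ge0//.
  rewrite [leRHS]mulrAC ler_wpM2r//.
  by rewrite ler_wpM2l// exprSr ler_pM ?exprn_ge0 ?(ltW c0)// lerXn2r// nnegrE ltW.
apply: le_trans (ler_normD _ _) _.
rewrite (_ : 2 * e1 * (D1 + D2) = e1 * D1 + e1 * D2 + e1 * (D1 + D2)); last by ring.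
by apply: lerD => //; apply: le_trans (ler_normB _ _) _; exact: lerD.
Qed.

(* f (q1' - q2') is the derivative of -r/(q1 - q2) + c (q1 - q2), so the two particles
   exchange no net energy over a period. *)
Lemma work_conservation : work z.1 f 1 = work z.2 f 1.
Proof.
have [[h1 h2] s1 s2 lt12] := (H1_inP z).1 zin.
have cf : continuous f by exact: force_continuous.
have [W1 [M1 [W10 W11 B1 A1]]] := work_in_time h1 s1 cf.
have [W2 [M2 [W20 W21 B2 A2]]] := work_in_time h2 s2 cf.
have c1 := levi_civita_continuous (H1_continuous h1) (H1_periodic h1) s1.
have c2 := levi_civita_continuous (H1_continuous h2) (H1_periodic h2) s2.
have p1 := levi_civita_periodic (H1_continuous h1) (H1_periodic h1) s1.
have p2 := levi_civita_periodic (H1_continuous h2) (H1_periodic h2) s2.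
have [c c0 cP] := levi_civita_gap zin.
pose m := (1 - r) / (itg 0 1 q1 - itg 0 1 q2) ^+ 2.
pose u t := q1 t - q2 t.
have cu : continuous u by exact: cts_sub.
pose Phi t := W1 t - W2 t + (r / u t - m * u t).
have : Phi 1 = Phi 0.
  apply: (@negligible_increments R Phi (fun t => M1 t + M2 t) 0 1 ler01) => e e0.
  pose e1 := e / 2; have e10 : 0 < e1 by rewrite divr_gt0.
  have [d1 d10 P1] := A1 _ e10; have [d2 d20 P2] := A2 _ e10.
  (* Chosen so that |r| |u t - u s| <= e1 c^3, as [potential_estimate] requires; the 1 keeps the
     denominator positive. *)
  pose e3 := e1 * c ^+ 3 / (`|r| + 1).
  have r1 : 0 < `|r| + 1 by rewrite ltr_wpDl.
  have e30 : 0 < e3 by rewrite divr_gt0// mulr_gt0// exprn_gt0.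
  have [d3 d30 P3] := @uniform_continuous_itv R u 0 1 cu _ e30.
  exists (Num.min d1 (Num.min d2 d3)); first by rewrite !lt_min d10 d20 d30.
  move=> s t s0 st t1; rewrite !lt_min => /and3P[l1 l2 l3].
  have -> : Phi t - Phi s = (W1 t - W1 s) - (W2 t - W2 s) + (r / u t - m * u t - (r / u s - m * u s)).
    by rewrite /Phi; ring.
  have -> : M1 t + M2 t - (M1 s + M2 s) = (M1 t - M1 s) + (M2 t - M2 s) by ring.
  have -> : e = 2 * e1 by rewrite /e1; field.
  apply: (potential_estimate (k := f s) (c := c) (a := q1 t - q1 s) (b := q2 t - q2 s)) => //.
  - exact: cP.
  - exact: cP.
  - by rewrite /u; ring.
  - exact: ltW.
  - exact: B1.
  - exact: B2.
  - exact: P1.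
  - exact: P2.
  have tsd : `|t - s| < d3 by rewrite ger0_norm ?subr_ge0.
  have st1 : 0 <= s <= 1 by rewrite s0 (le_trans st).
  have := ltW (P3 s t st1 tsd); rewrite /e3 ler_pdivlMr// => H.
  by apply: le_trans H; rewrite mulrC ler_wpM2l// lerDl.
have u10 : u 1 = u 0 by rewrite /u (periodic1_10 p1) (periodic1_10 p2).
rewrite /Phi u10 W10 W20 W11 W21 subr0 => /addIr/eqP.
by rewrite subr_eq0 => /eqP.
Qed.

(* z.1 cannot vanish at 0, where its square exceeds that of z.2. *)
Lemma critical_EL : critical_point (@H1_in R) (B_r r) z <->
  (exists v1 : R -> R, exists e1 : R -> R, EL_solution z.1 f v1 e1) /\
  (exists v2 : R -> R, exists e2 : R -> R, EL_solution z.2 (fun t => - f t) v2 e2).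
Proof.
have [[h1 h2] s1 s2 lt12] := (H1_inP z).1 zin.
have cf : continuous f by exact: force_continuous.
have cNf : continuous (fun t => - f t) by exact: cts_opp.
have pf : periodic1 f.
  move=> t; rewrite /force !levi_civita_periodic//; exact: H1_continuous || exact: H1_periodic.
have pNf : periodic1 (fun t => - f t) by move=> t; rewrite pf.
split=> [/critical_pointP[_ st1 st2]|[[v1 [e1 S1]] [v2 [e2 S2]]]].
  have z10 : z.1 0 != 0.
    rewrite -sqrf_eq0 -(levi_civita_time_change (H1_continuous h1) (H1_periodic h1) s1) lt0r_neq0//.
    by apply: le_lt_trans (lt12 _); exact: levi_civita_ge0.
  have w1 := stationary_work h1 s1 cf st1 z10.
  split; first exact: (stationary_EL h1 s1 cf pf st1 w1).
  apply: (stationary_EL h2 s2 cNf pNf st2).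
  by rewrite workN// -work_conservation w1 oppr0.
apply/critical_pointP; split=> // k hk.
- exact: (EL_first_variation h1 s1 cf S1).
- exact: (EL_first_variation h2 s2 cNf S2).
Qed.

End Conservation.

(** * Simple zeros *)

Section RealFunctions.
Variable R : realType.
Implicit Types (f h k u w : R -> R) (a b c d e x y s t : R).

(** The mean value theorem between x and y uses the derivative at interior points only, which avoid
    x; the intermediate value of k is then close to k x. *)
Lemma removable_derivative h k x d : 0 < d -> (forall y : R, `|y - x| < d -> y != x -> is_derive y 1 h (k y)) ->
  {for x, continuous h} -> {for x, continuous k} -> is_derive x 1 h (k x).
Proof.
move=> d0 dh ch ck; apply/is_deriveP => e e0.
have [d1 d10 P1] := (continuous_atP _ _).1 ck _ e0.
pose m := Num.min d d1; have m0 : 0 < m by rewrite lt_min d0.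
exists m => // y; rewrite lt_min => /andP[yd yd1].
have cont s : `|s - x| <= `|y - x| -> {for s, continuous h}.
  move=> sy; have [->//|sx] := eqVneq s x.
  by apply: is_derive_continuous (dh s _ sx); exact: le_lt_trans yd.
have fin c : `|c - x| <= `|y - x| -> h y - h x = k c * (y - x) -> `|h y - h x - k x * (y - x)| <= e * `|y - x|.
  move=> cy ->; rewrite -mulrBl normrM ler_wpM2r//; apply/ltW/P1; exact: le_lt_trans yd1.
have [xy|yx|->] := ltgtP x y; last first.
- by rewrite !subrr mulr0 subrr normr0 mulr0.
- have [c cyx E] : exists2 c, y <= c <= x & h x - h y = k c * (x - y).
    apply: MVT_le (ltW yx) _ _ => s /andP[ys sx].
      apply: dh; last by rewrite lt_eqF.
      by apply: le_lt_trans yd; rewrite !ltr0_norm ?subr_lt0// lerN2 lerD2r ltW.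
    by apply: cont; rewrite !ler0_norm ?subr_le0 ?(ltW yx)// lerN2 lerD2r.
  have [yc cx] := andP cyx; apply: (fin c).
    by rewrite !ler0_norm ?subr_le0 ?(ltW yx)// lerN2 lerD2r.
  by rewrite -opprB E; ring.
- have [c cyx E] : exists2 c, x <= c <= y & h y - h x = k c * (y - x).
    apply: MVT_le (ltW xy) _ _ => s /andP[xs sy].
      apply: dh; last by rewrite gt_eqF.
      by apply: le_lt_trans yd; rewrite !gtr0_norm ?subr_gt0// lerD2r ltW.
    by apply: cont; rewrite !ger0_norm ?subr_ge0 ?(ltW xy)// lerD2r.
  have [yc cx] := andP cyx; apply: (fin c) => //.
  by rewrite !ger0_norm ?subr_ge0 ?(ltW xy)// lerD2r.
Qed.

(** A maximum of h on [x, y] cannot be attained before y, since h increases just to the right of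
    every point. *)
Lemma locally_increasing h : continuous h ->
  (forall x, exists2 d : R, 0 < d & forall y, x < y -> y < x + d -> h x < h y) ->
  forall x y, x < y -> h x < h y.
Proof.
move=> ch loc x y xy.
have N c t : c < t -> (forall s, c <= s <= t -> h s <= h c) -> False.
  move=> ct mc; have [d d0 dP] := loc c.
  pose s := Num.min t (c + d / 2).
  have cs : c < s by rewrite lt_min ct ltrDl divr_gt0.
  have sd : s < c + d.
    by rewrite gt_min; apply/orP; right; rewrite ltrD2l ltr_pdivrMr// ltr_pMr// ltr1n.
  have := dP s cs sd; rewrite ltNge mc// ltW//= ge_min lexx//.
have [c] := EVT_max (ltW xy) (continuous_within ch (a := x) (b := y)).
rewrite in_itv/= => /andP[xc]; rewrite le_eqVlt => /predU1P[-> |cy] mc.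
  have hxy : h x <= h y by apply: mc; rewrite in_itv/= lexx ltW.
  rewrite lt_neqAle hxy andbT; apply/negP => /eqP E.
  by apply: (N x y xy) => s sxy; rewrite E; apply: mc; rewrite in_itv.
exfalso; apply: (N c y cy) => s /andP[cs sy]; apply: mc.
by rewrite in_itv/= sy (le_trans xc).
Qed.

Lemma circle_homeo h : continuous h -> (forall x y, x < y -> h x < h y) -> h 0 = 0 ->
  (forall x, h (x + 1) = h x + 1) ->
  exists X : R -> R, [/\ cancel h X, cancel X h, continuous X, X 0 = 0 & forall x, X (x + 1) = X x + 1].
Proof.
move=> ch ih h0 h1.
have hn (n : nat) x : h (x + n%:R) = h x + n%:R.
  by elim: n x => [|n IH] x; rewrite ?addr0// -natr1 !addrA h1 IH.
have hz (n : int) x : h (x + n%:~R) = h x + n%:~R.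
  case: n => n; first exact: hn.
  rewrite NegzE mulrNz; apply/eqP; rewrite -(subr_eq _ _) opprK eq_sym; apply/eqP.
  by apply: etrans (hn n.+1 _); rewrite subrK.
have /choice[X XP] t : exists x, h x = t.
  have [|x _ E] := @IVT R h 0 1 (t - (Num.floor t)%:~R) ler01 (continuous_within ch).
    rewrite -[1]add0r h1 h0 add0r min_l ?ler01// max_r ?ler01//; exact: frac_itv01.
  by exists (x + (Num.floor t)%:~R); rewrite hz E subrK.
have mono x y : (h x < h y) = (x < y).
  have [/ih->//|yx|->] := ltgtP x y; last by rewrite ltxx.
  by apply/negbTE; rewrite -leNgt ltW// ih.
have K : cancel h X.
  by move=> x; have [||//] := ltgtP (X (h x)) x => /ih; rewrite XP ltxx.
exists X; split=> // [t||x].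
- apply/continuous_atP => e e0.
  have l1 : h (X t - e) < t by rewrite -{2}(XP t) mono ltrBlDr ltrDl.
  have l2 : t < h (X t + e) by rewrite -{1}(XP t) mono ltrDl.
  exists (Num.min (t - h (X t - e)) (h (X t + e) - t)); first by rewrite lt_min !subr_gt0 l1.
  move=> s; rewrite lt_min !ltr_norml => /andP[/andP[a1 a2] /andP[a3 a4]].
  have b1 : X t - e < X s by rewrite -mono XP; move: a1; lra.
  have b2 : X s < X t + e by rewrite -mono XP; move: a4; lra.
  by apply/andP; split; lra.
- by rewrite -{1}h0 K.
- by apply: (can_inj K); rewrite XP h1 XP.
Qed.

Section SimpleZeros.
Variables u u' : R -> R.
Hypotheses (du : forall x : R, is_derive x 1 u (u' x)) (su : forall x, u x = 0 -> u' x != 0).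

Lemma simple_zero_sign x : u x = 0 -> exists2 d : R, 0 < d &
  forall y, `|y - x| < d -> y != x -> 0 < u y * (u' x * (y - x)).
Proof.
move=> ux; have a0 := su ux; have n0 : 0 < `|u' x| / 2 by rewrite divr_gt0// normr_gt0.
have [d d0 dP] := (is_deriveP _ _ _).1 (du x) _ n0.
exists d => // y yd yx; have := dP y yd; rewrite ux subr0.
set A := u' x * (y - x) => H.
have A0 : A != 0 by rewrite mulf_neq0// subr_eq0.
have {}H : `|u y - A| <= `|A| / 2 by rewrite /A normrM mulrAC.
have A2 : 0 < `|A| by rewrite normr_gt0.
have [p|p|p] := ltgtP A 0; [|..|by rewrite p eqxx in A0].
- have E : `|A| = - A by rewrite ltr0_norm.
  by rewrite nmulr_lgt0//; move: H; rewrite E ler_norml => /andP[_ H]; lra.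
- have E : `|A| = A by rewrite gtr0_norm.
  by rewrite pmulr_lgt0//; move: H; rewrite E ler_norml => /andP[H _]; lra.
Qed.

Lemma isolated_zero x : exists2 d : R, 0 < d & forall y, `|y - x| < d -> y != x -> u y != 0.
Proof.
have [ux|ux] := eqVneq (u x) 0.
  have [d d0 dP] := simple_zero_sign ux; exists d => // y yd yx.
  by apply/eqP => uy; have := dP y yd yx; rewrite uy mul0r ltxx.
have cu := continuous_derive du.
have nx : 0 < `|u x| by rewrite normr_gt0.
have [d d0 dP] := (continuous_atP _ _).1 (cu x) _ nx.
exists d => // y yd _; apply/eqP => uy; have := dP y yd.
by rewrite uy sub0r normrN ltxx.
Qed.

Lemma isolated_zero_right x : exists2 d : R, 0 < d & forall y, x < y -> y < x + d -> u y != 0.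
Proof.
have [d d0 dP] := isolated_zero x; exists d => // y xy yd; apply: dP; last by rewrite gt_eqF.
by rewrite gtr0_norm ?subr_gt0// ltrBlDl.
Qed.

(** Zeros of u are isolated, so h has a positive derivative just to the right of every point, zeros
    included. *)
Lemma increasing_off_zeros h k : continuous h -> (forall x, u x != 0 -> 0 < k x) ->
  (forall x : R, u x != 0 -> is_derive x 1 h (k x)) -> forall x y, x < y -> h x < h y.
Proof.
move=> ch kp dh; apply: locally_increasing => // x.
have [d d0 dP] := isolated_zero_right x; exists d => // y xy yd.
have [s /andP[xs sy] E] : exists2 s, s \in `]x, y[ & h y - h x = k s * (y - x).
  apply: MVT => // [s|]; last exact: continuous_within.
  by rewrite in_itv/= => /andP[xs sy]; apply/dh/dP => //; exact: lt_trans yd.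
rewrite -subr_gt0 E mulr_gt0 ?subr_gt0//; apply/kp/dP; first by rewrite bnd_simp in xs.
by apply: lt_trans yd; rewrite bnd_simp in sy.
Qed.

Lemma derive_off_zeros h k : continuous h -> continuous k ->
  (forall x : R, u x != 0 -> is_derive x 1 h (k x)) -> forall x : R, is_derive x 1 h (k x).
Proof.
move=> ch ck dh x; have [d d0 dP] := isolated_zero x.
by apply: removable_derivative d0 _ (ch x) (ck x) => y yd yx; apply: dh; exact: dP.
Qed.

End SimpleZeros.

(* Extended by u'/w' at the common zeros, u/w is continuous without zeros. *)
Lemma simple_zero_ratio u u' w w' :
  (forall x : R, is_derive x 1 u (u' x)) -> (forall x, u x = 0 -> u' x != 0) ->
  (forall x : R, is_derive x 1 w (w' x)) -> (forall x, w x = 0 -> w' x != 0) ->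
  (forall x, (u x == 0) = (w x == 0)) ->
  (forall x, 0 <= u x * w x) \/ (forall x, u x * w x <= 0).
Proof.
move=> du su dw sw uw.
pose p x := if w x == 0 then u' x / w' x else u x / w x.
have cu := continuous_derive du; have cw := continuous_derive dw.
have p0 x : p x != 0.
  rewrite /p; case: ifPn => [/eqP wx|wx]; rewrite mulf_neq0 ?invr_eq0 ?sw ?uw//.
  by apply: su; apply/eqP; rewrite uw wx.
have cp : continuous p.
  move=> x; have [wx|wx] := eqVneq (w x) 0; last first.
    have cx : {for x, continuous (fun y => u y / w y)} by apply: cvgM; [exact: cu|apply: cvgV => //; exact: cw].
    rewrite /continuous_at /p (negbTE wx); apply: cvg_trans cx; apply: near_eq_cvg.
    have [d d0 dP] := isolated_zero dw sw x.
    apply/nbhs_ballP; exists d => //= y; rewrite /ball/= distrC => yd.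
    have [->|yx] := eqVneq y x; first by rewrite (negbTE wx).
    by rewrite (negbTE (dP y yd yx)).
  have ux : u x = 0 by apply/eqP; rewrite uw wx.
  have [gu [guE cgu gu0]] := (is_derive1_caratheodory _ _ _).1 (du x).
  have [gw [gwE cgw gw0]] := (is_derive1_caratheodory _ _ _).1 (dw x).
  have gx : gw x != 0 by rewrite gw0 sw.
  have cx : {for x, continuous (fun y => gu y / gw y)} by apply: cvgM => //; apply: cvgV.
  rewrite /continuous_at /p wx eqxx -gu0 -gw0; apply: cvg_trans cx; apply: near_eq_cvg.
  have [d d0 dP] := isolated_zero dw sw x.
  apply/nbhs_ballP; exists d => //= y; rewrite /ball/= distrC => yd.
  have [->|yx] := eqVneq y x; first by rewrite wx eqxx gu0 gw0.
  have wy := dP y yd yx; rewrite (negbTE wy).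
  have := guE y; have := gwE y; rewrite ux wx !subr0 => E1 E2.
  have yx0 : y - x != 0 by rewrite subr_eq0.
  have gy : gw y != 0 by apply: contraNneq wy => gy; rewrite E1 gy mul0r.
  by rewrite E1 E2 -mulf_div divff// mulr1.
have sgn x y : 0 < p x -> 0 < p y.
  move=> px; rewrite lt_neqAle eq_sym p0/= leNgt; apply/negP => py.
  have [xy|/ltW yx] := leP x y.
    have [|c _ pc] := IVT (v := 0) xy (continuous_within cp); last by have := p0 c; rewrite pc eqxx.
    by rewrite min_r ?max_l ?(ltW py) ?(ltW px)//; exact: ltW (lt_trans py px).
  have [|c _ pc] := IVT (v := 0) yx (continuous_within cp); last by have := p0 c; rewrite pc eqxx.
  by rewrite min_l ?max_r ?(ltW py) ?(ltW px)//; exact: ltW (lt_trans py px).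
have uwp x : w x != 0 -> u x * w x = p x * w x ^+ 2.
  by move=> wx; rewrite /p (negbTE wx); field.
have [p00|p00] := ltP 0 (p 0).
  left=> x; have [->|wx] := eqVneq (w x) 0; first by rewrite mulr0.
  by rewrite uwp// mulr_ge0 ?sqr_ge0// ltW// (sgn 0).
right=> x; have [->|wx] := eqVneq (w x) 0; first by rewrite mulr0.
rewrite uwp// mulr_le0_ge0 ?sqr_ge0// leNgt; apply/negP => /(sgn x 0).
by rewrite ltNge p00.
Qed.

End RealFunctions.

(** * Smooth functions with prescribed simple zeros on the circle *)

Section SineProduct.
Variable R : realType.
Implicit Types (a : nat -> R) (n i j : nat) (x y t : R).

Lemma sin_pi_int (k : int) (x : R) : sin (pi * (x + k%:~R)) = 0 <-> sin (pi * x) = 0.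
Proof.
have N (n : nat) y : (sin (pi * (y + n%:R)) == 0 :> R) = (sin (pi * y) == 0).
  elim: n y => [|n IH] y; first by rewrite addr0.
  rewrite -natr1 addrA mulrDr mulr1 sinDpi oppr_eq0; exact: IH.
case: k => k; first by split=> /eqP H; apply/eqP; move: H; rewrite N.
have E := N k.+1 (x + (Negz k)%:~R); rewrite NegzE mulrNz in E *; rewrite subrK in E.
by split=> /eqP H; apply/eqP; rewrite -?E// E.
Qed.

Lemma sin_pi_eq0 x : sin (pi * x) = 0 <-> exists k : int, x = k%:~R.
Proof.
split=> [|[k ->]]; last first.
  by rewrite -[k%:~R]add0r; apply/sin_pi_int; rewrite mulr0 sin0.
rewrite -{1}[x](subrK (Num.floor x)%:~R) => /sin_pi_int.
have /andP[x0 _] := frac_itv01 x; move: x0; rewrite le_eqVlt => /predU1P[E _|x0].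
  by exists (Num.floor x); apply/eqP; rewrite -subr_eq0 -E.
have x1 : x - (Num.floor x)%:~R < 1.
  by have /andP[_] := floor_itv x; rewrite intrD ltrBlDl.
have /lt0r_neq0/eqP : 0 < sin (pi * (x - (Num.floor x)%:~R)) => //.
by apply: sin_gt0_pi; rewrite mulr_gt0 ?pi_gt0//= -[ltRHS]mulr1 ltr_pM2l ?pi_gt0.
Qed.

(** Each factor vanishes simply at a_i modulo 1 and changes sign under x -> x + 1. The product is
    thus periodic or antiperiodic according to the parity of n, which is how the parity of a zero
    set is detected. *)
Fixpoint sine_prod a n x : R := if n is m.+1 then sine_prod a m x * sin (pi * (x - a m)) else 1.

Lemma sine_prod_derive a n x : exists b : R, is_derive x 1 (sine_prod a n) b.
Proof.
elim: n => [|n [b db]]; first by exists 0; exact: is_derive_cst.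
have d1 : is_derive x 1 (fun y => pi * (y - a n)) pi.
  by apply: is_derive_eq (derZ pi (derB (is_derive_id x 1) (is_derive_cst (a n) x 1))) _; rewrite subr0 mulr1.
by exists (b * sin (pi * (x - a n)) + sine_prod a n x * (cos (pi * (x - a n)) * pi)); apply: derM => //; apply: der_comp d1.
Qed.

Lemma is_derive_sine_prod a n x : is_derive x 1 (sine_prod a n) (derive1 (sine_prod a n) x).
Proof. by have [b db] := sine_prod_derive a n x; rewrite (derive1_val db). Qed.

Lemma sine_prod_shift a n x : sine_prod a n (x + 1) = (-1) ^+ n * sine_prod a n x.
Proof.
elim: n => [|n IH] /=; first by rewrite mulr1.
rewrite IH (_ : pi * (x + 1 - a n) = pi * (x - a n) + pi); last by ring.
by rewrite sinDpi exprS; ring.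
Qed.

Lemma sine_prod_simple a n : (forall i, (i < n)%N -> 0 <= a i < 1) ->
  (forall i j, (i < n)%N -> (j < n)%N -> a i = a j -> i = j) ->
  forall x, (sine_prod a n x = 0 <-> exists2 i, (i < n)%N & exists k : int, x = a i + k%:~R) /\
    (sine_prod a n x = 0 -> derive1 (sine_prod a n) x != 0).
Proof.
elim: n => [|n IH] a01 ainj x.
  by split; [split=> [/eqP|[]//]; rewrite oner_eq0|move=> /eqP; rewrite oner_eq0].
have [|i j im jm|Z D] := IH _ _ x; [by move=> i im; apply: a01; exact: ltnW|by apply: ainj; exact: ltnW|].
have zE : sin (pi * (x - a n)) = 0 <-> exists k : int, x = a n + k%:~R.
  split=> [/sin_pi_eq0[k E]|[k E]]; first by exists k; rewrite -E addrC subrK.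
  by apply/sin_pi_eq0; exists k; rewrite E addrC addKr.
(* Distinct points of [0, 1[ do not differ by an integer, so the last factor never vanishes together
   with the others. *)
have excl : sine_prod a n x = 0 -> sin (pi * (x - a n)) = 0 -> False.
  move=> /Z[i im [k E]] /zE[l]; rewrite E => /eqP; rewrite -subr_eq eq_sym => /eqP H.
  have [/andP[i0 i1] /andP[n0 n1]] := (a01 i (ltnW im), a01 n (ltnSn n)).
  have kl : a n - a i = (k - l)%:~R by rewrite intrB; move: H; lra.
  have : (k - l)%:~R < 1%:~R :> R by rewrite -kl; lra.
  have : (-1)%:~R < (k - l)%:~R :> R by rewrite -kl; lra.
  rewrite !ltr_int ltrNl -[X in _ < X]add0r ltzD1 oppr_le0 => l1.
  rewrite -[X in _ < X]add0r ltzD1 => l2.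
  have E0 : k - l = 0 by apply/eqP; rewrite eq_le l1 l2.
  rewrite E0 in kl; have /esym/(ainj _ _ (ltnW im) (ltnSn n)) E1 : a n = a i by move: kl; lra.
  by rewrite E1 ltnn in im.
have dS := is_derive_sine_prod a n x.
have d1 : is_derive x 1 (fun y => pi * (y - a n)) pi.
  by apply: is_derive_eq (derZ pi (derB (is_derive_id x 1) (is_derive_cst (a n) x 1))) _; rewrite subr0 mulr1.
have dn : is_derive x 1 (sine_prod a n.+1) (derive1 (sine_prod a n) x * sin (pi * (x - a n)) + sine_prod a n x * (cos (pi * (x - a n)) * pi)).
  by apply: derM => //; apply: der_comp d1.
split.
  rewrite /=; split=> [/eqP|[i]].
    rewrite mulf_eq0 => /orP[/eqP/Z[i im H]|/eqP/zE H]; first by exists i => //; exact: ltnW.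
    by exists n.
  rewrite ltnS leq_eqVlt => /predU1P[->|im] H; first by rewrite (zE.2 H) mulr0.
  by rewrite (Z.2 _) ?mul0r//; exists i.
rewrite (derive1_val dn) /= => /eqP; rewrite mulf_eq0 => /orP[/eqP S0|/eqP s0].
  rewrite S0 mul0r addr0 mulf_neq0 ?D//; apply/eqP; exact: excl.
rewrite s0 mulr0 add0r mulf_neq0//; first by apply/eqP => S0; exact: excl.
by rewrite mulf_neq0 ?(lt0r_neq0 (pi_gt0 R))// -normr_gt0 sin0cos1.
Qed.

End SineProduct.

Section ZeroCount.
Variable R : realType.
Implicit Types (u q : R -> R).

(** q need not be differentiable at its zeros; the sine product has the same zeros, all simple, and
    lends q the arguments about isolated zeros. *)
Lemma zero_set_enum q n : periodic1 q -> (zero_set q #= `I_n)%card ->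
  exists a : nat -> R, forall x,
    [/\ sine_prod a n x = 0 <-> q x = 0, sine_prod a n x = 0 -> derive1 (sine_prod a n) x != 0
      & is_derive x 1 (sine_prod a n) (derive1 (sine_prod a n) x)].
Proof.
move=> pq; rewrite card_eq_sym => /card_set_bijP[a [fa ia sa]]; exists a => x.
have [|i j im jm|Z D] := @sine_prod_simple R a n _ _ x.
- by move=> i im; have [] := fa i im.
- by apply: ia; rewrite inE.
split=> //; last exact: is_derive_sine_prod.
rewrite Z; split=> [[i im [k ->]]|qx].
  by rewrite periodic1_int//; have [] := fa i im.
have [|i im E] := sa (x - (Num.floor x)%:~R).
  split; last by rewrite -periodic1_frac.
  have /andP[-> _] := frac_itv01 x => /=.
  by have /andP[_] := floor_itv x; rewrite intrD ltrBlDl.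
by exists i => //; exists (Num.floor x); rewrite E subrK.
Qed.

(** Between two zeros u' vanishes, by Rolle, while |u'| >= m at the zeros themselves. Uniform
    continuity of u' therefore keeps zeros at least d apart. *)
Lemma simple_zeros_finite u u' : (forall x : R, is_derive x 1 u (u' x)) -> continuous u' ->
  (exists2 m : R, 0 < m & forall x, u x = 0 -> m <= `|u' x|) -> finite_set (zero_set u).
Proof.
move=> du cu' [m m0 mP]; have [d d0 dP] := @uniform_continuous_itv R u' 0 1 cu' _ m0.
have sep x y : zero_set u x -> zero_set u y -> x < y -> d <= y - x.
  move=> [/andP[x0 x1] ux] [/andP[y0 y1] uy] xy; rewrite leNgt; apply/negP => yd.
  have [c /andP[xc cy] E] := MVT_le (ltW xy) (fun s _ => du s) (fun s _ => continuous_derive du (x := s)).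
  have c0 : u' c = 0.
    by move/eqP: E; rewrite ux uy subrr eq_sym mulf_eq0 subr_eq0 [y == x]gt_eqF// orbF => /eqP.
  have x01 : 0 <= x <= 1 by rewrite x0 ltW.
  have cd : `|c - x| < d by rewrite ger0_norm ?subr_ge0//; apply: le_lt_trans yd; rewrite lerD2r.
  by have := dP x c x01 cd; rewrite c0 sub0r normrN ltNge mP.
(* Each cell [k d, (k + 1) d[ contains at most one zero; F k is that zero, if it exists. *)
pose F (k : nat) := xget 0 [set x | zero_set u x /\ Num.truncn (x / d) = k].
apply: (@sub_finite_set _ _ (F @` `I_(Num.truncn d^-1).+1)); last exact/finite_image/finite_II.
move=> x zx; have [/andP[x0 x1] ux] := zx.
have xd : 0 <= x / d by rewrite divr_ge0// ltW.
exists (Num.truncn (x / d)).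
  by rewrite /= ltnS; apply: le_truncn; rewrite ler_piMl ?invr_ge0 ?(ltW d0)// ltW.
rewrite /F; case: xgetP => [y _ [zy E]|/(_ x)[]//].
have [/andP[y0 y1] uy] := zy.
have yd : 0 <= y / d by rewrite divr_ge0// ltW.
have /andP[a1 a2] := truncn_itv xd; have /andP[b1 b2] := truncn_itv yd.
rewrite E in b1 b2.
have W s t : s / d < (Num.truncn (x / d)).+1%:R -> (Num.truncn (x / d))%:R <= t / d -> s - t < d.
  rewrite -natr1 => A B; have : (s - t) / d < 1 by rewrite mulrBl; lra.
  by rewrite ltr_pdivrMr// mul1r.
have [xy|yx|//] := ltgtP x y.
- by have := sep x y zx zy xy; rewrite leNgt W.
- by have := sep y x zy zx yx; rewrite leNgt W.
Qed.

(* u / sine_prod has constant sign, and sine_prod picks up the sign (-1)^n over a period. *)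
Lemma simple_zeros_even u u' : periodic1 u -> (forall x : R, is_derive x 1 u (u' x)) -> continuous u' ->
  (exists2 m : R, 0 < m & forall x, u x = 0 -> m <= `|u' x|) ->
  even_zero_set u.
Proof.
move=> pu du cu' mu; have [m m0 mP] := mu.
have su x : u x = 0 -> u' x != 0 by move=> /mP H; rewrite -normr_gt0; exact: lt_le_trans H.
have /finite_setP[n nE] := simple_zeros_finite du cu' mu.
have [a aP] := zero_set_enum pu nE; pose S := sine_prod a n.
have dS (x : R) : is_derive x 1 S (derive1 S x) by have [] := aP x.
have sS x : S x = 0 -> derive1 S x != 0 by have [] := aP x.
have uS x : (u x == 0) = (S x == 0) by have [[A B] _ _] := aP x; apply/eqP/eqP.
have on : odd n = false.
  have [x ux] : exists x, u x != 0.
    have [d d0 dP] := isolated_zero du su 0; exists (d / 2); apply: dP.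
      by rewrite subr0 gtr0_norm ?divr_gt0// ltr_pdivrMr// ltr_pMr// ltr1n.
    by rewrite lt0r_neq0// divr_gt0.
  have uSx : u x * S x != 0 by rewrite mulf_neq0// -uS.
  apply/negP => on; have sh : u (x + 1) * S (x + 1) = - (u x * S x).
    by rewrite pu /S sine_prod_shift -signr_odd on expr1; ring.
  have [H|H] := simple_zero_ratio du su dS sS uS.
    have := H (x + 1); rewrite sh oppr_ge0 => H'; case/negP: uSx.
    by rewrite eq_le H' H.
  have := H (x + 1); rewrite sh oppr_le0 => H'; case/negP: uSx.
  by rewrite eq_le H' H.
by exists n./2; rewrite (_ : n./2.*2 = n)//; move: (odd_double_half n); rewrite on add0n.
Qed.

End ZeroCount.

(** * From critical points to generalized solutions *)

(** Used with P = |p| and i = 1/(q + d^2): the error of replacing p = W/q by W/(q + d^2) is at most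
    d times an expression with bounded integral. *)
Lemma regularization_amgm (R : realFieldType) (P d i : R) : 0 < d -> 0 < i -> d ^+ 2 * i <= 1 ->
  P * (d ^+ 2 * i) <= d / 2 * (P ^+ 2 + i).
Proof.
move=> d0 i0 i1; rewrite -subr_ge0.
have -> : d / 2 * (P ^+ 2 + i) - P * (d ^+ 2 * i) =
    d / 2 * ((P - d * i) ^+ 2 + i * (1 - d ^+ 2 * i)) by field.
by rewrite mulr_ge0 ?divr_ge0 ?(ltW d0)// addr_ge0 ?sqr_ge0// mulr_ge0 ?subr_ge0// ltW.
Qed.

(** From 2 |Z| d <= Z^2 + d^2. With Z = z x it bounds the error of the same regularization after the
    pullback to tau. *)
Lemma regularization_le (R : realFieldType) (Z d : R) : 0 < d ->
  `|2 * Z * d ^+ 2 / (Z ^+ 2 + d ^+ 2)| <= d.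
Proof.
move=> d0; have zd : 0 < Z ^+ 2 + d ^+ 2 by rewrite ltr_wpDl ?sqr_ge0// exprn_gt0.
have -> : 2 * Z * d ^+ 2 / (Z ^+ 2 + d ^+ 2) = (2 * d ^+ 2 / (Z ^+ 2 + d ^+ 2)) * Z by ring.
rewrite normrM ger0_norm; last by rewrite divr_ge0 ?(ltW zd)// mulr_ge0// ltW// exprn_gt0.
rewrite mulrAC ler_pdivrMr// -[Z ^+ 2]real_normK ?num_real// -subr_ge0.
have -> : d * (`|Z| ^+ 2 + d ^+ 2) - 2 * d ^+ 2 * `|Z| = d * (`|Z| - d) ^+ 2 by ring.
by rewrite mulr_ge0 ?sqr_ge0// ltW.
Qed.

Section Forward.
Variable R : realType.
Variables z f v e : R -> R.
Hypotheses (hz : H1 z) (z0 : 0 < sqnorm z) (cf : continuous f).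
Hypothesis S : EL_solution z f v e.
Implicit Types (k : R -> R) (a b c d x y s t : R).
Local Notation C := (sqnorm z).
Local Notation T := (time_change z).
Local Notation q := (levi_civita z).
Local Notation X := (inv_time_change z).
Let cz : continuous z. Proof. exact: H1_continuous. Qed.
Let pz : periodic1 z. Proof. exact: H1_periodic. Qed.
Let n0 : C != 0. Proof. exact: lt0r_neq0. Qed.
Let cT : continuous T. Proof. exact: time_change_continuous. Qed.
Let cv : continuous v. Proof. exact: continuous_derive (EL_v S). Qed.
Let ce : continuous e. Proof. exact: continuous_derive (EL_e S). Qed.
Let cq : continuous q. Proof. exact: levi_civita_continuous. Qed.
Let q0 t : 0 <= q t. Proof. exact: levi_civita_ge0. Qed.

(** The exact slope provides the uniform lower bound 1 / C that [simple_zeros_finite] asks for. *)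
Lemma EL_simple_zero x : z x = 0 -> C * `|v x| = 1.
Proof.
move=> zx; have := EL_energy S x; rewrite zx expr0n mul0r => /esym/eqP.
rewrite subr_eq0 => /eqP H; have {}H : (C * `|v x|) ^+ 2 = 1.
  by rewrite exprMn real_normK ?num_real//; move: H; lra.
by apply/eqP; rewrite -sqrp_eq1 ?H// mulr_ge0 ?normr_ge0// ltW.
Qed.

Let sz x : z x = 0 -> v x != 0.
Proof. by move=> /EL_simple_zero; case: eqP => // ->; rewrite normr0 mulr0 => /esym/eqP; rewrite oner_eq0. Qed.

Let dT x : is_derive x 1 T (z x ^+ 2 / C). Proof. exact: is_derive_time_change. Qed.

Lemma EL_time_increasing x y : x < y -> T x < T y.
Proof.
apply: (increasing_off_zeros (EL_z S) sz (k := fun x => z x ^+ 2 / C)) => // s zs.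
by rewrite divr_gt0// exprn_even_gt0.
Qed.

Lemma EL_homeo : [/\ cancel T X, cancel X T, continuous X, X 0 = 0 & forall x, X (x + 1) = X x + 1].
Proof.
have [Y [TY YT cY Y0 Y1]] := circle_homeo cT EL_time_increasing (time_change0 z) (time_change_shift cz pz z0).
suff -> : X = Y by [].
by apply/funext => t; have [E _] := inv_time_changeP cz pz z0 t; rewrite -{2}E TY.
Qed.

Let TX : cancel X T. Proof. by have [] := EL_homeo. Qed.
Let XT : cancel T X. Proof. by have [] := EL_homeo. Qed.
Let cX : continuous X. Proof. by have [] := EL_homeo. Qed.

Lemma levi_civita_X t : q t = z (X t) ^+ 2. Proof. exact: levi_civitaE. Qed.

Let zX t : q t != 0 -> z (X t) != 0. Proof. by rewrite levi_civita_X sqrf_eq0. Qed.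

Lemma EL_inv_time_derive t : q t != 0 -> is_derive t 1 X (C / q t).
Proof.
move=> qt; have a0 : z (X t) ^+ 2 / C != 0 by rewrite -levi_civita_X mulf_neq0// invr_neq0.
have -> : C / q t = (z (X t) ^+ 2 / C)^-1 by rewrite invf_div levi_civita_X.
have N (P : R -> Prop) : (forall y, P y) -> \forall y \near X t, P y.
  by move=> H; apply/nbhs_ballP; exists 1 => //= y _; exact: H.
by rewrite -{1}(TX t); apply: is_derive_inverse (dT (X t)) a0; apply: N.
Qed.

(** The derivative of q off the collisions; at a collision, division by zero makes it 0. *)
Let p t := 2 * C * (v (X t) / z (X t)).

Lemma EL_levi_civita_derive t : q t != 0 -> is_derive t 1 q (p t).
Proof.
move=> qt; have -> : q = (fun y => z (X y) ^+ 2) by apply/funext => y; exact: levi_civita_X.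
apply: is_derive_eq (der_sqr (der_comp (EL_z S (X t)) (EL_inv_time_derive qt))) _.
by rewrite levi_civita_X /p; field; rewrite zX.
Qed.

Let dp t : q t != 0 -> is_derive t 1 p (- (2 / q t ^+ 2) + f t).
Proof.
move=> qt; have zt := zX qt.
have D := derZ (2 * C) (derM (der_comp (EL_v S (X t)) (EL_inv_time_derive qt))
  (derV (f := fun y => z (X y)) zt (der_comp (EL_z S (X t)) (EL_inv_time_derive qt)))).
apply: is_derive_eq D _; have En := EL_energy S (X t).
rewrite TX levi_civita_X; apply/eqP; rewrite -subr_eq0; apply/eqP.
set Z := z (X t) in zt En *; set V := v (X t) in En *; set E := e (X t) in En *.
(* What remains of the equation of motion is the energy relation divided by z^4. *)
apply: etrans (_ : (Z ^+ 2 * E - (2 * C ^+ 2 * V ^+ 2 - 2)) / Z ^+ 4 = 0); first by field; rewrite zt.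
by rewrite En subrr mul0r.
Qed.

Lemma open_nonzero k : continuous k -> open (nonzero k).
Proof.
move=> ck; rewrite (_ : nonzero k = k @^-1` [set x | x != 0]) //.
by apply: open_comp; [move=> x _; exact: ck|exact: open_neq].
Qed.

Lemma EL_ode t : q t != 0 -> derive1n 2 q t = - (2 / q t ^+ 2) + f t.
Proof.
move=> qt; rewrite derive1nS -(derive1_val (dp qt)) !derive1E; apply: near_eq_derive.
near=> y; rewrite derive1n1; apply: derive1_val; apply: EL_levi_civita_derive.
near: y; exact: open_near (open_nonzero cq) qt.
Unshelve. all: by end_near. Qed.

Lemma EL_C2 : Ck_on 2 (nonzero q) q.
Proof.
have oq := open_nonzero cq.
apply: (Ck_onSP oq (fun t qt => EL_levi_civita_derive qt)); apply: (Ck_onSP oq (fun t qt => dp qt)).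
apply/Ck_on0 => t qt; apply: cvgD; last exact: cf.
apply: cvgN; apply: cvgM; first exact: cvg_cst.
apply: cvgV; first by rewrite expf_neq0.
exact: (cts_exp (n := 2) cq).
Qed.

Lemma EL_energy_extends : energy_extends q.
Proof.
exists (e \o X); split=> [t||t qt] /=.
- by have [_ _ _ _ ->] := EL_homeo; exact: EL_periodic S _.
- exact: cts_comp.
- rewrite (derive1_val (EL_levi_civita_derive qt)); have En := EL_energy S (X t).
  have zt := zX qt; rewrite levi_civita_X /p.
  apply: (mulfI (expf_neq0 2 zt)); rewrite En; field; exact: zt.
Qed.

Lemma EL_zero_set_finite : finite_set (zero_set z).
Proof.
apply: (simple_zeros_finite (EL_z S) cv); exists C^-1; first by rewrite invr_gt0.
by move=> x /EL_simple_zero H; rewrite -(ler_pM2l z0) H divff.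
Qed.

(** z is periodic with simple zeros, so their number is even, and t_z maps them bijectively onto the
    zeros of q. *)
Lemma EL_even : even_zero_set q.
Proof.
have [|n nE] := simple_zeros_even pz (EL_z S) cv.
  exists C^-1; first by rewrite invr_gt0.
  by move=> x /EL_simple_zero H; rewrite -(ler_pM2l z0) H divff.
exists n; apply: card_eq_trans nE.
have -> : zero_set q = T @` zero_set z.
  have mono x y : (T x < T y) = (x < y).
    have [/EL_time_increasing->//|yx|->] := ltgtP x y; last by rewrite ltxx.
    by apply/negbTE; rewrite -leNgt ltW// EL_time_increasing.
  have memo x y : (T x <= T y) = (x <= y) by rewrite leNgt mono -leNgt.
  have M01 x : (0 <= T x < 1) = (0 <= x < 1).
    by rewrite -{1}(time_change0 z) -{1}(time_change1 z0) memo mono.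
  apply/seteqP; split=> [t [t01 qt]|_ [x [x01 zx] <-]].
    exists (X t) => //; split; first by rewrite /= -M01 TX.
    by apply/eqP; rewrite -sqrf_eq0 -levi_civita_X qt.
  by split; [rewrite M01|rewrite levi_civita_time_change// zx expr0n].
apply: inj_card_eq => x y _ _; exact: (can_inj XT).
Qed.

Lemma EL_regular_time_change : regular_time_change z.
Proof. by split; [exact: EL_zero_set_finite|exact: EL_inv_time_derive]. Qed.

Let qe0 (d : R) t : 0 < d -> 0 < q t + d. Proof. by move=> d0; rewrite ltr_wpDl. Qed.

Let cI k : continuous k -> integrable_on 0 1 k. Proof. exact: continuous_integrable_on. Qed.

(** In the variable tau the integral is C^-1 int z^2 / (z^2 + d), whose integrand is at most 1. *)
Let itg_inv_le d : 0 < d -> itg 0 1 (fun t => (q t + d)^-1) <= C^-1.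
Proof.
move=> d0.
have c1 : continuous (fun t => (q t + d)^-1).
  by apply: cts_inv => [|t]; [apply: cts_add => //; exact: cst_continuous|rewrite lt0r_neq0// qe0].
have c2 : continuous (fun x => z x ^+ 2 * (q (T x) + d)^-1).
  by apply: cts_mul; [exact: cts_exp|exact: (cts_comp c1 cT)].
rewrite (itg_time_change cz z0 c1) -[leRHS]mulr1 ler_wpM2l ?invr_ge0 ?(ltW z0)//.
have E : itg 0 1 (fun=> 1 : R) = 1 by rewrite itg_cst ?ler01// subr0 mul1r.
rewrite -[leRHS]E; apply: itg_le; [exact: cI|apply: cI; exact: cst_continuous|].
move=> x _; rewrite levi_civita_time_change// ler_pdivrMr ?mul1r; last by rewrite ltr_wpDl// sqr_ge0.
by rewrite lerDl ltW.
Qed.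

Lemma EL_inv_integrable : integrable_on 0 1 (fun t => (q t)^-1).
Proof.
(* 1 / (q + 1/(n + 1)) would diverge at the zeros of q, where [(q t)^-1] is 0 by convention. The
   numerator q makes the sequence converge there too and keeps it increasing in n. *)
pose h (n : nat) t := q t / (q t + n.+1%:R^-1) ^+ 2.
have en (n : nat) : 0 < n.+1%:R^-1 :> R by rewrite invr_gt0.
have pos n t : 0 < q t + n.+1%:R^-1 by exact: qe0.
have ch n : continuous (h n).
  apply: cts_mul => //; apply: cts_inv => [|t]; last by rewrite expf_neq0// lt0r_neq0.
  by apply: cts_exp; apply: cts_add => //; exact: cst_continuous.
apply: (@monotone_limit_integrable _ h _ C^-1) => //.
- by move=> n t; rewrite divr_ge0// exprn_ge0// ltW.
- move=> n m t nm; rewrite /h ler_wpM2l// lef_pV2 ?posrE ?exprn_gt0//.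
  rewrite lerXn2r ?nnegrE ?(ltW (pos _ _))// lerD2l lef_pV2 ?posrE//.
  by rewrite ler_nat.
- move=> t; have [E|qt] := eqVneq (q t) 0.
    rewrite E invr0 (_ : (fun n => h n t) = fun=> 0); first exact: cvg_cst.
    by apply/funext => n; rewrite /h E mul0r.
  have -> : (q t)^-1 = q t / (q t + 0) ^+ 2 by rewrite addr0; field.
  apply: cvgM; first exact: cvg_cst.
  apply: cvgV; first by rewrite addr0 expf_neq0.
  rewrite expr2; under eq_fun do rewrite expr2.
  by apply: cvgM; (apply: cvgD; [exact: cvg_cst|exact: cvg_harmonic]).
- move=> n; apply: le_trans (itg_inv_le (en n)).
  apply: itg_le; [exact: cI|apply: cI; apply: cts_inv => [|t]; last by rewrite lt0r_neq0|].
    by apply: cts_add => //; exact: cst_continuous.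
  move=> t _; rewrite /h expr2 invfM mulrA ler_piMl ?invr_ge0 ?(ltW (pos _ _))//.
  by rewrite ler_pdivrMr// mul1r lerDl ltW.
Qed.

(** This is q q', which stays continuous through the collisions. *)
Let W t := 2 * C * (v (X t) * z (X t)).
Let cW : continuous W.
Proof. by apply: cts_scale; apply: cts_mul; exact: cts_comp. Qed.

Let pW t : p t = W t / q t.
Proof.
rewrite /p /W levi_civita_X; have [->|zt] := eqVneq (z (X t)) 0; last by field.
by rewrite invr0 !mulr0 mul0r.
Qed.

Let W2 t : W t ^+ 2 = q t * (2 * q t * e (X t) + 4).
Proof.
have En := EL_energy S (X t); rewrite /W levi_civita_X; set Z := z _ in En *.
have -> : 2 * Z ^+ 2 * e (X t) = 2 * (Z ^+ 2 * e (X t)) by ring.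
by rewrite En; ring.
Qed.

Lemma EL_levi_civita_derive_L2 : in_L2 p.
Proof.
have Ip : integrable_on 0 1 p.
  apply: (eq_integrable_on (f := fun t => W t * (q t)^-1)) => [t _|]; first by rewrite pW.
  exact: integrable_onM EL_inv_integrable.
split; first exact: integrable_on_measurable Ip.
suff : integrable_on 0 1 (fun t => p t ^+ 2) by [].
apply: (eq_integrable_on (f := fun t => (2 * q t * e (X t) + 4) * (q t)^-1)) => [t _|].
  rewrite pW expr_div_n W2; have [->|qt] := eqVneq (q t) 0; last by field.
  by rewrite expr0n invr0 !mulr0.
apply: integrable_onM EL_inv_integrable; apply: cts_add; last exact: cst_continuous.
by apply: cts_mul; [exact: cts_scale|exact: cts_comp].
Qed.

Lemma dist_all_pos a b (K : R) : (forall d, 0 < d -> `|a - b| <= d * K) -> a = b.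
Proof.
move=> H; apply/eqP; rewrite -subr_eq0 -normr_eq0 eq_le normr_ge0 andbT.
rewrite leNgt; apply/negP => n.
have K0 : 0 < K by have := H 1 ltr01; rewrite mul1r; exact: lt_le_trans.
have : 0 < `|a - b| / (2 * K) by rewrite divr_gt0// mulr_gt0.
move=> /H; rewrite leNgt => /negP; apply.
have -> : `|a - b| / (2 * K) * K = `|a - b| / 2 by field; rewrite lt0r_neq0.
by rewrite ltr_pdivrMr// ltr_pMr// ltr1n.
Qed.

(* The change of variables applies to the continuous functions W/(q + d^2), which tend to p. *)
Lemma itg_levi_civita_derive k : continuous k ->
  itg 0 1 (fun t => p t * k t) = itg 0 1 (fun x => 2 * (z x * v x) * k (T x)).
Proof.
move=> ck; have [p1 p2] := EL_levi_civita_derive_L2.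
have Ip : integrable_on 0 1 p := in_L2_integrable EL_levi_civita_derive_L2.
have {}p2 : integrable_on 0 1 (fun t => p t ^+ 2) by [].
have ckT : continuous (fun x => k (T x)) by exact: cts_comp.
have [M M0 MP] := bounded_itv 0 1 ck.
have [N N0 NP] := bounded_itv 0 1 cv.
apply: (@dist_all_pos _ _ (M * (itg 0 1 (fun t => p t ^+ 2) + C^-1) / 2 + M * N)) => d d0.
have d2 : 0 < d ^+ 2 by rewrite exprn_gt0.
pose pd t := W t / (q t + d ^+ 2).
have ci : continuous (fun t => (q t + d ^+ 2)^-1).
  by apply: cts_inv => [|t]; [apply: cts_add => //; exact: cst_continuous|rewrite lt0r_neq0// qe0].
have cpd : continuous pd by exact: cts_mul.
have A : `|itg 0 1 (fun t => p t * k t) - itg 0 1 (fun t => pd t * k t)| <=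
    d * (M * (itg 0 1 (fun t => p t ^+ 2) + C^-1) / 2).
  have I1 : integrable_on 0 1 (fun t => p t * k t).
    by apply: eq_integrable_on (integrable_onM ck Ip) => t _; exact: mulrC.
  have I2 : integrable_on 0 1 (fun t => pd t * k t) by apply/cI/cts_mul.
  have I3 : integrable_on 0 1 (fun t => (d * M / 2) * (p t ^+ 2 + (q t + d ^+ 2)^-1)).
    by apply: integrable_onZ; apply: integrable_onD => //; exact: cI.
  rewrite -(itgB I1 I2).
  apply: le_trans (itg_norm_le (integrable_onB I1 I2) I3 _) _.
    move=> t t01; rewrite -mulrBl normrM.
    have -> : p t - pd t = p t * (d ^+ 2 / (q t + d ^+ 2)).
      rewrite /pd pW; have [E|qt] := eqVneq (q t) 0.
        have Wt : W t = 0 by apply/eqP; rewrite -sqrf_eq0 W2 E mul0r.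
        by rewrite Wt !mul0r subrr.
      have F (w a b : R) : a != 0 -> a + b != 0 -> w / a - w / (a + b) = w / a * (b / (a + b)).
        by move=> a0 ab0; field; rewrite a0 ab0.
      exact: F qt (lt0r_neq0 (qe0 t d2)).
    have i0 : 0 < (q t + d ^+ 2)^-1 by rewrite invr_gt0 qe0.
    have i1 : d ^+ 2 * (q t + d ^+ 2)^-1 <= 1 by rewrite ler_pdivrMr ?qe0// mul1r lerDr.
    rewrite normrM [`|d ^+ 2 / _|]gtr0_norm ?mulr_gt0//.
    move: (MP t t01) i0 i1 (normr_ge0 (k t)) (normr_ge0 (p t)); rewrite -[p t ^+ 2]real_normK ?num_real//.
    set K := `|k t|; set P := `|p t|; set i := (q t + d ^+ 2)^-1 => KM i0 i1 K0 P0.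
    have H : P * (d ^+ 2 * i) <= d / 2 * (P ^+ 2 + i) := regularization_amgm P d0 i0 i1.
    have -> : d * M / 2 * (P ^+ 2 + i) = d / 2 * (P ^+ 2 + i) * M by ring.
    apply: ler_pM => //; apply: mulr_ge0 => //; apply: mulr_ge0; exact: ltW.
  rewrite (itgZ _ (integrable_onD p2 (cI ci))) (itgD p2 (cI ci)).
  have := itg_inv_le d2; set J := itg _ _ _; set Y := itg _ _ _ => JY.
  have -> : d * (M * (Y + C^-1) / 2) = d * M / 2 * (Y + C^-1) by ring.
  by apply: ler_wpM2l; [apply: divr_ge0 => //; apply: mulr_ge0; exact: ltW|rewrite lerD2l].
have B : `|itg 0 1 (fun t => pd t * k t) - itg 0 1 (fun x => 2 * (z x * v x) * k (T x))| <= d * (M * N).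
  have cpk : continuous (fun t => pd t * k t) by exact: cts_mul.
  have cpkT : continuous (fun x => z x ^+ 2 * (pd (T x) * k (T x))).
    by apply: cts_mul; [exact: cts_exp|exact: (cts_comp cpk cT)].
  have cvk : continuous (fun x => 2 * (z x * v x) * k (T x)) by apply: cts_mul => //; apply: cts_scale; exact: cts_mul.
  rewrite (itg_time_change cz z0 cpk) -(itgZ _ (cI cpkT)).
  rewrite -(itgB (integrable_onZ _ (cI cpkT)) (cI cvk)).
  have E1 : itg 0 1 (fun=> d * (M * N)) = d * (M * N) by rewrite itg_cst ?ler01// subr0 mulr1.
  rewrite -[leRHS]E1; apply: itg_norm_le; [apply: integrable_onB; [exact/integrable_onZ/cI|exact: cI]|apply: cI; exact: cst_continuous|].
  move=> x x01; rewrite /pd /W levi_civita_time_change// XT.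
  have zd : 0 < z x ^+ 2 + d ^+ 2 by rewrite ltr_wpDl// sqr_ge0.
  have -> : C^-1 * (z x ^+ 2 * (2 * C * (v x * z x) / (z x ^+ 2 + d ^+ 2) * k (T x))) -
      2 * (z x * v x) * k (T x) = - (v x * k (T x) * (2 * z x * d ^+ 2 / (z x ^+ 2 + d ^+ 2))).
    by field; rewrite n0 lt0r_neq0.
  rewrite normrN normrM mulrC; apply: ler_pM => //; last first.
    rewrite normrM mulrC; apply: ler_pM => //; [exact/MP/time_change_itv01|exact: NP].
  exact: regularization_le.
rewrite mulrDr; apply: le_trans (ler_distD (itg 0 1 (fun t => pd t * k t)) _ _) _.
exact: lerD.
Qed.

(** Pulled back to tau, the weak derivative identity is an integration by parts between z^2 and
    phi(t_z); the boundary terms cancel by periodicity. *)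
Lemma EL_H1 : H1 q.
Proof.
split=> //; first exact: levi_civita_periodic.
exists p; split; first exact: EL_levi_civita_derive_L2.
move=> phi tphi; have [phi01 dphi cdphi aphi] := test_function_C1 tphi.
have cphi : continuous phi := continuous_derive dphi.
rewrite !int01E (itg_levi_civita_derive cphi).
have cqp : continuous (fun t => q t * derive1 phi t) by exact: cts_mul.
rewrite (itg_time_change cz z0 cqp).
have dz2 (x : R) : is_derive x 1 (fun y => z y ^+ 2) (2 * (z x * v x)).
  by apply: is_derive_eq (der_sqr (EL_z S x)) _; ring.
have dpT x := der_comp (dphi (T x)) (dT x).
have czv : continuous (fun x => 2 * (z x * v x)) by apply: cts_scale; exact: cts_mul.
have cpz : continuous (fun x => derive1 phi (T x) * (z x ^+ 2 / C)).
  apply: cts_mul; first exact: cts_comp.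
  by apply: cts_mul; [exact: cts_exp|exact: cst_continuous].
have := itg_parts (C1_AC dz2 czv) (C1_AC dpT cpz).
rewrite (periodic1_10 pz) time_change0 (time_change1 z0) phi01 subrr sub0r => <-.
have c1 : continuous (fun x => z x ^+ 2 * (q (T x) * derive1 phi (T x))).
  by apply: cts_mul; [exact: cts_exp|exact: (cts_comp cqp cT)].
rewrite -(itgZ _ (cI c1)); apply: eq_itg => x _.
rewrite levi_civita_time_change//; ring.
Qed.

End Forward.

(** * From generalized solutions to critical points *)

Section SignAndSquare.
Variable R : realType.
Implicit Types (g w : R -> R) (a b x y d : R).

Lemma near_same_sign g a : {for a, continuous g} -> g a != 0 ->
  exists2 d : R, 0 < d & forall y, `|y - a| < d -> 0 < g y * g a.
Proof.
move=> cg ga; have ga2 : 0 < g a ^+ 2 by rewrite exprn_even_gt0.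
have cm : {for a, continuous (fun y => g y * g a)} by apply: cvgM => //; exact: cvg_cst.
have [d d0 dP] := (continuous_atP _ _).1 cm _ ga2.
exists d => // y /dP; rewrite -expr2 ltr_norml => /andP[H _]; move: H; lra.
Qed.

Lemma same_sign_sg x y : 0 < x * y -> Num.sg x = Num.sg y.
Proof.
have [->|y0|y0] := sgrP y; first by rewrite mulr0 ltxx.
  by rewrite pmulr_lgt0// => x0; rewrite gtr0_sg.
by rewrite nmulr_lgt0// => x0; rewrite ltr0_sg.
Qed.

Lemma sign_transfer (p u s s' x : R) : 0 < s * (s' * x) -> 0 < p * x -> 0 < u * s ->
  0 <= p * u * Num.sg s'.
Proof.
move=> P1 P2 P3; have s'0 : s' != 0 by apply: contraTneq P1 => ->; rewrite mul0r mulr0 ltxx.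
have x0 : x != 0 by apply: contraTneq P2 => ->; rewrite mulr0 ltxx.
have s0 : s != 0 by apply: contraTneq P3 => ->; rewrite mulr0 ltxx.
have n0 : 0 < `|s'| by rewrite normr_gt0.
have x2 : 0 < x ^+ 2 by rewrite exprn_even_gt0.
have s2 : 0 < s ^+ 2 by rewrite exprn_even_gt0.
rewrite -(pmulr_lge0 _ n0) -[_ * _ * `|_|]mulrA -numEsg -(pmulr_lge0 _ x2) -(pmulr_lge0 _ s2).
have -> : p * u * s' * x ^+ 2 * s ^+ 2 = (p * x) * (s * (s' * x)) * (u * s) by ring.
exact: mulr_ge0 (mulr_ge0 (ltW P2) (ltW P1)) (ltW P3).
Qed.

Lemma sqrt_derivative_eq (g w a b c : R) : g ^+ 2 = 1 -> w != 0 -> g != 0 -> c != 0 ->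
  g * ((2 * w)^-1 * (b * (a / c))) = a * b / (2 * c * (g * w)).
Proof.
move=> g2 w0 g0 c0; apply/eqP; rewrite -subr_eq0; apply/eqP.
apply: etrans (_ : (g ^+ 2 - 1) * (a * b / (2 * c * w * g)) = 0).
  by field; rewrite w0 g0 c0.
by rewrite g2 subrr mul0r.
Qed.

(** When w y and w a have the same sign, |w y - w a| |w a| <= |w(y)^2 - w(a)^2|. At a zero of w
    continuity of the square is enough. *)
Lemma continuous_of_sqr w a : {for a, continuous (fun y => w y ^+ 2)} ->
  (w a != 0 -> exists2 d : R, 0 < d & forall y, `|y - a| < d -> 0 <= w y * w a) ->
  {for a, continuous w}.
Proof.
move=> cw sw; apply/continuous_atP => e e0.
have [wa|wa] := eqVneq (w a) 0.
  have e2 : 0 < e ^+ 2 by rewrite exprn_gt0.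
  have [d d0 dP] := (continuous_atP _ _).1 cw _ e2.
  exists d => // y /dP; rewrite wa expr0n !subr0 normrX => H.
  by rewrite -(@ltr_pXn2r _ 2) ?nnegrE ?normr_ge0 ?(ltW e0).
have [d d0 dP] := sw wa; have w0 : 0 < `|w a| by rewrite normr_gt0.
have [d1 d10 dP1] := (continuous_atP _ _).1 cw _ (mulr_gt0 e0 w0).
exists (Num.min d d1) => [|y]; first by rewrite lt_min d0.
rewrite lt_min => /andP[yd yd1]; have S := dP y yd.
have : `|w y - w a| * `|w a| <= `|w y ^+ 2 - w a ^+ 2|.
  rewrite subr_sqr normrM ler_wpM2l//.
  rewrite -(ler_pM2r w0) -!normrM mulrDl -expr2 (ger0_norm (addr_ge0 S (sqr_ge0 _))).
  by rewrite normrX -[leLHS]add0r real_normK ?num_real// lerD.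
move=> /le_lt_trans/(_ (dP1 y yd1)); by rewrite ltr_pM2r.
Qed.

End SignAndSquare.

Section Backward.
Variable R : realType.
Variables q f E : R -> R.
Hypotheses (cq : continuous q) (pq : periodic1 q) (q0 : forall t, 0 <= q t).
Hypotheses (cf : continuous f) (pf : periodic1 f) (cE : continuous E) (pE : periodic1 E).
Hypotheses (C2q : Ck_on 2 (nonzero q) q) (evenq : even_zero_set q).
Hypothesis ode : forall t, nonzero q t -> derive1n 2 q t = - (2 / q t ^+ 2) + f t.
Hypothesis enE : forall t, q t != 0 -> E t = derive1 q t ^+ 2 / 2 - 2 / q t.
Implicit Types (a b c d s t x y : R).
Local Notation q' := (derive1 q).

Let dq t : q t != 0 -> is_derive t 1 q (q' t).
Proof. by move=> qt; exact: Ck_on_is_derive C2q qt. Qed.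

Let ddq t : q t != 0 -> is_derive t 1 q' (- (2 / q t ^+ 2) + f t).
Proof.
move=> qt; have [_ C1] := (Ck_onS _ _ _).1 C2q.
by rewrite -(ode qt) derive1nS derive1n1; exact: Ck_on_is_derive C1 qt.
Qed.

(* The regularized momentum: it extends continuously through the collisions. *)
Let W t := q t * q' t.

Let W2 t : W t ^+ 2 = q t * (2 * q t * E t + 4).
Proof.
rewrite /W; have [->|qt] := eqVneq (q t) 0; first by rewrite !mul0r expr0n.
by rewrite (enE qt); field.
Qed.

Let cW : continuous W.
Proof.
have cW2 : continuous (fun t => W t ^+ 2).
  rewrite (_ : (fun t => _) = (fun t => q t * (2 * q t * E t + 4))); last exact/funext.
  apply: cts_mul => //; apply: cts_add; last exact: cst_continuous.
  by apply: cts_mul => //; exact: cts_scale.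
move=> t; have [qt|qt] := eqVneq (q t) 0.
  by apply: continuous_of_sqr => [|/eqP[]]; [exact: cW2|rewrite /W qt mul0r].
by apply: cvgM; [exact: cq|exact: is_derive_continuous (ddq qt)].
Qed.

Let dW t : q t != 0 -> is_derive t 1 W (2 / q t + (2 * E t + f t * q t)).
Proof.
move=> qt; apply: is_derive_eq (derM (dq qt) (ddq qt)) _.
by rewrite (enE qt); field.
Qed.

Let pW : periodic1 W.
Proof.
move=> t; rewrite /W pq; have [->|qt] := eqVneq (q t) 0; first by rewrite !mul0r.
have qt1 : q (t + 1) != 0 by rewrite pq.
have D := is_derive_shiftD (dq qt1).
have Eq : (fun y => q (y + 1)) = q by apply/funext.
by rewrite Eq in D; rewrite -(derive1_val D).
Qed.

Let cF : continuous (fun t => 2 * E t + f t * q t).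
Proof. by apply: cts_add; [exact: cts_scale|exact: cts_mul]. Qed.

Let pF : periodic1 (fun t => 2 * E t + f t * q t).
Proof. by move=> t; rewrite pE pf pq. Qed.

(** The evenness hypothesis enters here, through the periodicity of S; the sign of S will be the
    sign of the lift. *)
Lemma sine_with_zeros : exists S S' : R -> R, [/\ forall t : R, is_derive t 1 S (S' t),
  forall t, S t = 0 -> S' t != 0, forall t, (S t == 0) = (q t == 0) & periodic1 S].
Proof.
have [m mE] := evenq; have [a aP] := zero_set_enum pq mE.
exists (sine_prod a m.*2), (derive1 (sine_prod a m.*2)); split=> [t|t|t|t].
- by have [] := aP t.
- by have [] := aP t.
- by have [[A B] _ _] := aP t; apply/eqP/eqP.
- by rewrite sine_prod_shift -signr_odd odd_double expr0 mul1r.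
Qed.

(* sigma is a primitive of 1/q off the collisions, defined without improper integrals *)
Let sigma t := (W t - W 0 - prim (fun t => 2 * E t + f t * q t) t) / 2.

(** Y is the inverse of C sigma, with C = 1 / sigma(1) so that a period of t corresponds to a period
    of tau. Its derivative is q(Y) / C off the collisions, and at the collisions as well because
    this expression is continuous. *)
Lemma regularized_time : exists2 C : R, 0 < C & exists Y : R -> R,
  [/\ Y 0 = 0, forall x, Y (x + 1) = Y x + 1, continuous Y, injective Y &
    forall x : R, is_derive x 1 Y (q (Y x) / C)].
Proof.
have [S [S' [dS sS Sq pS]]] := sine_with_zeros.
have dp t := is_derive_prim t cF.
have cs : continuous sigma.
  apply: cts_mul; last exact: cst_continuous.
  apply: cts_sub; last exact: (continuous_derive dp).
  by apply: cts_sub => //; exact: cst_continuous.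
have ds t : q t != 0 -> is_derive t 1 sigma (q t)^-1.
  move=> qt; have D := derM (derB (derB (dW qt) (is_derive_cst (W 0) t 1)) (dp t)) (is_derive_cst (2^-1 : R) t 1).
  rewrite /sigma; apply: is_derive_eq D _.
  by rewrite /= mulr0 addr0 subr0 addrK; field.
have s0 : sigma 0 = 0 by rewrite /sigma prim0 subrr subr0 mul0r.
have is' x y : x < y -> sigma x < sigma y.
  apply: (increasing_off_zeros dS sS (k := fun t => (q t)^-1)) => // t; rewrite Sq; last exact: ds.
  by move=> qt; rewrite invr_gt0 lt_neqAle eq_sym qt q0.
have s1 : 0 < sigma 1 by rewrite -s0; exact: is'.
have shift t : sigma (t + 1) = sigma t + sigma 1.
  have w1 := periodic1_10 pW.
  have E1 := prim_shift1 t cF pF; have E0 := prim_shift1 0 cF pF; rewrite prim0 !add0r in E0.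
  rewrite /sigma pW E1 w1 E0; ring.
pose C := (sigma 1)^-1; exists C; first by rewrite invr_gt0.
have C0 : C != 0 by rewrite invr_neq0// lt0r_neq0.
have [||||Y [hY Yh cY Y0 Y1]] := @circle_homeo R (fun t => C * sigma t).
- exact: cts_scale.
- by move=> x y xy; rewrite ltr_pM2l ?invr_gt0// is'.
- by rewrite s0 mulr0.
- by move=> t; rewrite shift mulrDr mulVf// lt0r_neq0.
have iY : injective Y := can_inj Yh.
have cCs : continuous (fun t => C * sigma t) by exact: cts_scale.
exists Y; split=> // x.
have dY y : q (Y y) != 0 -> is_derive y 1 Y (q (Y y) / C).
  move=> qy; have -> : q (Y y) / C = (C * (q (Y y))^-1)^-1 by apply/esym/invf_div.
  have N (P : R -> Prop) : (forall s, P s) -> \forall s \near Y y, P s.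
    by move=> H; apply/nbhs_ballP; exists 1 => //= s _; exact: H.
  rewrite -{1}(Yh y); apply: is_derive_inverse (derZ C (ds _ qy)) _.
  - by apply: N; exact: hY.
  - apply: N; exact: cCs.
  - by rewrite mulf_neq0// invr_neq0.
have [d d0 dP] := isolated_zero dS sS (Y x).
have [d1 d10 d1P] := (continuous_atP _ _).1 (cY x) _ d0.
apply: (removable_derivative (k := fun y => q (Y y) / C) d10) => //.
- move=> y yd yx; apply: dY; rewrite -Sq; apply: dP; first exact: d1P.
  by apply: contra_neq yx; exact: iY.
- exact: cY.
- suff cqY : continuous (fun y => q (Y y) / C) by exact: cqY.
  by apply: cts_mul; [exact: cts_comp|exact: cst_continuous].
Qed.

(** W vanishes at a collision, and near it W' is positive since the singular term 2 / q dominates: q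
    W' extends continuously with the value 2. *)
Lemma momentum_sign a : q a = 0 -> exists2 d : R, 0 < d &
  forall t, `|t - a| < d -> t != a -> 0 < W t * (t - a).
Proof.
move=> qa; have [S [S' [dS sS Sq pS]]] := sine_with_zeros.
have [d d0 dP] := isolated_zero dS sS a.
have cg : continuous (fun t => 2 + q t * (2 * E t + f t * q t)).
  by apply: cts_add; [exact: cst_continuous|exact: cts_mul].
have ga : 2 + q a * (2 * E a + f a * q a) != 0 by rewrite qa mul0r addr0.
have [d1 d10 d1P] := near_same_sign (cg a) ga.
have Wa : W a = 0 by rewrite /W qa mul0r.
have pos s : `|s - a| < Num.min d d1 -> s != a -> q s != 0 /\ 0 < 2 / q s + (2 * E s + f s * q s).
  rewrite lt_min => /andP[sd sd1] sa; have qs : q s != 0 by rewrite -Sq; exact: dP.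
  split=> //; have := d1P s sd1; rewrite qa mul0r addr0 pmulr_lgt0// => H.
  have qs0 : 0 < q s by rewrite lt_neqAle eq_sym qs q0.
  rewrite -(pmulr_rgt0 _ qs0); apply: lt_le_trans H _.
  have -> : q s * (2 / q s + (2 * E s + f s * q s)) = 2 + q s * (2 * E s + f s * q s) by field.
  exact: lexx.
exists (Num.min d d1); first by rewrite lt_min d0.
move=> t td ta; have [ta'|at'|E'] := ltgtP t a; last by rewrite E' eqxx in ta.
- have [s /andP[ts sa] Es] : exists2 s, s \in `]t, a[ & W a - W t = (2 / q s + (2 * E s + f s * q s)) * (a - t).
    apply: (MVT ta') => [s|]; last exact: continuous_within.
    rewrite in_itv/= => /andP[ts sa]; apply/dW; apply: (pos s _ _).1; last by rewrite lt_eqF.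
    by apply: le_lt_trans td; rewrite !ltr0_norm ?subr_lt0// lerN2 lerD2r ltW.
  rewrite !bnd_simp in ts sa.
  have [|_ P] := pos s _ (negbT (lt_eqF sa)).
    by apply: le_lt_trans td; rewrite !ltr0_norm ?subr_lt0// lerN2 lerD2r ltW.
  rewrite nmulr_lgt0 ?subr_lt0//; move: Es; rewrite Wa sub0r => Es.
  by rewrite -oppr_gt0 Es mulr_gt0// subr_gt0.
- have [s /andP[ts sa] Es] : exists2 s, s \in `]a, t[ & W t - W a = (2 / q s + (2 * E s + f s * q s)) * (t - a).
    apply: (MVT at') => [s|]; last exact: continuous_within.
    rewrite in_itv/= => /andP[ts sa]; apply/dW; apply: (pos s _ _).1; last by rewrite gt_eqF.
    by apply: le_lt_trans td; rewrite !gtr0_norm ?subr_gt0// lerD2r ltW.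
  rewrite !bnd_simp in ts sa.
  have [|_ P] := pos s _ (negbT (gt_eqF ts)).
    by apply: le_lt_trans td; rewrite !gtr0_norm ?subr_gt0// lerD2r ltW.
  rewrite pmulr_lgt0 ?subr_gt0//; move: Es; rewrite Wa subr0 => ->.
  by rewrite mulr_gt0// subr_gt0.
Qed.

Lemma levi_civita_lift : exists z v e : R -> R,
  [/\ H1 z, 0 < sqnorm z, levi_civita z = q & EL_solution z f v e].
Proof.
have [S [S' [dS sS Sq pS]]] := sine_with_zeros.
have [C C0 [Y [Y0 Y1 cY iY dY]]] := regularized_time.
have nC := lt0r_neq0 C0.
have cS : continuous S := continuous_derive dS.
have cqY : continuous (fun x => q (Y x)) by exact: cts_comp.
have cWY : continuous (fun x => W (Y x)) by exact: cts_comp.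
have cSY : continuous (fun x => S (Y x)) by exact: cts_comp.
have cEY : continuous (fun x => E (Y x)) by exact: cts_comp.
have cfY : continuous (fun x => f (Y x)) by exact: cts_comp.
pose z x := Num.sg (S (Y x)) * Num.sqrt (q (Y x)).
have z2 x : z x ^+ 2 = q (Y x).
  rewrite /z exprMn sqr_sqrtr// sqr_sg; case: eqVneq => [/eqP|_] /=; last by rewrite mul1r.
  by rewrite Sq => /eqP ->; rewrite mulr0.
have zE x : (z x == 0) = (q (Y x) == 0) by rewrite -z2 sqrf_eq0.
have zS x : z x != 0 -> 0 < z x * S (Y x).
  rewrite zE => qx; have q1 : 0 < q (Y x) by rewrite lt_neqAle eq_sym qx q0.
  have Sx : S (Y x) != 0 by rewrite Sq.
  by rewrite /z mulrAC -normrEsg mulr_gt0 ?sqrtr_gt0// normr_gt0.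
(* At a zero the energy relation forces |v| = 1 / C, and z changes sign there in the same direction
   as S. *)
pose v x := if z x == 0 then Num.sg (S' (Y x)) / C else W (Y x) / (2 * C * z x).
pose e x := E (Y x).
have zv x : z x * v x = W (Y x) / (2 * C).
  rewrite /v; case: ifPn => [|zx]; last by field; rewrite ?zx ?nC.
  by move=> /eqP zx; rewrite zx /W -z2 zx expr0n !mul0r.
have v2 x : v x ^+ 2 = (q (Y x) * e x + 2) / (2 * C ^+ 2).
  rewrite /v; case: ifPn => [/eqP zx|zx].
    rewrite -z2 zx expr0n mul0r add0r expr_div_n sqr_sg sS ?mul1r; first by field; rewrite ?nC.
    by apply/eqP; rewrite Sq -zE zx.
  rewrite expr_div_n W2 -z2 /e; by field; rewrite ?zx ?nC.
have sgn_z a : z a != 0 -> exists2 d : R, 0 < d & forall y, `|y - a| < d -> 0 < S (Y y) * S (Y a).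
  by move=> za; apply: near_same_sign (cSY a) _; rewrite Sq -zE.
have cz : continuous z.
  move=> a; apply: continuous_of_sqr => [|za].
    by rewrite (_ : (fun y => _) = (fun y => q (Y y))); [exact: cqY|exact/funext].
  have [d d0 dP] := sgn_z a za; exists d => // y yd.
  by rewrite /z (same_sign_sg (dP y yd)) mulrACA -expr2 mulr_ge0 ?sqr_ge0// mulr_ge0 ?sqrtr_ge0.
have zn0 a : z a != 0 -> 2 * C * z a != 0.
  by move=> za; apply: mulf_neq0 za; exact: mulf_neq0.
have cCz : continuous (fun y => 2 * C * z y) by exact: cts_scale.
have vE a : z a != 0 -> v a = W (Y a) / (2 * C * z a) by move=> za; rewrite /v (negbTE za).
have near_nz a : z a != 0 -> \forall y \near a, z y != 0.
  by move=> za; apply: (open_near (open_nonzero cz)).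
have near_v a : z a != 0 -> \forall y \near a, W (Y y) / (2 * C * z y) = v y.
  by move=> za; near do rewrite vE//; exact: near_nz.
have cv : continuous v.
  move=> a; have [za|za] := eqVneq (z a) 0; last first.
    have c1 : {for a, continuous (fun y => W (Y y) / (2 * C * z y))}.
      apply: cvgM; first exact: cWY.
      by apply: cvgV; [exact: zn0|exact: cCz].
    rewrite /continuous_at -(nbhs_singleton (near_v a za)); apply: cvg_trans c1.
    exact/near_eq_cvg/near_v.
  have Sa : S (Y a) = 0 by apply/eqP; rewrite Sq -zE za.
  have qa : q (Y a) = 0 by rewrite -z2 za expr0n.
  have S'a := sS _ Sa.
  (* The square of v is continuous through the collision by the energy relation, so only the sign
     remains; it is that of W z, to be compared with S' (Y a). *)
  apply: continuous_of_sqr => [|va].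
    rewrite (_ : (fun y => _) = (fun x => (q (Y x) * e x + 2) / (2 * C ^+ 2))); last exact/funext.
    by apply: cts_mul; [apply: cts_add; [exact: cts_mul|exact: cst_continuous]|exact: cst_continuous].
  have [d1 d10 d1P] := simple_zero_sign dS sS Sa.
  have [d2 d20 d2P] := momentum_sign qa.
  have m0 : 0 < Num.min d1 d2 by rewrite lt_min d10.
  have [d d0 dP] := (continuous_atP _ _).1 (cY a) _ m0.
  exists d => // y yd; have [->|ya] := eqVneq y a; first by rewrite -expr2 sqr_ge0.
  have := dP y yd; rewrite lt_min => /andP[yd1 yd2].
  have Yya : Y y != Y a by apply: contra_neq ya; exact: iY.
  have P1 := d1P _ yd1 Yya; have P2 := d2P _ yd2 Yya.
  have Sy : S (Y y) != 0 by apply: contraTneq P1 => ->; rewrite mul0r ltxx.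
  have zy : z y != 0 by rewrite zE -Sq.
  have P3 := zS y zy.
  rewrite (vE y zy) /v za eqxx.
  have -> : W (Y y) / (2 * C * z y) * (Num.sg (S' (Y a)) / C) =
     (W (Y y) * z y * Num.sg (S' (Y a))) / (2 * C ^+ 2 * z y ^+ 2) by field; rewrite ?zy ?nC.
  apply: divr_ge0; first exact: sign_transfer P1 P2 P3.
  by apply: mulr_ge0; [apply: mulr_ge0 => //; exact: sqr_ge0|exact: sqr_ge0].
have iso a : exists2 d : R, 0 < d & forall y, `|y - a| < d -> y != a -> z y != 0.
  have [d d0 dP] := isolated_zero dS sS (Y a).
  have [d1 d10 d1P] := (continuous_atP _ _).1 (cY a) _ d0.
  exists d1 => // y yd ya; rewrite zE -Sq; apply: dP; first exact: d1P.
  by apply: contra_neq ya; exact: iY.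
(* All derivatives need to be computed off the isolated zeros of z only. *)
have everywhere (h k : R -> R) : continuous h -> continuous k ->
    (forall x : R, z x != 0 -> is_derive x 1 h (k x)) -> forall x : R, is_derive x 1 h (k x).
  move=> ch ck dh x; have [d d0 dP] := iso x.
  by apply: removable_derivative d0 _ (ch x) (ck x) => y yd yx; apply: dh; exact: dP.
have dz : forall x : R, is_derive x 1 z (v x).
  apply: everywhere => // x zx; have [d d0 dP] := sgn_z x zx.
  have qx : 0 < q (Y x) by rewrite lt_neqAle eq_sym -zE zx q0.
  have D := derZ (Num.sg (S (Y x))) (der_comp (is_derive1_sqrt qx) (der_comp (dq (lt0r_neq0 qx)) (dY x))).
  apply: near_is_derive (_ : is_derive x 1 (fun y => Num.sg (S (Y x)) * Num.sqrt (q (Y y))) _).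
    by apply/nbhs_ballP; exists d => //= y; rewrite /ball/= distrC => /dP/same_sign_sg; rewrite /z => ->.
  apply: is_derive_eq D _; rewrite (vE x zx) /W.
  have zx' : z x = Num.sg (S (Y x)) * Num.sqrt (q (Y x)) by [].
  have g2 : Num.sg (S (Y x)) ^+ 2 = 1 by rewrite sqr_sg Sq -zE zx.
  have s0 : Num.sqrt (q (Y x)) != 0 by rewrite lt0r_neq0// sqrtr_gt0.
  have g0 : Num.sg (S (Y x)) != 0 by rewrite sgr_eq0 Sq -zE.
  by rewrite zx'; apply: sqrt_derivative_eq.
have dv : forall x : R, is_derive x 1 v ((e x + f (Y x) * z x ^+ 2) / (2 * C ^+ 2) * z x).
  apply: everywhere => //.
    apply: cts_mul => //; apply: cts_mul; last exact: cst_continuous.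
    by apply: cts_add => //; apply: cts_mul => //; exact: cts_exp.
  move=> x zx; have qx : q (Y x) != 0 by rewrite -zE.
  have zx2 := zn0 x zx.
  apply: near_is_derive (near_v x zx) _.
  apply: is_derive_eq (derM (der_comp (dW qx) (dY x)) (derV (f := fun y => 2 * C * z y) zx2 (derZ (2 * C) (dz x)))) _.
  have H : W (Y x) * v x = z x * (z x ^+ 2 * e x + 2) / C.
    have := W2 (Y x); have := vE x zx => ->.
    rewrite -z2 => H; rewrite mulrA -expr2 H /e; by field; rewrite ?zx ?nC.
  rewrite (_ : W (Y x) * (- (2 * C * v x) / (2 * C * z x) ^+ 2) = - (W (Y x) * v x) / (2 * C * z x ^+ 2)).
    by rewrite H -z2 -/(e x); field; rewrite ?zx ?nC.
  by field; rewrite ?zx ?nC.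
have de : forall x : R, is_derive x 1 e (2 * f (Y x) * z x * v x).
  apply: everywhere => //.
    by do 2!(apply: cts_mul => //); exact: cts_scale.
  move=> x zx; have qx : q (Y x) != 0 by rewrite -zE.
  have dE : is_derive (Y x) 1 E (f (Y x) * q' (Y x)).
    have D := derB (derM (der_sqr (ddq qx)) (is_derive_cst (2^-1 : R) (Y x) 1)) (derZ 2 (derV qx (dq qx))).
    apply: near_is_derive (_ : is_derive (Y x) 1 (fun t => q' t ^+ 2 * 2^-1 - 2 * (q t)^-1) _).
      near=> t; rewrite enE//; near: t; exact: open_near (open_nonzero cq) qx.
    by apply: is_derive_eq D _; rewrite /=; field.
  apply: is_derive_eq (der_comp dE (dY x)) _.
  have -> : 2 * f (Y x) * z x * v x = 2 * f (Y x) * (z x * v x) by ring.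
  by rewrite zv /W; field; rewrite ?nC.
have pz : periodic1 z by move=> x; rewrite /z Y1 pS pq.
have hz : H1 z := H1_smooth pz dz cv.
have sz : sqnorm z = C.
  rewrite sqnormE (eq_itg (g := fun x => C * (q (Y x) / C))); last by move=> x _; rewrite z2; field; rewrite ?nC.
  have cYd : continuous (fun x => q (Y x) / C) by apply: cts_mul => //; exact: cst_continuous.
  rewrite itgZ; last exact: continuous_integrable_on.
  have [_ _ /(_ 1)] := C1_AC dY cYd; rewrite ler01 lexx Y0 add0r => /(_ isT) <-.
  by rewrite -[1]add0r Y1 Y0 add0r mulr1.
have sz0 : 0 < sqnorm z by rewrite sz.
have TY x : time_change z x = Y x.
  apply: (@eq_of_derive R _ _ (fun x => q (Y x) / C)) => //; last by rewrite time_change0 Y0.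
  by move=> y; rewrite -z2 -sz; exact: is_derive_time_change.
exists z, v, e; split=> //.
- apply/funext => t; rewrite levi_civitaE z2 -TY.
  by have [-> _] := inv_time_changeP cz pz sz0 t.
- split=> // x; rewrite ?TY ?sz//.
  + by rewrite v2 z2; field; rewrite ?nC.
  + by rewrite /e Y1 pE.
Unshelve. all: by end_near. Qed.

End Backward.

(** * Uniqueness of the lift up to sign *)

Section Uniqueness.
Variable R : realType.
Implicit Types (z w f k v e : R -> R).

(** Each inverse time change divided by its C has derivative 1/q off the collisions and vanishes at
    0, so the two quotients agree, and their values at 1 give equal C. Then z = w or z = - w
    pointwise; simplicity of the zeros makes the sign global. *)
Lemma EL_unique z w f k v v1 e e1 : H1 z -> H1 w -> 0 < sqnorm z -> 0 < sqnorm w ->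
  EL_solution z f v e -> EL_solution w k v1 e1 -> levi_civita z = levi_civita w ->
  z = w \/ z = (fun x => - w x).
Proof.
move=> hz hw z0 w0 Sz Sw zw.
have cz := H1_continuous hz; have pz := H1_periodic hz.
have cw := H1_continuous hw; have pw := H1_periodic hw.
have [TX XT cX X0 X1] := EL_homeo hz z0 Sz; have [TY YT cY Y0 Y1] := EL_homeo hw w0 Sw.
set X := inv_time_change z in TX XT cX X0 X1; set Y := inv_time_change w in TY YT cY Y0 Y1.
have [m mE] := EL_even hz z0 Sz; have pq := levi_civita_periodic cz pz z0.
have [a aP] := zero_set_enum pq mE.
have cst_derive : forall t : R, is_derive t 1 (fun t => (sqnorm z)^-1 * X t - (sqnorm w)^-1 * Y t) 0.
  apply: (@derive_off_zeros R (sine_prod a m.*2) (derive1 (sine_prod a m.*2)) _ _ _ (fun=> 0)) => [t|t|||t St].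
  - by have [] := aP t.
  - by have [] := aP t.
  - by apply: cts_sub; exact: cts_scale.
  - exact: cst_continuous.
  have qz : levi_civita z t != 0 by apply: contra_neq St; have [[_ B] _ _] := aP t.
  have qw : levi_civita w t != 0 by rewrite -zw.
  apply: is_derive_eq (derB (derZ _ (EL_inv_time_derive hz z0 Sz qz)) (derZ _ (EL_inv_time_derive hw w0 Sw qw))) _.
  by rewrite !mulKf ?lt0r_neq0// zw subrr.
have EXY t : (sqnorm z)^-1 * X t = (sqnorm w)^-1 * Y t.
  apply/eqP; rewrite -subr_eq0; apply/eqP.
  apply: (@eq_of_derive R _ (fun=> 0) (fun=> 0) cst_derive).
  by rewrite X0 Y0 !mulr0 subrr.
have CC : sqnorm z = sqnorm w.
  have := EXY 1; rewrite -[1]add0r X1 Y1 X0 Y0 !add0r !mulr1.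
  exact: invr_inj.
have XY t : X t = Y t.
  by have := EXY t; rewrite CC => /mulfI; apply; rewrite invr_neq0// lt0r_neq0.
have TT x : time_change z x = time_change w x by rewrite -{2}(TX x) XY YT.
have z2 x : z x ^+ 2 = w x ^+ 2.
  by rewrite -(levi_civita_time_change cz pz z0) -(levi_civita_time_change cw pw w0) TT zw.
have sz x : z x = 0 -> v x != 0.
  by move=> /(EL_simple_zero z0 Sz); case: eqP => // ->; rewrite normr0 mulr0 => /esym/eqP; rewrite oner_eq0.
have sw x : w x = 0 -> v1 x != 0.
  by move=> /(EL_simple_zero w0 Sw); case: eqP => // ->; rewrite normr0 mulr0 => /esym/eqP; rewrite oner_eq0.
have E0 x : (z x == 0) = (w x == 0) by rewrite -sqrf_eq0 z2 sqrf_eq0.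
have pm x : z x = w x \/ z x = - w x.
  by have /eqP := z2 x; rewrite eqf_sqr => /orP[]/eqP; [left|right].
have [H|H] := simple_zero_ratio (EL_z Sz) sz (EL_z Sw) sw E0; [left|right]; apply/funext => x.
  have [//|E] := pm x; have := H x; rewrite E mulNr oppr_ge0 -expr2 => H'.
  have /eqP : w x ^+ 2 = 0 by apply/eqP; rewrite eq_le H' sqr_ge0.
  by rewrite sqrf_eq0 => /eqP ->; rewrite oppr0.
have [E|//] := pm x; have := H x; rewrite E -expr2 => H'.
have /eqP : w x ^+ 2 = 0 by apply/eqP; rewrite eq_le H' sqr_ge0.
by rewrite sqrf_eq0 => /eqP ->; rewrite oppr0.
Qed.

End Uniqueness.

(** * The 4-to-1 correspondence *)

Section Assembly.
Variable R : realType.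
Variable r : R.
Local Notation pair2 := ((R -> R) * (R -> R))%type.
Implicit Types (z q : pair2) (w f v e : R -> R) (t x : R).

Let rhs q t := r / (q.1 t - q.2 t) ^+ 2 + (1 - r) / (itg 0 1 q.1 - itg 0 1 q.2) ^+ 2.

(** A bootstrap off all collisions: the right-hand sides are as smooth as the pair, so the equations
    raise its regularity. Each force involves both components, which must therefore advance
    together. *)
Lemma interpolated_system_smooth q : (forall t, q.2 t < q.1 t) ->
  Ck_on 2 (nonzero q.1) q.1 -> Ck_on 2 (nonzero q.2) q.2 ->
  continuous q.1 -> continuous q.2 ->
  (forall t, nonzero q.1 t -> derive1n 2 q.1 t = - (2 / q.1 t ^+ 2) + rhs q t) ->
  (forall t, nonzero q.2 t -> derive1n 2 q.2 t = - (2 / q.2 t ^+ 2) + - rhs q t) ->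
  forall k, Ck_on k (nonzero q.1 `&` nonzero q.2) q.1 /\ Ck_on k (nonzero q.1 `&` nonzero q.2) q.2.
Proof.
move=> lt12 C1 C2 c1 c2 o1 o2; set A := _ `&` _.
have oA : open A by apply: openI; exact: open_nonzero.
have A1 t : A t -> q.1 t != 0 by case.
have A2 t : A t -> q.2 t != 0 by case.
have gap0 t : q.1 t - q.2 t != 0 by rewrite lt0r_neq0// subr_gt0.
have step (f g : R -> R) k : (A `<=` nonzero f) -> Ck_on 2 (nonzero f) f ->
    (forall t, nonzero f t -> derive1n 2 f t = - (2 / f t ^+ 2) + g t) ->
    Ck_on k A f -> Ck_on k A g -> Ck_on k.+2 A f.
  move=> Af Cf odef kf kg.
  apply: (@Ck_onSP _ _ A f (derive1 f)) => // [t /Af|]; first exact: Ck_on_is_derive Cf.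
  apply: (@Ck_onSP _ _ A (derive1 f) (fun t => - (2 / f t ^+ 2) + g t)) => // [t /Af ft|].
    have [_ Cf'] := (Ck_onS _ _ _).1 Cf.
    by rewrite -(odef t ft) derive1nS derive1n1; exact: Ck_on_is_derive Cf' ft.
  apply: Ck_onD => //.
  apply: (@Ck_on_ext _ _ A (fun t => - 2 * (f t ^+ 2)^-1)) => // [t _|]; first by rewrite mulNr.
  apply: Ck_onZ => //; apply: Ck_onV => // [t /Af ft|]; first by rewrite expf_neq0.
  exact: Ck_onX.
have Crhs k : Ck_on k A q.1 -> Ck_on k A q.2 -> Ck_on k A (rhs q).
  move=> k1 k2; apply: Ck_onD => //; last exact: Ck_on_cst.
  apply: Ck_onZ => //; apply: Ck_onV => // [t _|]; first by rewrite expf_neq0.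
  apply: Ck_onX => //; apply: Ck_onD => //.
  apply: (@Ck_on_ext _ _ A (fun t => - 1 * q.2 t)) => // [t _|]; first by rewrite mulN1r.
  exact: Ck_onZ.
elim=> [|k [k1 k2]]; first by split; apply/Ck_on0 => t _; [exact: c1|exact: c2].
have kf := Crhs k k1 k2.
split; apply: Ck_onW.
  by apply: (step q.1 (rhs q)) => // t [].
apply: (step q.2 (fun t => - rhs q t)) => //.
apply: (@Ck_on_ext _ _ A (fun t => - 1 * rhs q t)) => // [t _|]; first by rewrite mulN1r.
exact: Ck_onZ.
Qed.

Lemma critical_generalized z : critical_point (@H1_in R) (B_r r) z ->
  generalized_solution r (LC z) /\ (regular_time_change z.1 /\ regular_time_change z.2).
Proof.
move=> cz; have zin : H1_in z by case: cz.
have [[h1 h2] s1 s2 lt12] := (H1_inP z).1 zin.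
have cf : continuous (force r z) by exact: force_continuous.
have cNf : continuous (fun t => - force r z t) by exact: cts_opp.
have [[v1 [e1 S1]] [v2 [e2 S2]]] := (critical_EL r zin).1 cz.
split; last by split; [exact: EL_regular_time_change S1|exact: EL_regular_time_change S2].
have [c1 p1] := (H1_continuous h1, H1_periodic h1).
have [c2 p2] := (H1_continuous h2, H1_periodic h2).
have o1 := EL_ode h1 s1 S1; have o2 := EL_ode h2 s2 S2.
have C1 := EL_C2 h1 s1 cf S1; have C2 := EL_C2 h2 s2 cNf S2.
have B := @interpolated_system_smooth (LC z) lt12 C1 C2 (levi_civita_continuous c1 p1 s1)
  (levi_civita_continuous c2 p2 s2) o1 o2.
split.
- by split; [exact: EL_H1 S1|exact: EL_H1 S2].
- by move=> t; split; exact: levi_civita_ge0.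
- exact: lt12.
- by split; [exact: EL_even S1|exact: EL_even S2].
split.
- move=> w [->|->]; split=> // k; by have [] := B k.
- move=> t qt; rewrite /interpolated_system1 !int01E (o1 t qt) /force /=; ring.
- move=> t qt; rewrite /interpolated_system2 !int01E (o2 t qt) /force /=; ring.
- by split; [exact: EL_energy_extends S1|exact: EL_energy_extends S2].
Qed.

Definition flip (b : bool) w x : R := if b then - w x else w x.

Lemma flip_sqr b w x : flip b w x ^+ 2 = w x ^+ 2.
Proof. by case: b; rewrite /flip ?sqrrN. Qed.

Lemma sqnorm_flip b w : sqnorm (flip b w) = sqnorm w.
Proof. by rewrite !sqnormE; apply: eq_itg => x _; exact: flip_sqr. Qed.

Lemma H1_flip b w : H1 w -> H1 (flip b w).
Proof.
move=> hw; case: b => //; rewrite (_ : flip true w = (fun x => - 1 * w x)); first exact: H1Z.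
by apply/funext => x; rewrite mulN1r.
Qed.

Lemma time_change_flip b w : 0 < sqnorm w -> continuous w -> time_change (flip b w) = time_change w.
Proof.
move=> w0 cw; have cb : continuous (flip b w) by case: b => //; exact: cts_opp.
apply/funext => x; apply: (@eq_of_derive R _ _ (fun x => w x ^+ 2 / sqnorm w)) => [y|y|].
- by rewrite -(flip_sqr b) -(sqnorm_flip b); apply: is_derive_time_change => //; rewrite sqnorm_flip.
- exact: is_derive_time_change.
- by rewrite !time_change0.
Qed.

Lemma levi_civita_flip b w : 0 < sqnorm w -> continuous w -> levi_civita (flip b w) = levi_civita w.
Proof.
move=> w0 cw; apply/funext => t; rewrite !levi_civitaE flip_sqr.
by rewrite /inv_time_change time_change_flip.
Qed.

Lemma EL_flip b w f v e : 0 < sqnorm w -> continuous w -> EL_solution w f v e ->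
  EL_solution (flip b w) f (flip b v) e.
Proof.
move=> w0 cw [dz dv de en pe]; split=> // x; rewrite ?(time_change_flip b w0 cw) ?sqnorm_flip ?flip_sqr.
- case: b; last exact: dz.
  exact: derN (dz x).
- case: b; last exact: dv.
  by apply: is_derive_eq (derN (dv x)) _; rewrite /flip mulrN.
- by case: b; apply: is_derive_eq (de x) _; rewrite /flip ?mulrN ?mulNr ?opprK.
- exact: en.
Qed.

Lemma flip_inj b1 b2 w : 0 < sqnorm w -> flip b1 w = flip b2 w -> b1 = b2.
Proof.
move=> w0 E; have W : (fun x => - w x) <> w.
  move=> E'; have w00 x : w x = 0 by have := congr1 (fun f => f x) E' => /= /eqP; rewrite eq_sym -addr_eq0 -mulr2n mulrn_eq0 => /eqP.
  move: w0; rewrite sqnormE (eq_itg (g := fun=> 0)); last by move=> x _; rewrite w00 expr0n.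
  by rewrite itg_cst ?ler01// mul0r ltxx.
by case: b1 b2 E => -[] // E; case: W; rewrite [RHS]E.
Qed.

(** On the fiber over q the force is the fixed function [rhs q], so the two components solve
    separate one-body problems and their signs can be chosen independently. *)
Lemma fiber_card q : generalized_solution r q ->
  ([set z | critical_point (@H1_in R) (B_r r) z /\ LC z = q] #= `I_4)%card.
Proof.
move=> [[h1 h2] q0 lt12 [ev1 ev2] [reg o1 o2 [[E1 [pE1 cE1 En1]] [E2 [pE2 cE2 En2]]]]].
have [C1 _] := reg q.1 (or_introl erefl); have [C2 _] := reg q.2 (or_intror erefl).
have [c1 p1] := (H1_continuous h1, H1_periodic h1).
have [c2 p2] := (H1_continuous h2, H1_periodic h2).
have cf : continuous (rhs q).
  apply: cts_add; last exact: cst_continuous.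
  apply: cts_scale; apply: cts_inv => [|t]; first by apply: cts_exp; exact: cts_sub.
  by rewrite expf_neq0// lt0r_neq0// subr_gt0.
have pf : periodic1 (rhs q) by move=> t; rewrite /rhs p1 p2.
have cNf : continuous (fun t => - rhs q t) by exact: cts_opp.
have pNf : periodic1 (fun t => - rhs q t) by move=> t; rewrite pf.
have o1' t : nonzero q.1 t -> derive1n 2 q.1 t = - (2 / q.1 t ^+ 2) + rhs q t.
  by move=> qt; rewrite (o1 t qt) /rhs !int01E; ring.
have o2' t : nonzero q.2 t -> derive1n 2 q.2 t = - (2 / q.2 t ^+ 2) + - rhs q t.
  by move=> qt; rewrite (o2 t qt) /rhs !int01E; ring.
have [z1 [v1 [e1 [hz1 s1 L1 S1]]]] :=
  levi_civita_lift c1 p1 (fun t => (q0 t).1) cf pf cE1 pE1 C1 ev1 o1' En1.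
have [z2 [v2 [e2 [hz2 s2 L2 S2]]]] :=
  levi_civita_lift c2 p2 (fun t => (q0 t).2) cNf pNf cE2 pE2 C2 ev2 o2' En2.
have cz1 := H1_continuous hz1; have cz2 := H1_continuous hz2.
(* The two binary digits of i < 4 are the two signs. *)
pose F (i : nat) : pair2 := (flip (odd i) z1, flip (1 < i)%N z2).
have -> : [set z | critical_point (@H1_in R) (B_r r) z /\ LC z = q] = F @` `I_4.
  apply/seteqP; split=> [z [cz Lz]|_ [i _ <-]].
    have zin : H1_in z by case: cz.
    have [[g1 g2] t1 t2 _] := (H1_inP z).1 zin.
    have [[u1 [d1 Z1]] [u2 [d2 Z2]]] := (critical_EL r zin).1 cz.
    have l1 : levi_civita z.1 = levi_civita z1 by rewrite L1 -Lz.
    have l2 : levi_civita z.2 = levi_civita z2 by rewrite L2 -Lz.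
    have [b1 B1] : exists b, z.1 = flip b z1.
      by have [->|->] := EL_unique g1 hz1 t1 s1 Z1 S1 l1; [exists false|exists true].
    have [b2 B2] : exists b, z.2 = flip b z2.
      by have [->|->] := EL_unique g2 hz2 t2 s2 Z2 S2 l2; [exists false|exists true].
    exists (b1 + b2.*2)%N; first by rewrite /=; case: b1 {B1}; case: b2 {B2}.
    by rewrite [z]surjective_pairing B1 B2 /F; case: b1 {B1}; case: b2 {B2}.
  have LF : LC (F i) = q.
    by rewrite /LC /F /= !levi_civita_flip// L1 L2 -surjective_pairing.
  have ff : force r (F i) = rhs q.
    by apply/funext => t; rewrite /force /F /= !levi_civita_flip// L1 L2.
  have Fin : H1_in (F i).
    apply/H1_inP; rewrite /F /= !sqnorm_flip; split=> //.
      by split; exact: H1_flip.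
    by move=> t; rewrite !levi_civita_flip// L1 L2.
  split=> //; apply/(critical_EL r Fin); rewrite ff; split.
    by exists (flip (odd i) v1), e1; exact: EL_flip.
  by exists (flip (1 < i)%N v2), e2; exact: EL_flip.
apply: inj_card_eq => i j; rewrite !inE => i4 j4 [/(flip_inj s1) E1' /(flip_inj s2) E2'].
by move: i4 j4 E1' E2' {F}; case: i => [|[|[|[|i]]]] // _; case: j => [|[|[|[|j]]]].
Qed.

End Assembly.

Theorem theoremA (R : realType) (r : R) (hr : 0 <= r <= 1) :
  (forall z : (R -> R) * (R -> R), critical_point (@H1_in R) (B_r r) z ->
     regular_time_change z.1 /\ regular_time_change z.2) /\
  k_to_one 4 [set z | critical_point (@H1_in R) (B_r r) z]
    (generalized_solution r) (@LC R).
Proof.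
split=> [z /critical_generalized[]//|].
by split=> [z /critical_generalized[]//|q]; exact: fiber_card.
Qed.
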